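(* Let $X=C([0,1])$ be equipped with the supremum norm $\|\cdot\|_\infty$ and let $\mu>0$. Let $A_\mu f:=f_{xx}-\mu f$ with domain $D(A_\mu):=\{f\in C^2([0,1]): f'(0)=f'(1)=0\}$. Let $p\in C^1([0,1])$ be a real-valued function with $p(0)=p(1)=0$ and $p_x(x)\ge-2\mu$ for all $x\in[0,1]$, and let $Bf:=p\,f_x$ with domain $D(B):=C^1([0,1])$. Then the operator $A_\mu+B$ generates a uniformly exponentially stable analytic semigroup $(e^{t(A_\mu+B)})_{t\ge0}$ on $X$.
   Context: Functions in $X$ are complex-valued. Subscripts $x$ denote derivatives. The operator $A_\mu+B$ has domain $D(A_\mu)$. A $C_0$-semigroup $(T(t))_{t\ge0}$ on $X$ is uniformly exponentially stable if there are $M\ge1$, $\omega>0$ with $\|T(t)\|_{\mathcal L(X)}\le Me^{-\omega t}$ for all $t\ge0$. *)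

(* Defs.v *)
From Stdlib Require Import Reals Lra.
From Stdlib Require Import ClassicalEpsilon FunctionalExtensionality
  PropExtensionality ProofIrrelevance.
From Coquelicot Require Import Coquelicot.
Open Scope R_scope.



Definition UI : Type := {x : R | 0 <= x <= 1}.
Definition UI_val (x : UI) : R := proj1_sig x.
Coercion UI_val : UI >-> R.

Definition UI0 : UI := exist _ 0 (conj (Rle_refl 0) Rle_0_1).
Definition UI1 : UI := exist _ 1 (conj Rle_0_1 (Rle_refl 1)).

Definition UI_UniformSpace_mixin : UniformSpace.mixin_of UI :=
  UniformSpace.Mixin UI UI0 (fun x e y => ball (x : R) e (y : R))
    (fun x e => ball_center (x : R) e)
    (fun x y e => ball_sym (x : R) (y : R) e)
    (fun x y z e1 e2 => ball_triangle (x : R) (y : R) (z : R) e1 e2).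
Canonical UI_UniformSpace := UniformSpace.Pack UI UI_UniformSpace_mixin UI.

Record CUI : Type := mkCUI {
  CUI_fun :> UI -> C;
  CUI_cont : forall x : UI, continuous CUI_fun x
}.

Lemma CUI_ext (f g : CUI) : (forall x, f x = g x) -> f = g.
Proof.
destruct f as [f hf], g as [g hg]; simpl; intros E.
assert (f = g) by (now apply functional_extensionality); subst g.
f_equal; apply proof_irrelevance.
Qed.

Lemma continuous_UI_Cmod (f : UI -> C) (x : UI) :
  continuous f x <->
  forall eps, 0 < eps -> exists d, 0 < d /\
    forall y : UI, Rabs (y - x) < d -> Cmod (f y - f x)%C < eps.
Proof.
unfold continuous.
rewrite (filterlim_locally_ball_norm (K := C_AbsRing) (U := C_NormedModule)).
split.
- intros h eps he; destruct (h (mkposreal eps he)) as [d hd].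
  exists d; split; [apply cond_pos | exact hd].
- intros h eps; destruct (h eps (cond_pos eps)) as [d [hd H]].
  exists (mkposreal d hd); exact H.
Qed.

Definition CUI_plus (f g : CUI) : CUI :=
  mkCUI (fun x => plus (f x) (g x))
    (fun x => continuous_plus (V := C_NormedModule) f g x
                (CUI_cont f x) (CUI_cont g x)).
Definition CUI_opp (f : CUI) : CUI :=
  mkCUI (fun x => opp (f x))
    (fun x => continuous_opp (V := C_NormedModule) f x (CUI_cont f x)).
Definition CUI_scal (c : C) (f : CUI) : CUI :=
  mkCUI (fun x => scal c (f x))
    (fun x => continuous_scal_r (V := C_NormedModule) c f x (CUI_cont f x)).
Definition CUI_zero : CUI :=
  mkCUI (fun _ => zero) (fun x => continuous_const (zero : C) x).

Definition CUI_AbelianMonoid_mixin : AbelianMonoid.mixin_of CUI.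
Proof.
apply (AbelianMonoid.Mixin CUI CUI_plus CUI_zero); intros; apply CUI_ext;
  intros t; simpl.
- apply plus_comm.
- apply plus_assoc.
- apply plus_zero_r.
Defined.
Canonical CUI_AbelianMonoid :=
  AbelianMonoid.Pack CUI CUI_AbelianMonoid_mixin CUI.

Definition CUI_AbelianGroup_mixin : AbelianGroup.mixin_of CUI_AbelianMonoid.
Proof.
apply (AbelianGroup.Mixin CUI_AbelianMonoid CUI_opp).
intros f; apply CUI_ext; intros x; apply (plus_opp_r (G := C_AbelianGroup)).
Defined.
Canonical CUI_AbelianGroup := AbelianGroup.Pack CUI
  (AbelianGroup.Class _ CUI_AbelianMonoid_mixin CUI_AbelianGroup_mixin) CUI.

Definition CUI_ModuleSpace_mixin :
  ModuleSpace.mixin_of C_Ring CUI_AbelianGroup.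
Proof.
apply (ModuleSpace.Mixin C_Ring CUI_AbelianGroup CUI_scal); intros;
  apply CUI_ext; intros t; simpl.
- apply (scal_assoc (V := C_ModuleSpace)).
- apply (scal_one (V := C_ModuleSpace)).
- apply (scal_distr_l (V := C_ModuleSpace)).
- apply (scal_distr_r (V := C_ModuleSpace)).
Defined.
Canonical CUI_ModuleSpace := ModuleSpace.Pack C_Ring CUI
  (ModuleSpace.Class C_Ring CUI (AbelianGroup.class CUI_AbelianGroup)
     CUI_ModuleSpace_mixin) CUI.

Definition sup_norm (f : CUI) : R :=
  real (Lub_Rbar (fun r => exists x : UI, r = Cmod (f x))).

Lemma CUI_bounded (f : CUI) : exists M, forall x : UI, Cmod (f x) <= M.
Proof.
set (pr := fun x : R => Rmax 0 (Rmin 1 x)).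
assert (hpr : forall x, 0 <= pr x <= 1).
{ intros x; unfold pr; split; [apply Rmax_l |].
  apply Rmax_lub; [lra | apply Rmin_l]. }
assert (hlip : forall x y, Rabs (pr y - pr x) <= Rabs (y - x)).
{ intros x y; unfold pr, Rmax, Rmin.
  repeat destruct (Rle_dec _ _); unfold Rabs;
    repeat destruct (Rcase_abs _); lra. }
set (g := fun x : R => Cmod (f (exist _ (pr x) (hpr x)))).
destruct (continuity_ab_maj g 0 1) as [m [hm _]].
- lra.
- intros c _; apply continuity_pt_filterlim.
  apply filterlim_locally; intros eps.
  destruct (proj1 (continuous_UI_Cmod f (exist _ (pr c) (hpr c)))
    (CUI_cont f _) eps (cond_pos eps)) as [d [hd H]].
  exists (mkposreal d hd); intros y hy.
  assert (K : Cmod (f (exist _ (pr y) (hpr y)) -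
                    f (exist _ (pr c) (hpr c)))%C < eps).
  { apply H; simpl; apply Rle_lt_trans with (1 := hlip c y); exact hy. }
  apply Rle_lt_trans with (2 := K).
  apply (norm_triangle_inv (V := C_NormedModule)).
- exists (g m); intros [x hx].
  assert (E : exist (fun x => 0 <= x <= 1) x hx = exist _ (pr x) (hpr x)).
  { apply subset_eq_compat; unfold pr.
    rewrite Rmin_right, Rmax_right; lra. }
  rewrite E; apply (hm x hx).
Qed.

Lemma sup_norm_lub (f : CUI) :
  is_lub_Rbar (fun r => exists x : UI, r = Cmod (f x)) (sup_norm f).
Proof.
unfold sup_norm.
destruct (CUI_bounded f) as [M hM].
pose proof (Lub_Rbar_correct (fun r => exists x : UI, r = Cmod (f x))) as H.
destruct (Lub_Rbar _) as [r | |]; [exact H | |]; exfalso; destruct H as [h1 h2].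
- apply (h2 M); intros r [x ->]; apply hM.
- apply (h1 (Cmod (f UI0))); now exists UI0.
Qed.

Lemma sup_norm_ub (f : CUI) (x : UI) : Cmod (f x) <= sup_norm f.
Proof. apply (proj1 (sup_norm_lub f) (Cmod (f x))); now exists x. Qed.

Lemma sup_norm_le (f : CUI) (M : R) :
  (forall x, Cmod (f x) <= M) -> sup_norm f <= M.
Proof.
intros h; apply (proj2 (sup_norm_lub f) M); intros r [x ->]; apply h.
Qed.

Lemma sup_norm_plus (f g : CUI) :
  sup_norm (plus f g) <= sup_norm f + sup_norm g.
Proof.
apply sup_norm_le; intros x; apply Rle_trans with (1 := Cmod_triangle _ _).
apply Rplus_le_compat; apply sup_norm_ub.
Qed.

Lemma sup_norm_scal (c : C) (f : CUI) :
  sup_norm (scal c f) <= Cmod c * sup_norm f.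
Proof.
apply sup_norm_le; intros x; simpl.
change (Cmod (c * f x)%C <= Cmod c * sup_norm f); rewrite Cmod_mult.
apply Rmult_le_compat_l; [apply Cmod_ge_0 | apply sup_norm_ub].
Qed.

Lemma sup_norm_eq0 (f : CUI) : sup_norm f = 0 -> f = zero.
Proof.
intros h; apply CUI_ext; intros x; apply Cmod_eq_0.
apply Rle_antisym; [rewrite <- h; apply sup_norm_ub | apply Cmod_ge_0].
Qed.

Lemma sup_norm_zero : sup_norm zero = 0.
Proof.
apply Rle_antisym.
- apply sup_norm_le; intros x; simpl.
  change (Cmod 0 <= 0); rewrite Cmod_0; lra.
- apply Rle_trans with (2 := sup_norm_ub zero UI0); apply Cmod_ge_0.
Qed.

Lemma sup_norm_minus_sym (f g : CUI) :
  sup_norm (minus f g) = sup_norm (minus g f).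
Proof.
assert (H : forall f g : CUI, sup_norm (minus f g) <= sup_norm (minus g f)).
{ clear; intros f g; apply sup_norm_le; intros x.
  apply Rle_trans with (2 := sup_norm_ub (minus g f) x).
  right; rewrite <- Cmod_opp; f_equal.
  change (- (f x - g x) = g x - f x)%C; ring. }
now apply Rle_antisym.
Qed.

Definition CUI_UniformSpace_mixin : UniformSpace.mixin_of CUI.
Proof.
apply (UniformSpace.Mixin CUI CUI_zero
  (fun f e g => sup_norm (minus g f) < e)).
- intros f e; rewrite (minus_eq_zero f : minus f f = CUI_zero).
  rewrite (sup_norm_zero : sup_norm CUI_zero = 0); apply cond_pos.
- intros f g e h; now rewrite sup_norm_minus_sym.
- intros f g h e1 e2 h1 h2.
  rewrite (minus_trans g).
  apply Rle_lt_trans with (1 := sup_norm_plus _ _); lra.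
Defined.
Canonical CUI_UniformSpace :=
  UniformSpace.Pack CUI CUI_UniformSpace_mixin CUI.

Canonical CUI_NormedModuleAux := NormedModuleAux.Pack C_AbsRing CUI
  (NormedModuleAux.Class C_AbsRing CUI
     (ModuleSpace.class C_Ring CUI_ModuleSpace)
     (UniformSpace.class CUI_UniformSpace)) CUI.

Definition CUI_NormedModule_mixin :
  NormedModule.mixin_of C_AbsRing CUI_NormedModuleAux.
Proof.
apply (NormedModule.Mixin C_AbsRing CUI_NormedModuleAux sup_norm 1).
- apply sup_norm_plus.
- apply sup_norm_scal.
- intros f g e h; exact h.
- intros f g e h; rewrite Rmult_1_l; exact h.
- apply sup_norm_eq0.
Defined.
Canonical CUI_NormedModule := NormedModule.Pack C_AbsRing CUI
  (NormedModule.Class C_AbsRing CUI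
     (NormedModuleAux.class C_AbsRing CUI_NormedModuleAux)
     CUI_NormedModule_mixin) CUI.

Lemma CUI_complete (F : (CUI -> Prop) -> Prop) :
  ProperFilter F -> cauchy F ->
  exists l : CUI, forall eps : posreal, F (ball l eps).
Proof.
intros PF cF.
set (ev := fun x : UI => filtermap (fun f : CUI => (f x : C)) F).
assert (PE : forall x, ProperFilter (ev x)).
{ intros x; now apply filtermap_proper_filter. }
set (l := fun x => lim (T := C_CompleteNormedModule) (ev x)).
assert (hev : forall x eps, 0 < eps ->
  F (fun f : CUI => Cmod (f x - l x)%C < eps)).
{ intros x eps he.
  assert (cE : cauchy (T := C_CompleteNormedModule) (ev x)).
  { intros e; destruct (cF e) as [g hg]; exists (g x).
    unfold ev, filtermap; apply filter_imp with (2 := hg).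
    intros f hf; apply (norm_compat1 (V := C_NormedModule)).
    apply Rle_lt_trans with (2 := hf).
    apply (sup_norm_ub (minus f g) x). }
  pose proof (@norm_factor_gt_0 _ C_NormedModule) as hn.
  assert (hd : 0 < eps / @norm_factor _ C_NormedModule).
  { now apply Rdiv_lt_0_compat. }
  pose proof (complete_cauchy (T := C_CompleteNormedModule) (ev x) (PE x) cE
    (mkposreal _ hd)) as H.
  unfold ev at 1, filtermap in H; apply filter_imp with (2 := H).
  intros f hf; apply (norm_compat2 (V := C_NormedModule)) in hf; simpl in hf.
  apply Rlt_le_trans with (1 := hf); right; field; lra. }
assert (hun : forall eps, 0 < eps -> exists g : CUI,
  F (ball g eps) /\ forall x, Cmod (g x - l x)%C <= eps).
{ intros eps he; destruct (cF (mkposreal eps he)) as [g hg]; exists g.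
  split; [exact hg |]; intros x.
  apply le_epsilon; intros e hpos.
  destruct (filter_ex _ (filter_and _ _ hg (hev x e hpos))) as [f [h1 h2]].
  replace (g x - l x)%C with ((g x - f x) + (f x - l x))%C by ring.
  apply Rle_trans with (1 := Cmod_triangle _ _).
  apply Rplus_le_compat; [| now apply Rlt_le].
  apply Rle_trans with (1 := sup_norm_ub (minus g f) x).
  rewrite sup_norm_minus_sym; apply Rlt_le; exact h1. }
assert (hl : forall x, continuous l x).
{ intros x; apply continuous_UI_Cmod; intros eps he.
  destruct (hun (eps / 3)) as [g [_ hg]]; [lra |].
  destruct (proj1 (continuous_UI_Cmod g x) (CUI_cont g x) (eps / 3))
    as [d [hd H]]; [lra |].
  exists d; split; [exact hd |]; intros y hy.
  replace (l y - l x)%C with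
    (- (g y - l y) + ((g y - g x) + (g x - l x)))%C by ring.
  apply Rle_lt_trans with (1 := Cmod_triangle _ _).
  pose proof (Cmod_triangle (g y - g x) (g x - l x)).
  rewrite Cmod_opp.
  specialize (H y hy); pose proof (hg x); pose proof (hg y); lra. }
exists (mkCUI l hl); intros eps.
destruct (hun (eps / 3)) as [g [h1 h2]].
{ pose proof (cond_pos eps); lra. }
apply filter_imp with (2 := h1); intros f hf.
change (sup_norm (minus f (mkCUI l hl)) < eps).
change (sup_norm (minus f g) < eps / 3) in hf.
rewrite (minus_trans g).
apply Rle_lt_trans with (1 := sup_norm_plus _ _).
assert (sup_norm (minus g (mkCUI l hl)) <= eps / 3).
{ apply sup_norm_le; exact h2. }
pose proof (cond_pos eps); lra.
Qed.

Definition CUI_lim (F : (CUI -> Prop) -> Prop) : CUI :=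
  epsilon (inhabits CUI_zero) (fun l => forall eps : posreal, F (ball l eps)).

Definition CUI_CompleteSpace_mixin : CompleteSpace.mixin_of CUI_UniformSpace.
Proof.
apply (CompleteSpace.Mixin CUI_UniformSpace CUI_lim).
- intros F PF cF; unfold CUI_lim; apply epsilon_spec; now apply CUI_complete.
- intros F1 F2 h12 h21.
  assert (F1 = F2).
  { apply functional_extensionality; intros P.
    apply propositional_extensionality; split; [apply h21 | apply h12]. }
  subst F2; intros eps; apply ball_center.
Defined.
Canonical CUI_CompleteNormedModule := CompleteNormedModule.Pack C_AbsRing CUI
  (CompleteNormedModule.Class C_AbsRing CUI
     (NormedModule.class C_AbsRing CUI_NormedModule)
     CUI_CompleteSpace_mixin) CUI.



(** An unbounded operator is given by its graph: [A f g] means that [f] lies in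
    the domain of [A] and [A f = g]. *)
Definition operator (X : CompleteNormedModule C_AbsRing) : Type :=
  X -> X -> Prop.

(** The domain of the sum is the intersection of the two domains. *)
Definition op_add {X : CompleteNormedModule C_AbsRing} (A B : operator X) :
  operator X :=
  fun f g => exists g1 g2 : X, A f g1 /\ B f g2 /\ g = plus g1 g2.

Definition op_norm {X : CompleteNormedModule C_AbsRing} (T : X -> X) : Rbar :=
  Lub_Rbar (fun r => exists x : X, norm x <= 1 /\ r = norm (T x)).

(** [T t] is irrelevant for [t < 0]. The predicate [is_linear] includes
    boundedness. *)
Definition C0_semigroup {X : CompleteNormedModule C_AbsRing}
  (T : R -> X -> X) : Prop :=
  (forall t, 0 <= t -> is_linear (T t)) /\
  (forall x, T 0 x = x) /\
  (forall s t x, 0 <= s -> 0 <= t -> T (s + t) x = T s (T t x)) /\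
  (forall x, filterlim (fun t => T t x) (at_right 0) (locally x)).

Definition generator {X : CompleteNormedModule C_AbsRing}
  (T : R -> X -> X) : operator X :=
  fun x y =>
    filterlim (fun t : R => scal (RtoC (/ t)) (minus (T t x) x))
      (at_right 0) (locally y).

Definition generates {X : CompleteNormedModule C_AbsRing}
  (A : operator X) (T : R -> X -> X) : Prop :=
  C0_semigroup T /\ forall x y, A x y <-> generator T x y.

Definition uniformly_exponentially_stable
  {X : CompleteNormedModule C_AbsRing} (T : R -> X -> X) : Prop :=
  exists M omega : R, 1 <= M /\ 0 < omega /\
    forall t, 0 <= t -> Rbar_le (op_norm (T t)) (M * exp (- omega * t)).

(** The open sector [{z <> 0 : |arg z| < delta}]. *)
Definition sector (delta : R) (z : C) : Prop :=
  exists r theta : R, 0 < r /\ Rabs theta < delta /\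
    z = (r * cos theta, r * sin theta).

(** Complex differentiability with respect to the operator norm. *)
Definition holomorphic_at {X : CompleteNormedModule C_AbsRing}
  (S : C -> X -> X) (z : C) : Prop :=
  exists L : X -> X, is_linear L /\
    forall eps : posreal,
      locally' z (fun w : C =>
        Rbar_le (op_norm (fun x =>
          minus (scal (/ (w - z))%C (minus (S w x) (S z x))) (L x))) eps).

Definition analytic_of_angle {X : CompleteNormedModule C_AbsRing}
  (delta : R) (S : C -> X -> X) : Prop :=
  (forall z, sector delta z -> is_linear (S z)) /\
  (forall x, S (RtoC 0) x = x) /\
  (forall z w x, sector delta z -> sector delta w ->
     S (z + w)%C x = S z (S w x)) /\
  (forall z, sector delta z -> holomorphic_at S z) /\
  (forall delta' x, 0 < delta' < delta ->
     filterlim (fun z : C => S z x)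
       (within (sector delta') (locally (RtoC 0))) (locally x)).

Definition analytic_semigroup {X : CompleteNormedModule C_AbsRing}
  (T : R -> X -> X) : Prop :=
  exists (delta : R) (S : C -> X -> X),
    0 < delta <= PI / 2 /\ analytic_of_angle delta S /\
    forall t x, 0 <= t -> S (RtoC t) x = T t x.



(** Derivative on [0,1], one-sided at the end points. *)
Definition is_derive_UI {V : NormedModule R_AbsRing}
  (f : UI -> V) (x : UI) (l : V) : Prop :=
  filterlim (fun y : UI => scal (/ (y - x)) (minus (f y) (f x)))
    (locally' x) (locally l).

(** [f] is of class C^1 with derivative [f1]. *)
Definition C1_deriv (f f1 : CUI) : Prop :=
  forall x : UI, is_derive_UI (V := C_R_NormedModule) f x (f1 x).

Definition A_op (mu : R) : operator CUI_CompleteNormedModule :=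
  fun f g => exists f1 f2 : CUI,
    C1_deriv f f1 /\ C1_deriv f1 f2 /\
    f1 UI0 = RtoC 0 /\ f1 UI1 = RtoC 0 /\
    g = minus f2 (scal (RtoC mu) f).

Definition B_op (p : UI -> R) : operator CUI_CompleteNormedModule :=
  fun f g => exists f1 : CUI,
    C1_deriv f f1 /\ forall x : UI, g x = (RtoC (p x) * f1 x)%C.

(* Main.v *)
Require Import Defs.
From Stdlib Require Import Reals ZArith Lra Lia List.
From Stdlib Require Import ClassicalEpsilon FunctionalExtensionality PropExtensionality
  ProofIrrelevance.
From Coquelicot Require Import Coquelicot.
Open Scope R_scope.

(** For [mu = 0] the operator is [(d/dx + p) d/dx], and the proof reads it as the
    square of a first-order operator that generates a group.

    Functions on the interval are extended to even functions of period two, which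
    turns the Neumann conditions into smoothness of the extension. The coefficient [p]
    extends to an odd function [q] of period two ([odd_extension]). On the space [Per]
    of all continuous functions of period two put [B g = g' + q (g - g^) / 2], where
    [g^ x = g (- x)]. The bounded term is zero on even functions and is multiplication
    by [q] on odd ones, so [B (B f) = f'' + q f'] for even [f] ([gen_square_even],
    [operator_gen_square]).

    The derivative generates the isometric group of translations, hence its bounded
    perturbation [B] generates a group [W] of at most exponential growth. It is obtained
    from the Volterra equation for [T (- t) (W t x)], [T] being the translations, and
    is tied to [B] by [perturbed_gen_RInt] and [perturbed_gen_orbit].

    The semigroup is the Gaussian average of the group: [sg mu z x] is, up to a constant
    factor, the integral over the line of [k z s W s x], where [k] is the heat kernel
    [z^(-1/2) exp (- s^2 / 4 z - mu z)] at complex time [z]. Integration by parts moves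
    [B] to a derivative of the kernel ([smear_gen], [smear_of_gen]); since the kernel
    solves the heat equation, the time derivative of [sg mu z] is both [(B^2 - mu) (sg mu z)]
    and [(sg mu z) (B^2 - mu)]. The rest follows from this and from scalar estimates of
    the kernel: differentiability in operator norm ([heat_op_taylor]), the semigroup law,
    because [sg mu (z + w - s w) (sg mu (s w) x)] does not depend on [s] ([sg_add]), and
    strong continuity, because the kernel is an approximate identity in the cone
    [|Im z| <= Re z] ([sg_limit]). The generator is not larger than [B^2 - mu] because
    the latter is closed ([gen_square_closed]).

    Stability is the maximum principle: where [|f|] is largest, [f] is stationary and its
    second derivative points inwards, whatever the real coefficient [q] is
    ([gen_square_dissipative]). Hence the semigroup for [mu = 0] is contractive on even
    functions, and the term [- mu] contributes the factor [exp (- mu t)]. *)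


(** * Equations in real vector spaces *)

(** A reflective normalizer: both sides of an equation are reduced to their
    coefficients on the atoms, and [ring] compares the coefficients. *)

Section ModuleReflection.
Context {V : ModuleSpace R_Ring}.

Inductive mexp :=
  | MVar (n : nat) | MZero | MPlus (e1 e2 : mexp) | MOpp (e : mexp)
  | MScal (r : R) (e : mexp).

Fixpoint meval (env : list V) (e : mexp) : V :=
  match e with
  | MVar n => nth n env zero
  | MZero => zero
  | MPlus e1 e2 => plus (meval env e1) (meval env e2)
  | MOpp e => opp (meval env e)
  | MScal r e => scal r (meval env e)
  end.

Fixpoint mcoef (e : mexp) (i : nat) : R :=
  match e with
  | MVar n => if Nat.eqb n i then 1 else 0
  | MZero => 0
  | MPlus e1 e2 => mcoef e1 i + mcoef e2 i
  | MOpp e => - mcoef e i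
  | MScal r e => r * mcoef e i
  end.

Fixpoint mlin (c : nat -> R) (env : list V) (k : nat) : V :=
  match env with
  | nil => zero
  | cons v l => plus (scal (c k) v) (mlin c l (S k))
  end.

Fixpoint mcoef_eq (c d : nat -> R) (env : list V) (k : nat) : Prop :=
  match env with
  | nil => True
  | cons _ l => c k = d k /\ mcoef_eq c d l (S k)
  end.

Lemma mlin_plus c d env k :
  mlin (fun i => c i + d i) env k = plus (mlin c env k) (mlin d env k).
Proof.
revert k; induction env as [|v l IH]; intros k; simpl.
- now rewrite plus_zero_l.
- rewrite IH.
  pose proof (@scal_distr_r R_Ring V (c k) (d k) v) as E.
  change (@plus R_Ring (c k) (d k)) with (c k + d k) in E.
  rewrite E, <- !plus_assoc. f_equal.
  rewrite !plus_assoc. f_equal. apply plus_comm.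
Qed.

Lemma mlin_scal r c env k :
  mlin (fun i => r * c i) env k = scal r (mlin c env k).
Proof.
revert k; induction env as [|v l IH]; intros k; simpl.
- now rewrite scal_zero_r.
- rewrite IH, scal_distr_l.
  pose proof (@scal_assoc R_Ring V r (c k) v) as E.
  change (@mult R_Ring r (c k)) with (r * c k) in E. now rewrite E.
Qed.

Lemma mlin_ext c d env k :
  mcoef_eq c d env k -> mlin c env k = mlin d env k.
Proof.
revert k; induction env as [|v l IH]; intros k; simpl; [easy|].
intros [-> h]; now rewrite (IH _ h).
Qed.

Lemma scal_R0 (v : V) : scal (0 : R_Ring) v = zero.
Proof. apply (scal_zero_l v). Qed.

Lemma scal_R1 (v : V) : scal (1 : R_Ring) v = v.
Proof. apply (scal_one v). Qed.

Lemma mlin_var_lt n env k : (n < k)%nat ->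
  mlin (fun i => if Nat.eqb n i then 1 else 0) env k = zero.
Proof.
revert k; induction env as [|v l IH]; intros k h; simpl; [easy|].
rewrite (proj2 (Nat.eqb_neq n k)), IH by lia.
now rewrite scal_R0, plus_zero_l.
Qed.

Lemma mlin_var n env k :
  mlin (fun i => if Nat.eqb (n + k) i then 1 else 0) env k = nth n env zero.
Proof.
revert n k; induction env as [|v l IH]; intros n k; cbn [mlin nth].
- now destruct n.
- destruct n as [|n].
  + rewrite Nat.add_0_l, Nat.eqb_refl, mlin_var_lt by lia.
    now rewrite scal_R1, plus_zero_r.
  + rewrite (proj2 (Nat.eqb_neq (S n + k) k)) by lia.
    rewrite scal_R0, plus_zero_l, <- (IH n (S k)).
    now rewrite Nat.add_succ_r.
Qed.

Lemma meval_mlin env e : meval env e = mlin (mcoef e) env 0.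
Proof.
induction e as [n| |e1 IH1 e2 IH2|e IH|r e IH]; simpl.
- rewrite <- (mlin_var n env 0). now rewrite Nat.add_0_r.
- transitivity (scal 0 (mlin (fun _ => 0) env 0)).
  + symmetry; apply scal_R0.
  + rewrite <- mlin_scal; f_equal.
    apply functional_extensionality; intros; ring.
- now rewrite IH1, IH2, mlin_plus.
- rewrite IH, <- scal_opp_one.
  change (opp (one : R_Ring)) with (- (1)). rewrite <- mlin_scal; f_equal.
  apply functional_extensionality; intros; ring.
- rewrite IH, <- mlin_scal; reflexivity.
Qed.

Lemma meval_eq env e1 e2 :
  mcoef_eq (mcoef e1) (mcoef e2) env 0 -> meval env e1 = meval env e2.
Proof. intros h; rewrite !meval_mlin; now apply mlin_ext. Qed.
End ModuleReflection.

Ltac madd_atom v env :=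
  let rec mem l :=
    lazymatch l with
    | nil => constr:(false)
    | cons v _ => constr:(true)
    | cons _ ?l => mem l
    end in
  let b := mem env in
  lazymatch b with true => env | false => constr:(cons v env) end.

Ltac mindex v env :=
  lazymatch env with
  | cons v _ => constr:(O)
  | cons _ ?l => let n := mindex v l in constr:(S n)
  end.

Ltac matoms V e env :=
  lazymatch e with
  | plus ?a ?b => let env := matoms V a env in matoms V b env
  | minus ?a ?b => let env := matoms V a env in matoms V b env
  | opp ?a => matoms V a env
  | zero => env
  | scal _ ?a => matoms V a env
  | _ => madd_atom e env
  end.

Ltac mreify e env :=
  lazymatch e with
  | plus ?a ?b =>
      let a := mreify a env in let b := mreify b env in constr:(MPlus a b)
  | minus ?a ?b =>
      let a := mreify a env in let b := mreify b env in
      constr:(MPlus a (MOpp b))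
  | opp ?a => let a := mreify a env in constr:(MOpp a)
  | zero => constr:(MZero)
  | scal ?r ?a => let a := mreify a env in constr:(MScal r a)
  | _ => let n := mindex e env in constr:(MVar n)
  end.

Ltac module_start V :=
  lazymatch goal with
  | |- ?l = ?r =>
    let env := matoms V l constr:(@nil V) in
    let env := matoms V r env in
    let el := mreify l env in
    let er := mreify r env in
    change (@meval V env el = @meval V env er);
    apply meval_eq; cbn [mcoef mcoef_eq Nat.eqb]
  end.

Ltac module_eq V := module_start V; repeat split; try ring.

(** * Derivatives and integrals of vector-valued functions *)

Lemma exp_monotone (a b : R) : a <= b -> exp a <= exp b.
Proof. intros [h| ->]; [now apply Rlt_le, exp_increasing | apply Rle_refl]. Qed.

Section VectorCalculus.
Context {V : CompleteNormedModule R_AbsRing}.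

Lemma vnorm_plus (x y : V) : norm (plus x y) <= norm x + norm y.
Proof. apply (norm_triangle (V := V)). Qed.

Lemma vnorm_scal (r : R) (x : V) : norm (scal r x) <= Rabs r * norm x.
Proof. apply (norm_scal (V := V)). Qed.

Lemma vnorm_opp (x : V) : norm (opp x) = norm x.
Proof. apply (norm_opp (V := V)). Qed.

Lemma vnorm_zero : norm (zero : V) = 0.
Proof. apply (norm_zero (V := V)). Qed.

Lemma vnorm_minus (x y : V) : norm (minus x y) <= norm x + norm y.
Proof. rewrite <- (vnorm_opp y); apply vnorm_plus. Qed.

Lemma vnorm_ge_0 (x : V) : 0 <= norm x.
Proof. apply (norm_ge_0 (V := V)). Qed.

Lemma vnorm_eq_0 (x : V) : norm x <= 0 -> x = zero.
Proof.
intros h; apply (norm_eq_zero (V := V)), Rle_antisym; [easy | apply vnorm_ge_0].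
Qed.

Lemma continuous_norm_iff (f : R -> V) (x : R) :
  continuous f x <->
  forall eps, 0 < eps -> exists d, 0 < d /\
    forall y, Rabs (y - x) < d -> norm (minus (f y) (f x)) < eps.
Proof.
unfold continuous.
rewrite (filterlim_locally_ball_norm (K := R_AbsRing) (U := V)).
split.
- intros h eps he; destruct (h (mkposreal eps he)) as [d hd].
  exists d; split; [apply cond_pos | exact hd].
- intros h eps; destruct (h eps (cond_pos eps)) as [d [hd H]].
  exists (mkposreal d hd); exact H.
Qed.

Lemma is_derive_norm_iff (f : R -> V) (x : R) (l : V) :
  is_derive f x l <->
  forall eps, 0 < eps -> exists d, 0 < d /\
    forall y, Rabs (y - x) < d ->
      norm (minus (minus (f y) (f x)) (scal (y - x) l)) <= eps * Rabs (y - x).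
Proof.
split.
- intros [_ h] eps he.
  destruct (h x (fun P h => h) (mkposreal eps he)) as [d hd].
  exists d; split; [apply cond_pos|]; intros y hy; exact (hd y hy).
- intros h; split; [apply is_linear_scal_l|].
  intros y hy.
  pose proof (is_filter_lim_locally_unique (V := R_NormedModule) x y hy) as E; subst y.
  intros eps; destruct (h eps (cond_pos eps)) as [d [hd H]].
  exists (mkposreal d hd); intros z hz; exact (H z hz).
Qed.

Lemma is_derive_eq (f : R -> V) (x : R) (l l' : V) :
  is_derive f x l -> l = l' -> is_derive f x l'.
Proof. now intros h <-. Qed.

Lemma is_derive_affine (f : R -> V) (k c x : R) (l : V) :
  is_derive f (k * x + c) l -> is_derive (fun y => f (k * y + c)) x (scal k l).
Proof.
intros h; apply (is_derive_comp f (fun y => k * y + c)); [easy|].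
auto_derive; [easy | ring].
Qed.

Lemma derive_zero_const (f : R -> V) (a b : R) :
  (forall t, is_derive f t zero) -> f a = f b.
Proof.
intros h; destruct (Rtotal_order a b) as [l|[-> |l]]; [|easy|].
- now apply (eq_is_derive f).
- symmetry; now apply (eq_is_derive f).
Qed.

Lemma is_derive_continuous (f : R -> V) (x : R) (l : V) :
  is_derive f x l -> continuous f x.
Proof. intros h; apply (ex_derive_continuous (V := V)); now exists l. Qed.

Lemma ex_RInt_cont (f : R -> V) (a b : R) :
  (forall x, continuous f x) -> ex_RInt f a b.
Proof. intros h; apply ex_RInt_continuous; intros; apply h. Qed.

Lemma is_derive_RInt_cont (f : R -> V) (a b : R) :
  (forall x, continuous f x) -> is_derive (fun t => RInt f a t) b (f b).
Proof.
intros h; apply is_derive_RInt with (a := a); [|apply h].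
apply filter_forall; intros y; apply RInt_correct; now apply ex_RInt_cont.
Qed.

Lemma continuous_RInt_cont (f : R -> V) (a b : R) :
  (forall x, continuous f x) -> continuous (fun t => RInt f a t) b.
Proof.
intros h; apply is_derive_continuous with (f b); now apply is_derive_RInt_cont.
Qed.

Lemma RInt_of_derive (f df : R -> V) (a b : R) :
  (forall x, is_derive f x (df x)) -> (forall x, continuous df x) ->
  RInt df a b = minus (f b) (f a).
Proof.
intros h1 h2; apply is_RInt_unique, is_RInt_derive; intros; auto.
Qed.

Lemma RInt_plus_cont (f g : R -> V) (a b : R) :
  (forall x, continuous f x) -> (forall x, continuous g x) ->
  RInt (fun x => plus (f x) (g x)) a b = plus (RInt f a b) (RInt g a b).
Proof. intros; apply RInt_plus; now apply ex_RInt_cont. Qed.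

Lemma RInt_minus_cont (f g : R -> V) (a b : R) :
  (forall x, continuous f x) -> (forall x, continuous g x) ->
  RInt (fun x => minus (f x) (g x)) a b = minus (RInt f a b) (RInt g a b).
Proof. intros; apply RInt_minus; now apply ex_RInt_cont. Qed.

Lemma RInt_Chasles_cont (f : R -> V) (a b c : R) :
  (forall x, continuous f x) -> plus (RInt f a b) (RInt f b c) = RInt f a c.
Proof. intros; apply RInt_Chasles; now apply ex_RInt_cont. Qed.

Lemma RInt_scale (f : R -> V) (k t : R) :
  (forall x, continuous f x) ->
  RInt f 0 (k * t) = RInt (fun s => scal k (f (k * s))) 0 t.
Proof.
intros h; symmetry; apply is_RInt_unique.
pose proof (is_RInt_comp_lin f k 0 0 t (RInt f 0 (k * t))) as H.
apply is_RInt_ext with (fun y => scal k (f (k * y + 0))).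
{ intros; now rewrite Rplus_0_r. }
apply H; rewrite Rmult_0_r, !Rplus_0_r.
apply RInt_correct; now apply ex_RInt_cont.
Qed.

Lemma norm_RInt_bound (f : R -> V) (a b M : R) :
  (forall x, continuous f x) ->
  (forall x, Rmin a b <= x <= Rmax a b -> norm (f x) <= M) ->
  norm (RInt f a b) <= M * Rabs (b - a).
Proof.
intros h hM; rewrite Rmult_comm; apply (norm_RInt_le_const_abs f a b); [easy|].
apply RInt_correct; now apply ex_RInt_cont.
Qed.

(** Integrating the exponential weight gains the factor [1 / k]: this is what
    makes the Volterra iteration a contraction. *)
Lemma norm_RInt_exp (f : R -> V) (k M t : R) :
  0 < k -> 0 <= M -> (forall x, continuous f x) ->
  (forall s, Rabs s <= Rabs t -> norm (f s) <= M * k * exp (k * Rabs s)) ->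
  norm (RInt f 0 t) <= M * exp (k * Rabs t).
Proof.
intros hk hM.
assert (K : forall f : R -> V, (forall x, continuous f x) ->
  forall t, 0 <= t ->
  (forall s, Rabs s <= Rabs t -> norm (f s) <= M * k * exp (k * Rabs s)) ->
  norm (RInt f 0 t) <= M * exp (k * Rabs t)).
{ clear f t; intros f h t ht hf.
  assert (I : is_RInt (fun s => M * k * exp (k * s)) 0 t
     (minus (M * exp (k * t)) (M * exp (k * 0)))).
  { apply (is_RInt_derive (V := R_CompleteNormedModule)
      (fun s => M * exp (k * s))).
    - intros x _; auto_derive; [easy | ring].
    - intros x _. apply (ex_derive_continuous (V := R_NormedModule)).
      now auto_derive. }
  apply Rle_trans with (minus (M * exp (k * t)) (M * exp (k * 0))).
  - apply (norm_RInt_le f (fun s => M * k * exp (k * s)) 0 t); try easy.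
    + intros x hx; pose proof (hf x ltac:(rewrite !Rabs_right; lra)) as E; rewrite Rabs_right in E by lra.
      exact E.
    + apply RInt_correct; now apply ex_RInt_cont.
  - change (M * exp (k * t) - M * exp (k * 0) <= M * exp (k * Rabs t)).
    rewrite Rabs_right by lra.
    pose proof (exp_pos (k * 0)). nra. }
intros h hf; destruct (Rle_dec 0 t) as [l|l]; [now apply K|].
replace t with (-1 * (- t)) at 1 by ring.
rewrite RInt_scale by easy.
rewrite <- (Rabs_Ropp t). apply K; [|lra|].
- intros x. apply (continuous_scal_r (V := V)).
  apply (continuous_comp (fun s => -1 * s) f); [|apply h].
  apply (continuous_scal_r (V := R_NormedModule)), continuous_id.
- intros s hs. apply Rle_trans with (1 := vnorm_scal (-1) (f (-1 * s))).
  change (Rabs (-1) * norm (f (-1 * s)) <= M * k * exp (k * Rabs s)).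
  replace (Rabs (-1)) with 1 by (rewrite Rabs_left; lra).
  rewrite Rmult_1_l; rewrite Rabs_Ropp in hs.
  assert (E : Rabs (-1 * s) = Rabs s) by
    (rewrite <- (Rabs_Ropp s); f_equal; ring).
  rewrite <- E; apply hf; now rewrite E.
Qed.
End VectorCalculus.

Section LinearMaps.
Context {U V : CompleteNormedModule R_AbsRing}.

Lemma is_derive_linear (l : U -> V) (f : R -> U) (x : R) (d : U) :
  is_linear l -> is_derive f x d -> is_derive (fun t => l (f t)) x (l d).
Proof.
intros hl hf.
apply is_derive_norm_iff; intros eps he.
destruct (linear_norm _ hl) as [M [hM H]].
destruct (proj1 (is_derive_norm_iff f x d) hf (eps / M)) as [dd [hd K]].
{ now apply Rdiv_lt_0_compat. }
exists dd; split; [easy|]; intros y hy.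
rewrite <- (linear_scal _ hl), <- !(linear_minus _ _ _ hl).
apply Rle_trans with (1 := H _).
apply Rle_trans with (M * (eps / M * Rabs (y - x))).
- apply Rmult_le_compat_l; [lra | now apply K].
- right; field; lra.
Qed.

Lemma continuous_linear (l : U -> V) (f : R -> U) (x : R) :
  is_linear l -> continuous f x -> continuous (fun t => l (f t)) x.
Proof.
intros hl hf; apply (continuous_comp f l); [easy | now apply (linear_cont (U := U) (V := V))].
Qed.

(** Both sides have the same derivative in the upper bound [b]. *)
Lemma linear_RInt (l : U -> V) (f : R -> U) (a b : R) :
  is_linear l -> (forall x, continuous f x) ->
  l (RInt f a b) = RInt (fun s => l (f s)) a b.
Proof.
intros hl hf; symmetry.
rewrite (RInt_of_derive (fun t => l (RInt f a t)) (fun s => l (f s))).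
- rewrite RInt_point, (linear_zero _ hl : l zero = zero).
  module_eq V.
- intros x; apply is_derive_linear; [easy | now apply is_derive_RInt_cont].
- intros x; now apply continuous_linear.
Qed.

Lemma RInt_family_linear (N : R -> U -> V) (t M : R) :
  0 <= M -> (forall s, is_linear (N s)) ->
  (forall x s, continuous (fun s => N s x) s) ->
  (forall s x, Rabs s <= Rabs t -> norm (N s x) <= M * norm x) ->
  is_linear (fun x => RInt (fun s => N s x) 0 t).
Proof.
intros hM hN hc hb; split.
- intros x y; etransitivity; [|apply RInt_plus_cont; apply hc].
  apply RInt_ext; intros s _; apply (linear_plus _ (hN s)).
- intros k x; etransitivity; [|apply RInt_scal, ex_RInt_cont; apply hc].
  apply RInt_ext; intros s _; apply (linear_scal _ (hN s)).
- exists (M * Rabs t + 1); pose proof (Rabs_pos t).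
  assert (0 <= M * Rabs t) by now apply Rmult_le_pos.
  split; [lra|]; intros x; pose proof (vnorm_ge_0 x).
  apply Rle_trans with (M * norm x * Rabs (t - 0)).
  + apply norm_RInt_bound; [apply hc|]; intros s hs; apply hb.
    unfold Rmin, Rmax in hs; destruct (Rle_dec 0 t).
    * rewrite !Rabs_right; lra.
    * rewrite !Rabs_left1; lra.
  + rewrite Rminus_0_r.
    change (M * norm x * Rabs t <= (M * Rabs t + 1) * norm x); nra.
Qed.

(** Strong continuity of a locally bounded family of operators is inherited by
    its action on a moving vector. *)
Lemma continuous_family (N : R -> U -> V) (h : R -> U) (t0 M : R) :
  (forall t, is_linear (N t)) -> 0 < M ->
  locally t0 (fun t => forall x, norm (N t x) <= M * norm x) ->
  continuous (fun t => N t (h t0)) t0 -> continuous h t0 ->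
  continuous (fun t => N t (h t)) t0.
Proof.
intros hN hM0 [d0 hM] c1 c2; apply continuous_norm_iff; intros eps he.
destruct (proj1 (continuous_norm_iff _ _) c1 (eps / 2)) as [d1 [hd1 H1]]; [lra|].
destruct (proj1 (continuous_norm_iff _ _) c2 (eps / (2 * M))) as [d2 [hd2 H2]].
{ apply Rdiv_lt_0_compat; lra. }
exists (Rmin d0 (Rmin d1 d2)); split.
{ pose proof (cond_pos d0); now repeat apply Rmin_pos. }
intros y hy.
apply Rmin_Rgt in hy as [hy0 hy]; apply Rmin_Rgt in hy as [hy1 hy2].
specialize (H1 y hy1); specialize (H2 y hy2).
replace (minus (N y (h y)) (N t0 (h t0))) with
  (plus (N y (minus (h y) (h t0))) (minus (N y (h t0)) (N t0 (h t0))))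
  by (rewrite (linear_minus _ _ _ (hN y)); module_eq V).
apply Rle_lt_trans with (1 := vnorm_plus _ _).
assert (K : norm (N y (minus (h y) (h t0))) <= M * (eps / (2 * M))).
{ apply Rle_trans with (1 := hM y hy0 _).
  apply Rmult_le_compat_l; lra. }
replace (M * (eps / (2 * M))) with (eps / 2) in K by (field; lra).
lra.
Qed.

(** The product rule. The family [N] is only differentiated at the vector [h t0], which
    is why the rule applies to orbits of an unbounded generator. *)
Lemma is_derive_family (N : R -> U -> V) (h : R -> U) (t0 M : R) (d : V) (h1 : U) :
  0 < M ->
  locally t0 (fun t => is_linear (N t) /\ forall x, norm (N t x) <= M * norm x) ->
  is_derive (fun t => N t (h t0)) t0 d -> is_derive h t0 h1 ->
  continuous (fun t => N t h1) t0 ->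
  is_derive (fun t => N t (h t)) t0 (plus d (N t0 h1)).
Proof.
intros hM0 [d0 H0] c1 c2 c3; apply is_derive_norm_iff; intros eps he.
destruct (proj1 (is_derive_norm_iff _ _ _) c1 (eps / 3)) as [d1 [hd1 H1]]; [lra|].
destruct (proj1 (is_derive_norm_iff _ _ _) c2 (eps / (3 * M))) as [d2 [hd2 H2]].
{ apply Rdiv_lt_0_compat; lra. }
destruct (proj1 (continuous_norm_iff _ _) c3 (eps / 3)) as [d3 [hd3 H3]]; [lra|].
exists (Rmin d0 (Rmin d1 (Rmin d2 d3))); split.
{ pose proof (cond_pos d0); now repeat apply Rmin_pos. }
intros y hy.
apply Rmin_Rgt in hy as [hy0 hy]; apply Rmin_Rgt in hy as [hy1 hy].
apply Rmin_Rgt in hy as [hy2 hy3].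
specialize (H1 y hy1); specialize (H2 y hy2); specialize (H3 y hy3).
destruct (H0 y hy0) as [hN hM].
set (a := Rabs (y - t0)) in *. assert (ha : 0 <= a) by apply Rabs_pos.
match goal with |- norm ?X <= _ => replace X with
  (plus (N y (minus (minus (h y) (h t0)) (scal (y - t0) h1)))
     (plus (scal (y - t0) (minus (N y h1) (N t0 h1)))
        (minus (minus (N y (h t0)) (N t0 (h t0))) (scal (y - t0) d)))) end.
2: { rewrite !(linear_minus _ _ _ hN), (linear_scal _ hN).
  module_eq V. }
apply Rle_trans with (1 := vnorm_plus _ _).
apply Rle_trans with (eps / 3 * a + (eps / 3 * a + eps / 3 * a));
  [|right; field].
apply Rplus_le_compat.
- apply Rle_trans with (1 := hM _).
  apply Rle_trans with (M * (eps / (3 * M) * a)).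
  + apply Rmult_le_compat_l; lra.
  + right; field; lra.
- apply Rle_trans with (1 := vnorm_plus _ _).
  apply Rplus_le_compat; [|easy].
  apply Rle_trans with (1 := vnorm_scal _ _).
  change (a * norm (minus (N y h1) (N t0 h1)) <= eps / 3 * a).
  rewrite Rmult_comm; apply Rmult_le_compat_r; lra.
Qed.
End LinearMaps.

(** * Limits of sequences *)

Lemma half_pow_small (A eps : R) : 0 < eps -> exists n, A * (1 / 2) ^ n < eps.
Proof.
intros he.
assert (hA : 0 < Rabs A + 1) by (pose proof (Rabs_pos A); lra).
destruct (pow_lt_1_zero (1 / 2) ltac:(rewrite Rabs_right; lra) (eps / (Rabs A + 1)))
  as [n hn]; [now apply Rdiv_lt_0_compat|].
exists n; specialize (hn n (le_n n)).
assert (hp : 0 < (1 / 2) ^ n) by (apply pow_lt; lra).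
rewrite Rabs_right in hn by lra.
apply Rmult_lt_compat_r with (r := Rabs A + 1) in hn; [|easy].
replace (eps / (Rabs A + 1) * (Rabs A + 1)) with eps in hn by (field; lra).
pose proof (Rle_abs A); nra.
Qed.

Section Limits.
Context {V : CompleteNormedModule R_AbsRing}.

Definition seq_limit (u : nat -> V) (l : V) : Prop :=
  forall eps, 0 < eps -> exists N, forall n, (N <= n)%nat ->
    norm (minus (u n) l) < eps.

Lemma cauchy_seq_limit (u : nat -> V) :
  (forall eps, 0 < eps -> exists N, forall n, (N <= n)%nat ->
    norm (minus (u n) (u N)) < eps) ->
  exists l, seq_limit u l.
Proof.
intros h.
set (F := filtermap u eventually).
assert (PF : ProperFilter F) by
  (apply filtermap_proper_filter, eventually_filter).
assert (cF : cauchy (T := V) F).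
{ intros eps; destruct (h eps (cond_pos eps)) as [N hN]; exists (u N).
  exists N; intros n hn; apply (norm_compat1 (V := V)); now apply hN. }
exists (lim (T := V) F); intros eps he.
pose proof (@norm_factor_gt_0 _ V) as hf.
destruct (complete_cauchy (T := V) F PF cF
  (mkposreal _ (Rdiv_lt_0_compat _ _ he hf))) as [N hN].
exists N; intros n hn.
apply Rlt_le_trans with (1 := norm_compat2 (V := V) _ _ _ (hN n hn)).
simpl; right; field; lra.
Qed.

Lemma seq_limit_le (u : nat -> V) (l v : V) (M : R) (N : nat) :
  seq_limit u l -> (forall n, (N <= n)%nat -> norm (minus (u n) v) <= M) ->
  norm (minus l v) <= M.
Proof.
intros h hM; apply le_epsilon; intros eps he.
destruct (h eps he) as [N' hN].
specialize (hN (N + N')%nat ltac:(lia)); specialize (hM (N + N')%nat ltac:(lia)).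
replace (minus l v) with
  (minus (minus (u (N + N')%nat) v) (minus (u (N + N')%nat) l)) by module_eq V.
apply Rle_trans with (1 := vnorm_minus _ _); lra.
Qed.

Lemma seq_limit_unique (u : nat -> V) (l l' : V) :
  seq_limit u l -> seq_limit u l' -> l = l'.
Proof.
intros h h'.
replace l with (plus l' (minus l l')) by module_eq V.
rewrite (vnorm_eq_0 (minus l l')); [module_eq V|].
apply le_epsilon; intros eps he.
destruct (h' eps he) as [N hN].
rewrite Rplus_0_l; apply seq_limit_le with u N; [easy|].
intros n hn; now apply Rlt_le, hN.
Qed.

(** The explicit rate is what makes limits of Picard iterates continuous in the
    parameter. *)
Lemma geometric_limit (u : nat -> V) (M : R) :
  (forall n, norm (minus (u (S n)) (u n)) <= M * (1 / 2) ^ n) ->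
  exists l, forall n, norm (minus l (u n)) <= 2 * M * (1 / 2) ^ n.
Proof.
intros h.
assert (K : forall n k, norm (minus (u (n + k)%nat) (u n)) <=
                   2 * M * (1 / 2) ^ n * (1 - (1 / 2) ^ k)).
{ intros n; induction k as [|k IH].
  - rewrite Nat.add_0_r; simpl; right.
    replace (minus (u n) (u n)) with (zero : V) by module_eq V.
    rewrite vnorm_zero; ring.
  - replace (minus (u (n + S k)%nat) (u n)) with
      (plus (minus (u (S (n + k))) (u (n + k)%nat)) (minus (u (n + k)%nat) (u n)))
      by (rewrite Nat.add_succ_r; module_eq V).
    apply Rle_trans with (1 := vnorm_plus _ _).
    specialize (h (n + k)%nat); rewrite pow_add in h; simpl; lra. }
assert (hM : 0 <= M).
{ pose proof (h 0%nat); simpl in H; pose proof (vnorm_ge_0 (minus (u 1%nat) (u 0%nat))).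
  lra. }
assert (K' : forall n k, norm (minus (u (n + k)%nat) (u n)) <= 2 * M * (1 / 2) ^ n).
{ intros n k; apply Rle_trans with (1 := K n k).
  assert (0 < (1 / 2) ^ n) by (apply pow_lt; lra).
  assert (0 < (1 / 2) ^ k) by (apply pow_lt; lra).
  assert (0 <= 2 * M * (1 / 2) ^ n) by (apply Rmult_le_pos; lra).
  nra. }
destruct (cauchy_seq_limit u) as [l hl].
- intros eps he.
  destruct (half_pow_small (2 * M) eps he) as [N hN].
  exists N; intros n hn. replace n with (N + (n - N))%nat by lia.
  now apply Rle_lt_trans with (1 := K' N _).
- exists l; intros n; apply seq_limit_le with u n; [easy|].
  intros m hm; replace m with (n + (m - n))%nat by lia; apply K'.
Qed.
End Limits.

(** * Integrals over the line of exponentially decaying functions *)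

Lemma exp_small (A c eps : R) : 0 < c -> 0 < eps ->
  exists N, forall n, (N <= n)%nat -> A * exp (- c * INR n) < eps.
Proof.
intros hc he.
destruct (INR_archimed c (Rabs A / eps) hc) as [N hN].
exists N; intros n hn.
assert (h1 : 0 < exp (c * INR n)) by apply exp_pos.
assert (h2 : Rabs A / eps < exp (c * INR n)).
{ apply Rlt_le_trans with (1 := hN).
  apply Rle_trans with (2 := exp_ineq1_le _).
  apply le_INR in hn; nra. }
replace (- c * INR n) with (- (c * INR n)) by ring; rewrite exp_Ropp.
apply Rmult_lt_reg_r with (1 := h1).
rewrite Rmult_assoc, Rinv_l, Rmult_1_r by lra.
apply Rle_lt_trans with (1 := Rle_abs A).
apply Rmult_lt_compat_r with (r := eps) in h2; [|easy].
replace (Rabs A / eps * eps) with (Rabs A) in h2 by (field; lra). lra.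
Qed.

Section LineIntegral.
Context {V : CompleteNormedModule R_AbsRing}.

Definition exp_decay (c M : R) (f : R -> V) : Prop :=
  (forall s, continuous f s) /\
  forall s, norm (f s) <= M * exp (- c * Rabs s).

(** Integrals over the line are one-sided integrals of [f s + f (- s)]; this makes
    them invariant under reflection by construction. *)
Definition fold_line (f : R -> V) (s : R) : V := plus (f s) (f (- s)).

Definition line_int (f : R -> V) : V :=
  epsilon (inhabits zero)
    (fun l => seq_limit (fun n => RInt (fold_line f) 0 (INR n)) l).

Lemma continuous_reflect (f : R -> V) :
  (forall s, continuous f s) -> forall s, continuous (fun s => f (- s)) s.
Proof.
intros h s; apply (continuous_comp Ropp f); [|apply h].
apply (continuous_opp (V := R_NormedModule)), continuous_id.
Qed.

Lemma fold_line_cont (f : R -> V) :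
  (forall s, continuous f s) -> forall s, continuous (fold_line f) s.
Proof.
intros h s; apply (continuous_plus (V := V)); [apply h|].
now apply continuous_reflect.
Qed.

Lemma exp_decay_ge_0 c M f : exp_decay c M f -> 0 <= M.
Proof.
intros [_ h]; specialize (h 0); pose proof (vnorm_ge_0 (f 0)).
rewrite Rabs_R0, Rmult_0_r, exp_0 in h; lra.
Qed.

Lemma exp_decay_plus c M f M' g : exp_decay c M f -> exp_decay c M' g ->
  exp_decay c (M + M') (fun s => plus (f s) (g s)).
Proof.
intros [h1 h2] [h1' h2']; split.
- intros s; now apply (continuous_plus (V := V)).
- intros s; apply Rle_trans with (1 := vnorm_plus _ _).
  rewrite Rmult_plus_distr_r; now apply Rplus_le_compat.
Qed.

Lemma fold_line_tail c M f a b : 0 < c -> exp_decay c M f -> 0 <= a <= b ->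
  norm (RInt (fold_line f) a b) <= 2 * M / c * exp (- c * a).
Proof.
intros hc hf hab.
pose proof (exp_decay_ge_0 _ _ _ hf) as hM.
assert (I : is_RInt (fun s => 2 * M * exp (- c * s)) a b
   (minus (- (2 * M / c) * exp (- c * b)) (- (2 * M / c) * exp (- c * a)))).
{ apply (is_RInt_derive (V := R_CompleteNormedModule)
    (fun s => - (2 * M / c) * exp (- c * s))).
  - intros x _; auto_derive; [easy | field; lra].
  - intros x _; apply (ex_derive_continuous (V := R_NormedModule)).
    now auto_derive. }
apply Rle_trans with
  (minus (- (2 * M / c) * exp (- c * b)) (- (2 * M / c) * exp (- c * a))).
- apply (norm_RInt_le (fold_line f) (fun s => 2 * M * exp (- c * s)) a b); try easy.
  + intros x hx; apply Rle_trans with (1 := vnorm_plus _ _).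
    pose proof (proj2 hf x) as h1; pose proof (proj2 hf (- x)) as h2.
    rewrite Rabs_Ropp in h2; rewrite Rabs_right in h1, h2 by lra. lra.
  + apply RInt_correct, ex_RInt_cont, fold_line_cont, hf.
- change (- (2 * M / c) * exp (- c * b) - - (2 * M / c) * exp (- c * a) <=
    2 * M / c * exp (- c * a)).
  assert (0 <= 2 * M / c * exp (- c * b)).
  { apply Rmult_le_pos; [apply Rdiv_le_0_compat; lra | apply Rlt_le, exp_pos]. }
  lra.
Qed.

Lemma line_int_correct c M f : 0 < c -> exp_decay c M f ->
  seq_limit (fun n => RInt (fold_line f) 0 (INR n)) (line_int f).
Proof.
intros hc hf; unfold line_int; apply epsilon_spec.
apply cauchy_seq_limit; intros eps he.
destruct (exp_small (2 * M / c) c eps hc he) as [N hN].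
exists N; intros n hn.
rewrite <- (RInt_Chasles_cont (fold_line f) 0 (INR N) (INR n))
  by apply fold_line_cont, hf.
match goal with |- norm ?X < _ => replace X with
  (RInt (fold_line f) (INR N) (INR n)) by module_eq V end.
apply Rle_lt_trans with (2 := hN N (le_n N)).
apply fold_line_tail; try easy.
split; [apply pos_INR | now apply le_INR].
Qed.

Lemma line_int_unique f l :
  seq_limit (fun n => RInt (fold_line f) 0 (INR n)) l -> line_int f = l.
Proof.
intros h; apply (seq_limit_unique (fun n => RInt (fold_line f) 0 (INR n))); [|easy].
unfold line_int; apply epsilon_spec; now exists l.
Qed.

Lemma line_int_norm c M f : 0 < c -> exp_decay c M f ->
  norm (line_int f) <= 2 * M / c.
Proof.
intros hc hf.
replace (line_int f) with (minus (line_int f) zero) by module_eq V.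
apply (seq_limit_le (fun n => RInt (fold_line f) 0 (INR n)) _ _ _ O).
- now apply line_int_correct with c M.
- intros n _.
  replace (minus (RInt (fold_line f) 0 (INR n)) zero) with
    (RInt (fold_line f) 0 (INR n)) by module_eq V.
  pose proof (fold_line_tail c M f 0 (INR n) hc hf
    (conj (Rle_refl 0) (pos_INR n))) as h.
  now rewrite Rmult_0_r, exp_0, Rmult_1_r in h.
Qed.

Lemma seq_limit_plus (u v : nat -> V) k l :
  seq_limit u k -> seq_limit v l -> seq_limit (fun n => plus (u n) (v n)) (plus k l).
Proof.
intros hu hv eps he.
destruct (hu (eps / 2)) as [N hN]; [lra|].
destruct (hv (eps / 2)) as [N' hN']; [lra|].
exists (N + N')%nat; intros n hn.
replace (minus (plus (u n) (v n)) (plus k l)) with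
  (plus (minus (u n) k) (minus (v n) l)) by module_eq V.
apply Rle_lt_trans with (1 := vnorm_plus _ _).
specialize (hN n ltac:(lia)); specialize (hN' n ltac:(lia)); lra.
Qed.

Lemma line_int_plus c M f M' g :
  0 < c -> exp_decay c M f -> exp_decay c M' g ->
  line_int (fun s => plus (f s) (g s)) = plus (line_int f) (line_int g).
Proof.
intros hc hf hg; apply line_int_unique.
pose proof (seq_limit_plus _ _ _ _ (line_int_correct _ _ _ hc hf)
  (line_int_correct _ _ _ hc hg)) as H.
intros eps he; destruct (H eps he) as [N hN]; exists N; intros n hn.
rewrite (RInt_ext _ (fun s => plus (fold_line f s) (fold_line g s))).
- rewrite RInt_plus_cont by apply fold_line_cont, hf || apply fold_line_cont, hg.
  now apply hN.
- intros s _; unfold fold_line; module_eq V.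
Qed.

(** The boundary terms vanish at infinity. *)
Lemma line_int_derive c M f f1 :
  0 < c -> exp_decay c M f -> (forall s, is_derive f s (f1 s)) ->
  (forall s, continuous f1 s) -> line_int f1 = zero.
Proof.
intros hc hf h1 c1; apply line_int_unique; intros eps he.
destruct (exp_small (2 * M) c eps hc he) as [N hN].
exists N; intros n hn.
rewrite (RInt_of_derive (fun s => minus (f s) (f (- s)))).
- rewrite Ropp_0.
  match goal with |- norm ?X < _ => replace X with
    (minus (f (INR n)) (f (- INR n))) by module_eq V end.
  apply Rle_lt_trans with (1 := vnorm_minus _ _).
  apply Rle_lt_trans with (2 := hN n hn).
  pose proof (proj2 hf (INR n)) as K1; pose proof (proj2 hf (- INR n)) as K2.
  pose proof (pos_INR n).
  rewrite Rabs_Ropp in K2; rewrite Rabs_right in K1, K2 by lra. lra.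
- intros s; eapply is_derive_eq.
  + apply (is_derive_minus (V := V)); [apply h1|].
    apply is_derive_ext with (fun s => f (-1 * s + 0)); [intros; f_equal; ring|].
    apply is_derive_affine, h1.
  + unfold fold_line; replace (-1 * s + 0) with (- s) by ring; module_eq V.
- now apply fold_line_cont.
Qed.

Lemma line_int_ext (f g : R -> V) :
  (forall s, f s = g s) -> line_int f = line_int g.
Proof. intros h; f_equal; now apply functional_extensionality. Qed.

Lemma line_int_reflect (f : R -> V) : line_int (fun s => f (- s)) = line_int f.
Proof.
unfold line_int; f_equal; apply functional_extensionality; intros l.
do 2 f_equal; apply functional_extensionality; intros n.
f_equal; apply functional_extensionality; intros s; unfold fold_line.
rewrite Ropp_involutive; apply plus_comm.
Qed.
End LineIntegral.

Section LineIntegralLinear.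
Context {U V : CompleteNormedModule R_AbsRing}.

Lemma line_int_linear (l : U -> V) c M f :
  is_linear l -> 0 < c -> exp_decay c M f ->
  line_int (fun s => l (f s)) = l (line_int f).
Proof.
intros hl hc hf; apply line_int_unique; intros eps he.
destruct (linear_norm _ hl) as [m [hm H]].
destruct (line_int_correct c M f hc hf (eps / m)) as [N hN].
{ now apply Rdiv_lt_0_compat. }
exists N; intros n hn; specialize (hN n hn).
rewrite (RInt_ext _ (fun s => l (fold_line f s))).
- rewrite <- linear_RInt by (try easy; apply fold_line_cont, hf).
  rewrite <- (linear_minus _ _ _ hl).
  apply Rle_lt_trans with (1 := H _).
  apply Rmult_lt_compat_l with (r := m) in hN; [|easy].
  replace (m * (eps / m)) with eps in hN by (field; lra). exact hN.
- intros s _; unfold fold_line; now rewrite (linear_plus _ hl).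
Qed.

Lemma exp_decay_linear (l : U -> V) m c M f :
  is_linear l -> 0 <= m -> (forall x, norm (l x) <= m * norm x) ->
  exp_decay c M f -> exp_decay c (m * M) (fun s => l (f s)).
Proof.
intros hl hm H [h1 h2]; split.
- intros s; now apply (continuous_linear l).
- intros s; apply Rle_trans with (1 := H _); rewrite Rmult_assoc.
  now apply Rmult_le_compat_l.
Qed.
End LineIntegralLinear.

(** * Bounded perturbations of isometric groups *)

Section Perturbation.
Context {V : CompleteNormedModule R_AbsRing}.
Variables (T : R -> V -> V) (P : V -> V) (beta : R).
Hypothesis T_linear : forall t, is_linear (T t).
Hypothesis T_norm : forall t x, norm (T t x) <= norm x.
Hypothesis T_0 : forall x, T 0 x = x.
Hypothesis T_add : forall s t x, T (s + t) x = T s (T t x).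
Hypothesis T_cont : forall x t, continuous (fun t => T t x) t.
Hypothesis beta_pos : 0 < beta.
Hypothesis P_linear : is_linear P.
Hypothesis P_norm : forall x, norm (P x) <= beta * norm x.

Lemma T_inv t x : T t (T (- t) x) = x.
Proof. now rewrite <- T_add, Rplus_opp_r, T_0. Qed.

Lemma T_moving (h : R -> V) (sg : R) :
  (forall t, continuous h t) -> forall t, continuous (fun t => T (sg * t) (h t)) t.
Proof.
intros hh t; apply (continuous_family (fun t => T (sg * t)) h t 1); auto; try lra.
- apply filter_forall; intros s x; rewrite Rmult_1_l; apply T_norm.
- apply (continuous_comp (fun s => sg * s) (fun r => T r (h t))); [|apply T_cont].
  apply (continuous_scal_r (V := R_NormedModule)), continuous_id.
Qed.

(** The perturbation seen from the frame moving with the group. *)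
Definition pert (s : R) (x : V) : V := T (- s) (P (T s x)).

Lemma pert_linear s : is_linear (pert s).
Proof.
unfold pert; apply (is_linear_comp (fun x => P (T s x))); [|easy].
now apply is_linear_comp.
Qed.

Lemma pert_norm s x : norm (pert s x) <= beta * norm x.
Proof.
unfold pert; apply Rle_trans with (1 := T_norm _ _).
apply Rle_trans with (1 := P_norm _), Rmult_le_compat_l, T_norm; lra.
Qed.

Lemma pert_cont (h : R -> V) :
  (forall t, continuous h t) -> forall t, continuous (fun t => pert t (h t)) t.
Proof.
intros hh t. unfold pert.
apply (continuous_ext (fun t => T (-1 * t) (P (T (1 * t) (h t))))).
{ intros s. do 2 f_equal; [|f_equal; f_equal]; ring. }
revert t; apply T_moving; intros t.
apply (continuous_linear P (fun t => T (1 * t) (h t))); [easy|].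
now apply T_moving.
Qed.

Lemma pert_norm_exp (h : R -> V) (M t : R) :
  0 <= M -> (forall s, continuous h s) ->
  (forall s, Rabs s <= Rabs t -> norm (h s) <= M * exp (2 * beta * Rabs s)) ->
  norm (RInt (fun s => pert s (h s)) 0 t) <= M / 2 * exp (2 * beta * Rabs t).
Proof.
intros hM c h1; apply norm_RInt_exp; try lra; [now apply pert_cont|].
intros s hs; apply Rle_trans with (1 := pert_norm _ _).
specialize (h1 s hs). replace (M / 2 * (2 * beta) * exp (2 * beta * Rabs s)) with
  (beta * (M * exp (2 * beta * Rabs s))) by field.
apply Rmult_le_compat_l; lra.
Qed.

(** The integral equation [h = x + int_0 pert h] has at most one solution: on a
    bounded interval the difference of two solutions is bounded, and every
    substitution into the equation halves the bound. *)
Lemma volterra_zero (h : R -> V) :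
  (forall t, continuous h t) ->
  (forall t, h t = RInt (fun s => pert s (h s)) 0 t) -> forall t, h t = zero.
Proof.
intros c E t0.
destruct (bounded_continuity (V := V) h (- Rabs t0) (Rabs t0)) as [M hM].
{ intros; apply c. }
assert (hM0 : 0 <= M).
{ apply Rle_trans with (1 := vnorm_ge_0 (h 0)), Rlt_le, hM.
  pose proof (Rabs_pos t0); lra. }
assert (K : forall n t, Rabs t <= Rabs t0 ->
  norm (h t) <= M * (1 / 2) ^ n * exp (2 * beta * Rabs t)).
{ induction n as [|n IH]; intros t ht.
  - rewrite Rmult_1_r; apply Rle_trans with M.
    + apply Rlt_le, hM; now apply Rabs_le_between.
    + pose proof (exp_ineq1_le (2 * beta * Rabs t)).
      assert (0 <= 2 * beta * Rabs t) by
        (apply Rmult_le_pos; [lra | apply Rabs_pos]). nra.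
  - rewrite E; replace (M * (1 / 2) ^ S n) with (M * (1 / 2) ^ n / 2)
      by (simpl; field).
    apply pert_norm_exp; [|easy|].
    + apply Rmult_le_pos; [easy | apply pow_le; lra].
    + intros s hs; apply IH; lra. }
apply vnorm_eq_0, le_epsilon; intros eps he.
destruct (half_pow_small (M * exp (2 * beta * Rabs t0)) eps he) as [N hN].
specialize (K N t0 (Rle_refl _)); lra.
Qed.

Lemma pert_RInt_minus (g h : R -> V) (t : R) :
  (forall t, continuous g t) -> (forall t, continuous h t) ->
  minus (RInt (fun s => pert s (g s)) 0 t) (RInt (fun s => pert s (h s)) 0 t) =
  RInt (fun s => pert s (minus (g s) (h s))) 0 t.
Proof.
intros cg ch; rewrite <- RInt_minus_cont by now apply pert_cont.
apply RInt_ext; intros s _; symmetry; apply (linear_minus _ _ _ (pert_linear s)).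
Qed.

Lemma volterra_unique (x : V) (g h : R -> V) :
  (forall t, continuous g t) -> (forall t, continuous h t) ->
  (forall t, g t = plus x (RInt (fun s => pert s (g s)) 0 t)) ->
  (forall t, h t = plus x (RInt (fun s => pert s (h s)) 0 t)) ->
  forall t, g t = h t.
Proof.
intros cg ch Eg Eh t.
assert (cd : forall t, continuous (fun t => minus (g t) (h t)) t)
  by (intros; now apply (continuous_minus (V := V))).
assert (Z : minus (g t) (h t) = zero).
{ apply (volterra_zero (fun t => minus (g t) (h t))); [easy|].
  intros r; rewrite <- pert_RInt_minus by easy.
  rewrite Eg, (Eh r); module_eq V. }
replace (g t) with (plus (h t) (minus (g t) (h t))) by module_eq V.
rewrite Z; module_eq V.
Qed.

Fixpoint picard (x : V) (n : nat) (t : R) : V :=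
  match n with
  | O => x
  | S n => plus x (RInt (fun s => pert s (picard x n s)) 0 t)
  end.

Lemma picard_cont x n t : continuous (picard x n) t.
Proof.
revert t; induction n as [|n IH]; intros t; simpl.
- apply continuous_const.
- apply (continuous_plus (V := V)); [apply continuous_const|].
  apply continuous_RInt_cont; now apply pert_cont.
Qed.

Lemma picard_step x n t :
  norm (minus (picard x (S n) t) (picard x n t)) <=
  norm x / 2 * (1 / 2) ^ n * exp (2 * beta * Rabs t).
Proof.
pose proof (vnorm_ge_0 x) as hx.
revert t; induction n as [|n IH]; intros t.
- replace (minus (picard x 1 t) (picard x 0 t)) with
    (RInt (fun s => pert s x) 0 t) by (simpl; module_eq V).
  rewrite pow_O, Rmult_1_r.
  apply (pert_norm_exp (fun _ => x)); [easy | intros; apply continuous_const|].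
  intros s _; pose proof (exp_ineq1_le (2 * beta * Rabs s)).
  assert (0 <= 2 * beta * Rabs s) by
    (apply Rmult_le_pos; [lra | apply Rabs_pos]). nra.
- replace (minus (picard x (S (S n)) t) (picard x (S n) t)) with
    (minus (RInt (fun s => pert s (picard x (S n) s)) 0 t)
       (RInt (fun s => pert s (picard x n s)) 0 t))
    by (cbn [picard]; module_eq V).
  rewrite pert_RInt_minus by apply picard_cont.
  replace (norm x / 2 * (1 / 2) ^ S n) with (norm x / 2 * (1 / 2) ^ n / 2)
    by (simpl; field).
  apply pert_norm_exp.
  + apply Rmult_le_pos; [lra | apply pow_le; lra].
  + intros s; apply (continuous_minus (V := V)); apply picard_cont.
  + intros s _; apply IH.
Qed.

Lemma volterra_solution_ex x t :
  exists l, forall n, norm (minus l (picard x n t)) <=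
    norm x * exp (2 * beta * Rabs t) * (1 / 2) ^ n.
Proof.
destruct (geometric_limit (fun n => picard x n t)
  (norm x / 2 * exp (2 * beta * Rabs t))) as [l hl].
- intros n; apply Rle_trans with (1 := picard_step x n t); right; ring.
- exists l; intros n; apply Rle_trans with (1 := hl n); right; field.
Qed.

(** [T (- t)] applied to the perturbed group. *)
Definition moving_frame (t : R) (x : V) : V :=
  proj1_sig (constructive_indefinite_description _ (volterra_solution_ex x t)).

Lemma moving_frame_approx t x n :
  norm (minus (moving_frame t x) (picard x n t)) <=
  norm x * exp (2 * beta * Rabs t) * (1 / 2) ^ n.
Proof.
unfold moving_frame.
now destruct (constructive_indefinite_description _ (volterra_solution_ex x t)).
Qed.
Lemma moving_frame_cont x t0 : continuous (fun t => moving_frame t x) t0.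
Proof.
apply continuous_norm_iff; intros eps he.
destruct (half_pow_small (norm x * exp (2 * beta * (Rabs t0 + 1))) (eps / 3))
  as [n hn]; [lra|].
destruct (proj1 (continuous_norm_iff _ _) (picard_cont x n t0) (eps / 3))
  as [d [hd H]]; [lra|].
exists (Rmin 1 d); split; [apply Rmin_pos; lra|].
intros y hy; apply Rmin_Rgt in hy as [hy1 hy2]; specialize (H y hy2).
assert (K : forall t, Rabs t <= Rabs t0 + 1 ->
  norm (minus (moving_frame t x) (picard x n t)) < eps / 3).
{ intros t ht; apply Rle_lt_trans with (1 := moving_frame_approx t x n).
  apply Rle_lt_trans with (2 := hn).
  apply Rmult_le_compat_r; [apply pow_le; lra|].
  apply Rmult_le_compat_l; [apply vnorm_ge_0|].
  apply exp_monotone, Rmult_le_compat_l; lra. }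
pose proof (K t0 ltac:(lra)).
assert (hy' : Rabs y <= Rabs t0 + 1).
{ replace y with (t0 + (y - t0)) by ring.
  apply Rle_trans with (1 := Rabs_triang _ _); lra. }
specialize (K y hy').
replace (minus (moving_frame y x) (moving_frame t0 x)) with
  (plus (minus (minus (moving_frame y x) (picard x n y))
           (minus (moving_frame t0 x) (picard x n t0)))
     (minus (picard x n y) (picard x n t0))) by module_eq V.
apply Rle_lt_trans with (1 := vnorm_plus _ _).
pose proof (vnorm_minus (minus (moving_frame y x) (picard x n y))
           (minus (moving_frame t0 x) (picard x n t0))).
lra.
Qed.

Lemma moving_frame_eq x t :
  moving_frame t x = plus x (RInt (fun s => pert s (moving_frame s x)) 0 t).
Proof.
set (I := RInt (fun s => pert s (moving_frame s x)) 0 t).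
replace (moving_frame t x) with
  (plus (plus x I) (minus (moving_frame t x) (plus x I))) by module_eq V.
rewrite (vnorm_eq_0 (minus (moving_frame t x) (plus x I))); [module_eq V|].
apply le_epsilon; intros eps he; rewrite Rplus_0_l.
destruct (half_pow_small (norm x * exp (2 * beta * Rabs t)) eps he) as [n hn].
replace (minus (moving_frame t x) (plus x I)) with
  (minus (minus (moving_frame t x) (picard x (S n) t))
     (minus I (RInt (fun s => pert s (picard x n s)) 0 t)))
  by (cbn [picard]; module_eq V).
unfold I; rewrite pert_RInt_minus by
  (intros; first [apply moving_frame_cont | apply picard_cont]).
apply Rle_trans with (1 := vnorm_minus _ _).
pose proof (moving_frame_approx t x (S n)) as h1.
assert (h2 : norm (RInt (fun s => pert s (minus (moving_frame s x) (picard x n s))) 0 t)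
  <= norm x * (1 / 2) ^ n / 2 * exp (2 * beta * Rabs t)).
{ apply pert_norm_exp.
  - apply Rmult_le_pos; [apply vnorm_ge_0 | apply pow_le; lra].
  - intros s; apply (continuous_minus (V := V));
      [apply moving_frame_cont | apply picard_cont].
  - intros s _; apply Rle_trans with (1 := moving_frame_approx s x n).
    right; ring. }
simpl pow in h1; lra.
Qed.

Lemma moving_frame_char x (h : R -> V) :
  (forall t, continuous h t) ->
  (forall t, h t = plus x (RInt (fun s => pert s (h s)) 0 t)) ->
  forall t, moving_frame t x = h t.
Proof.
intros c E; apply (volterra_unique x); auto.
- intros; apply moving_frame_cont.
- apply moving_frame_eq.
Qed.

Definition perturbed (t : R) (x : V) : V := T t (moving_frame t x).

Lemma perturbed_norm t x :
  norm (perturbed t x) <= 2 * exp (2 * beta * Rabs t) * norm x.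
Proof.
apply Rle_trans with (1 := T_norm _ _).
pose proof (moving_frame_approx t x 0) as h; simpl in h.
replace (moving_frame t x) with (plus (minus (moving_frame t x) x) x) by module_eq V.
apply Rle_trans with (1 := vnorm_plus _ _).
pose proof (exp_ineq1_le (2 * beta * Rabs t)).
assert (0 <= 2 * beta * Rabs t) by
    (apply Rmult_le_pos; [lra | apply Rabs_pos]).
pose proof (vnorm_ge_0 x). nra.
Qed.

Lemma perturbed_cont x t : continuous (fun t => perturbed t x) t.
Proof.
unfold perturbed.
apply (continuous_ext (fun t => T (1 * t) (moving_frame t x))).
{ intros s; now rewrite Rmult_1_l. }
revert t; apply T_moving; intros; apply moving_frame_cont.
Qed.

Lemma perturbed_0 x : perturbed 0 x = x.
Proof.
unfold perturbed; rewrite T_0, moving_frame_eq, RInt_point; module_eq V.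
Qed.

(** Both sides solve the same Volterra equation. The case [sg = -1] is a map that
    reverses time, the case [sg = 1] one that commutes with the group. *)
Lemma perturbed_intertwine (Q : V -> V) (sg : R) :
  sg * sg = 1 -> is_linear Q ->
  (forall t x, Q (T t x) = T (sg * t) (Q x)) ->
  (forall x, Q (P x) = scal sg (P (Q x))) ->
  forall t x, Q (perturbed t x) = perturbed (sg * t) (Q x).
Proof.
intros hs hQ hT hP t x; unfold perturbed; rewrite hT; f_equal.
assert (hc : forall t, continuous (fun t => Q (moving_frame (sg * t) x)) t).
{ intros r; apply (continuous_linear Q); [easy|].
  apply (continuous_comp (fun s => sg * s) (fun r => moving_frame r x));
    [|apply moving_frame_cont].
  apply (continuous_scal_r (V := R_NormedModule)), continuous_id. }
symmetry; rewrite (moving_frame_char (Q x) (fun t => Q (moving_frame (sg * t) x)) hc).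
- now rewrite <- Rmult_assoc, hs, Rmult_1_l.
- clear t; intros t; rewrite moving_frame_eq, (linear_plus _ hQ).
  assert (c : forall s, continuous (fun s => pert s (moving_frame s x)) s).
  { apply pert_cont; intros; apply moving_frame_cont. }
  rewrite linear_RInt by easy.
  rewrite RInt_scale by (intros; now apply (continuous_linear Q)).
  f_equal; apply RInt_ext; intros s _; unfold pert.
  rewrite hT, hP, hT, !(linear_scal _ (T_linear _)).
  rewrite Ropp_mult_distr_r_reverse, <- Rmult_assoc, hs, Rmult_1_l.
  rewrite (scal_assoc (V := V)). change (mult sg sg) with (sg * sg).
  rewrite hs. apply (scal_one (V := V)).
Qed.

Lemma perturbed_linear t : is_linear (perturbed t).
Proof.
assert (hp : forall x y, perturbed t (plus x y) = plus (perturbed t x) (perturbed t y)).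
{ intros x y; unfold perturbed; rewrite <- (linear_plus _ (T_linear t)); f_equal.
  apply (moving_frame_char _
    (fun t => plus (moving_frame t x) (moving_frame t y))).
  - intros r; apply (continuous_plus (V := V)); apply moving_frame_cont.
  - intros r; rewrite (moving_frame_eq x r) at 1; rewrite (moving_frame_eq y r) at 1.
    rewrite (RInt_ext (fun s => pert s (plus (moving_frame s x) (moving_frame s y)))
      (fun s => plus (pert s (moving_frame s x)) (pert s (moving_frame s y)))).
    + rewrite RInt_plus_cont by
        (apply pert_cont; intros; apply moving_frame_cont).
      module_eq V.
    + intros s _; apply (linear_plus _ (pert_linear s)). }
split; [easy| |].
- intros k x; change (perturbed t (scal k x) = scal k (perturbed t x)).
  replace t with (1 * t) at 1 by ring; symmetry.
  replace (1 * t) with (1 * (t * 1)) by ring; rewrite Rmult_1_r.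
  apply (perturbed_intertwine (scal k) 1).
  + ring.
  + apply (is_linear_scal_r (V := V)); intros; apply Rmult_comm.
  + intros r y; rewrite Rmult_1_l; symmetry; apply (linear_scal _ (T_linear r)).
  + intros y; rewrite (linear_scal _ P_linear); module_eq V.
- exists (2 * exp (2 * beta * Rabs t)); split.
  + pose proof (exp_pos (2 * beta * Rabs t)); lra.
  + intros x; apply perturbed_norm.
Qed.

(** Generators are given by their graphs, in integrated form: the graph is then
    visibly linear and closed. *)
Definition T_gen (x y : V) : Prop :=
  forall t, T t x = plus x (RInt (fun s => T s y) 0 t).

Definition perturbed_gen (x y : V) : Prop := T_gen x (minus y (P x)).

Lemma T_RInt_linear r : is_linear (fun y => RInt (fun s => T s y) 0 r).
Proof.
apply (RInt_family_linear T r 1); auto; [lra|].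
intros s x _; rewrite Rmult_1_l; apply T_norm.
Qed.

Lemma T_RInt_shift r t y :
  RInt (fun s => T s (T t y)) 0 r =
  minus (RInt (fun s => T s y) 0 (t + r)) (RInt (fun s => T s y) 0 t).
Proof.
rewrite (RInt_of_derive (fun r => RInt (fun s => T s y) 0 (1 * r + t))
  (fun s => T s (T t y))).
- f_equal; f_equal; ring.
- intros s; eapply is_derive_eq.
  + apply (is_derive_affine (fun b => RInt (fun s => T s y) 0 b)).
    apply (is_derive_RInt_cont (fun s => T s y)), T_cont.
  + cbn beta; rewrite Rmult_1_l, T_add; module_eq V.
- apply T_cont.
Qed.

(** Formally [d/ds (T s h) = D T s h + T s h'], with [D] the generator. *)
Lemma T_gen_moving (h h1 : R -> V) (t : R) :
  (forall s, is_derive h s (h1 s)) -> (forall s, continuous h1 s) ->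
  T_gen (RInt (fun s => T s (h s)) 0 t)
    (minus (minus (T t (h t)) (h 0)) (RInt (fun s => T s (h1 s)) 0 t)).
Proof.
intros hh hc r.
assert (hh' : forall s, continuous h s)
  by (intros s; now apply is_derive_continuous with (h1 s)).
assert (c0 : forall g : R -> V, (forall s, continuous g s) ->
  forall s, continuous (fun s => T s (g s)) s).
{ intros g cg s; apply (continuous_ext (fun s => T (1 * s) (g s))).
  - intros; now rewrite Rmult_1_l.
  - revert s; now apply T_moving. }
set (M := fun y => RInt (fun s => T s y) 0 r).
assert (hM : is_linear M) by apply T_RInt_linear.
set (A := fun t => RInt (fun s => T s (h s)) 0 t).
set (A1 := fun t => RInt (fun s => T s (h1 s)) 0 t).
change (T r (A t) = plus (A t) (M (minus (minus (T t (h t)) (h 0)) (A1 t)))).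
rewrite !(linear_minus _ _ _ hM).
(* The difference of the two sides of the claim, as a function of the upper bound. *)
set (D := fun t => minus (minus (T r (A t)) (A t))
  (minus (minus (M (T t (h t))) (M (h 0))) (M (A1 t)))).
assert (E : D t = D 0).
{ apply derive_zero_const; intros s; unfold D.
  assert (dA : is_derive A s (T s (h s))).
  { apply (is_derive_RInt_cont (fun s => T s (h s))); now apply c0. }
  assert (dA1 : is_derive A1 s (T s (h1 s))).
  { apply (is_derive_RInt_cont (fun s => T s (h1 s))); now apply c0. }
  assert (dM : is_derive (fun s => M (T s (h s))) s
    (plus (minus (T (s + r) (h s)) (T s (h s))) (M (T s (h1 s))))).
  { destruct (linear_norm _ hM) as [m [hm Hm]].
    apply (is_derive_family (fun s y => M (T s y)) h s m); auto.
    - apply filter_forall; intros u; split.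
      { apply (is_linear_comp (T u) M); auto. }
      intros x; apply Rle_trans with (1 := Hm _).
      apply Rmult_le_compat_l; [lra | apply T_norm].
    - apply is_derive_ext with (fun u => minus
        (RInt (fun s' => T s' (h s)) 0 (1 * u + r)) (RInt (fun s' => T s' (h s)) 0 u)).
      { intros u; unfold M; rewrite T_RInt_shift, Rmult_1_l; easy. }
      apply (is_derive_minus (V := V)).
      + eapply is_derive_eq.
        * apply (is_derive_affine (fun b => RInt (fun s' => T s' (h s)) 0 b)).
          apply (is_derive_RInt_cont (fun s' => T s' (h s))), T_cont.
        * cbn beta; rewrite Rmult_1_l; module_eq V.
      + apply (is_derive_RInt_cont (fun s' => T s' (h s))), T_cont.
    - apply (continuous_linear M); [easy | apply T_cont]. }
  eapply is_derive_eq.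
  - apply (is_derive_minus (V := V)).
    + apply (is_derive_minus (V := V)); [|exact dA].
      apply (is_derive_linear (T r)); [easy | exact dA].
    + apply (is_derive_minus (V := V)).
      * apply (is_derive_minus (V := V)); [exact dM|apply is_derive_const].
      * apply (is_derive_linear M); [easy | exact dA1].
  - rewrite Rplus_comm, T_add; module_eq V. }
assert (E0 : D 0 = zero).
{ unfold D, A, A1; rewrite !RInt_point, T_0.
  rewrite (linear_zero _ (T_linear r) : T r zero = zero).
  rewrite (linear_zero _ hM : M zero = zero). module_eq V. }
rewrite E0 in E; unfold D in E.
match type of E with ?X = _ =>
  transitivity (plus X (plus (A t) (minus (minus (M (T t (h t))) (M (h 0))) (M (A1 t))))) end.
- module_eq V.
- rewrite E; module_eq V.
Qed.

Lemma moving_frame_derive x t :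
  is_derive (fun t => moving_frame t x) t (pert t (moving_frame t x)).
Proof.
apply is_derive_ext with
  (fun t => plus x (RInt (fun s => pert s (moving_frame s x)) 0 t)).
{ intros s; symmetry; apply moving_frame_eq. }
eapply is_derive_eq.
- apply (is_derive_plus (V := V)); [apply is_derive_const|].
  apply (is_derive_RInt_cont (fun s => pert s (moving_frame s x))).
  apply pert_cont; intros; apply moving_frame_cont.
- module_eq V.
Qed.

(** The orbit is [T s (moving_frame s x)], and the derivative of the moving factor
    contributes [P (perturbed s x)], which is the difference between the two
    generators. *)
Lemma perturbed_gen_RInt x t :
  perturbed_gen (RInt (fun s => perturbed s x) 0 t) (minus (perturbed t x) x).
Proof.
unfold perturbed_gen.
rewrite linear_RInt by (try easy; apply perturbed_cont).
pose proof (T_gen_moving (fun s => moving_frame s x)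
  (fun s => pert s (moving_frame s x)) t (moving_frame_derive x)
  (pert_cont _ (moving_frame_cont x))) as H.
assert (E : moving_frame 0 x = x)
  by (rewrite moving_frame_eq, RInt_point; module_eq V).
cbn beta in H; rewrite E in H.
rewrite (RInt_ext (fun s => T s (pert s (moving_frame s x)))
  (fun s => P (perturbed s x))) in H; [exact H|].
intros s _; apply T_inv.
Qed.

Lemma T_gen_derive x y t : T_gen x y -> is_derive (fun t => T t x) t (T t y).
Proof.
intros h; apply is_derive_ext with (fun t => plus x (RInt (fun s => T s y) 0 t)).
{ intros s; symmetry; apply h. }
eapply is_derive_eq.
- apply (is_derive_plus (V := V)); [apply is_derive_const|].
  apply (is_derive_RInt_cont (fun s => T s y)), T_cont.
- module_eq V.
Qed.

Lemma T_gen_plus x y x' y' :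
  T_gen x y -> T_gen x' y' -> T_gen (plus x x') (plus y y').
Proof.
intros h h' t; rewrite (linear_plus _ (T_linear t)), h, h'.
rewrite (linear_plus _ (T_RInt_linear t)); module_eq V.
Qed.

(** With [w t = x + int_0^t W s y], the previous lemma gives [w' = B w], so that
    [T (- t) w t] solves the integral equation that characterizes [W t x]. *)
Lemma perturbed_gen_orbit x y t :
  perturbed_gen x y ->
  perturbed t x = plus x (RInt (fun s => perturbed s y) 0 t).
Proof.
intros hxy.
set (w := fun t => plus x (RInt (fun s => perturbed s y) 0 t)).
assert (dw : forall t, is_derive w t (perturbed t y)).
{ intros s; eapply is_derive_eq.
  - apply (is_derive_plus (V := V)); [apply is_derive_const|].
    apply (is_derive_RInt_cont (fun s => perturbed s y)), perturbed_cont.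
  - module_eq V. }
assert (gw : forall t, T_gen (w t) (minus (perturbed t y) (P (w t)))).
{ intros s.
  assert (E : minus (perturbed s y) (P (w s)) = plus (minus y (P x))
    (minus (minus (perturbed s y) y) (P (RInt (fun s => perturbed s y) 0 s)))).
  { unfold w; rewrite (linear_plus _ P_linear); module_eq V. }
  rewrite E; apply T_gen_plus; [exact hxy | apply perturbed_gen_RInt]. }
assert (cw : forall t, continuous w t)
  by (intros s; apply is_derive_continuous with (1 := dw s)).
set (h := fun t => T (- t) (w t)).
assert (ch : forall t, continuous h t).
{ intros s; unfold h; apply (continuous_ext (fun s => T (-1 * s) (w s))).
  - intros u; f_equal; ring.
  - revert s; now apply T_moving. }
assert (dh : forall t, is_derive h t (pert t (h t))).
{ intros s; eapply is_derive_eq.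
  - apply (is_derive_family (fun s => T (- s)) w s 1) with
      (d := opp (T (- s) (minus (perturbed s y) (P (w s))))) (h1 := perturbed s y);
      auto; try lra.
    + apply filter_forall; intros u; split; [easy|].
      intros z; rewrite Rmult_1_l; apply T_norm.
    + apply is_derive_ext with (fun u => T (-1 * u + 0) (w s)).
      { intros u; f_equal; ring. }
      eapply is_derive_eq.
      * apply (is_derive_affine (fun u => T u (w s))).
        apply T_gen_derive, gw.
      * replace (-1 * s + 0) with (- s) by ring.
        rewrite (linear_minus _ _ _ (T_linear (- s))); module_eq V.
    + apply (continuous_ext (fun u => T (-1 * u) (perturbed s y))).
      { intros u; f_equal; ring. }
      revert s; intros s; apply (T_moving (fun _ => perturbed s y)).
      intros; apply continuous_const.
  - unfold pert, h; rewrite T_inv, (linear_minus _ _ _ (T_linear (- s))).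
    module_eq V. }
unfold perturbed at 1; rewrite (moving_frame_char x h ch).
- unfold h; now rewrite T_inv.
- intros s; rewrite (RInt_of_derive h); [|easy|now apply pert_cont].
  replace (h 0) with x; [module_eq V|].
  unfold h, w; rewrite RInt_point, Ropp_0, T_0; module_eq V.
Qed.

(** If [Q] reverses time when [sg = -1], it sends the generator to [sg] times the
    generator; [sg = 1] is the case of a map that commutes with [T] and [P]. *)
Lemma perturbed_gen_intertwine (Q : V -> V) (sg : R) x y :
  sg * sg = 1 -> is_linear Q ->
  (forall t x, Q (T t x) = T (sg * t) (Q x)) ->
  (forall x, Q (P x) = scal sg (P (Q x))) ->
  perturbed_gen x y -> perturbed_gen (Q x) (scal sg (Q y)).
Proof.
intros hs hQ hT hP h t.
replace (T t (Q x)) with (Q (T (sg * t) x))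
  by (rewrite hT, <- Rmult_assoc, hs; f_equal; ring).
rewrite h, (linear_plus _ hQ); f_equal.
rewrite linear_RInt by (try easy; apply T_cont).
rewrite RInt_scale by
  (intros; apply (continuous_linear Q); [easy | apply T_cont]).
apply RInt_ext; intros s _.
rewrite hT, <- (linear_scal _ (T_linear _)).
f_equal; [rewrite <- Rmult_assoc, hs; ring|].
rewrite (linear_minus _ _ _ hQ), hP.
transitivity (minus (scal sg (Q y)) (scal (sg * sg) (P (Q x)))); [module_eq V|].
rewrite hs; module_eq V.
Qed.

Lemma perturbed_gen_closed x y :
  (forall eps, 0 < eps -> exists x' y', perturbed_gen x' y' /\
     norm (minus x' x) <= eps /\ norm (minus y' y) <= eps) ->
  perturbed_gen x y.
Proof.
intros h t.
set (M := fun y => RInt (fun s => T s y) 0 t).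
assert (hM : is_linear M) by apply T_RInt_linear.
destruct (linear_norm _ hM) as [m [hm Hm]].
change (T t x = plus x (M (minus y (P x)))).
set (d := fun x y => minus (minus (T t x) x) (M (minus y (P x)))).
assert (Z : d x y = zero).
{ apply vnorm_eq_0, le_epsilon; intros eps he; rewrite Rplus_0_l.
  assert (hk : 0 < 2 + m * (1 + beta)) by nra.
  destruct (h (eps / (2 + m * (1 + beta)))) as [x' [y' [g [h1 h2]]]].
  { now apply Rdiv_lt_0_compat. }
  set (e := eps / (2 + m * (1 + beta))) in *.
  assert (E : d x y = minus (M (minus (minus y' y) (P (minus x' x))))
    (minus (T t (minus x' x)) (minus x' x))).
  { unfold d.
    rewrite !(linear_minus _ _ _ P_linear), !(linear_minus _ _ _ hM),
      !(linear_minus _ _ _ (T_linear t)).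
    pose proof (g t) as g'.
    change (T t x' = plus x' (M (minus y' (P x')))) in g'.
    rewrite g', (linear_minus _ _ _ hM); module_eq V. }
  rewrite E; apply Rle_trans with (1 := vnorm_minus _ _).
  assert (k1 : norm (minus (minus y' y) (P (minus x' x))) <= (1 + beta) * e).
  { apply Rle_trans with (1 := vnorm_minus _ _).
    pose proof (P_norm (minus x' x)). nra. }
  pose proof (Hm (minus (minus y' y) (P (minus x' x)))) as k2.
  pose proof (vnorm_minus (T t (minus x' x)) (minus x' x)) as k3.
  pose proof (T_norm t (minus x' x)) as k4.
  replace eps with (m * ((1 + beta) * e) + 2 * e) by (unfold e; field; lra).
  assert (m * norm (minus (minus y' y) (P (minus x' x))) <= m * ((1 + beta) * e))
    by (apply Rmult_le_compat_l; lra).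
  lra. }
transitivity (plus (d x y) (plus x (M (minus y (P x))))); [unfold d; module_eq V|].
rewrite Z; module_eq V.
Qed.

(** The generator is the zero set of bounded linear maps of the pair [(x, y)], one
    for each [t], and these commute with the integral. *)
Lemma perturbed_gen_line_int c M f M' g :
  0 < c -> exp_decay c M f -> exp_decay c M' g ->
  (forall s, perturbed_gen (f s) (g s)) ->
  perturbed_gen (line_int f) (line_int g).
Proof.
intros hc hf hg h t.
set (N := fun y => RInt (fun s => T s y) 0 t).
assert (hN : is_linear N) by apply T_RInt_linear.
change (T t (line_int f) =
  plus (line_int f) (N (minus (line_int g) (P (line_int f))))).
assert (hPN : is_linear (fun x => opp (N (P x)))).
{ apply (is_linear_comp (fun x => N (P x)) opp); [|apply (is_linear_opp (V := V))].
  apply (is_linear_comp P N); easy. }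
destruct (linear_norm _ hN) as [n [hn Hn]].
destruct (linear_norm _ hPN) as [n' [hn' Hn']].
pose proof (exp_decay_linear N n c M' g hN (Rlt_le _ _ hn) Hn hg) as dN.
pose proof (exp_decay_linear _ n' c M f hPN (Rlt_le _ _ hn') Hn' hf) as dPN.
rewrite <- (line_int_linear (T t) c M f) by easy.
rewrite (line_int_ext (fun s => T t (f s))
  (fun s => plus (f s) (plus (N (g s)) (opp (N (P (f s))))))).
2: { intros s; rewrite (h s t); fold (N (minus (g s) (P (f s)))).
     now rewrite (linear_minus _ _ _ hN). }
rewrite (linear_minus _ _ _ hN).
rewrite (line_int_plus c M f _ _ hc hf (exp_decay_plus _ _ _ _ _ dN dPN)).
rewrite (line_int_plus c _ _ _ _ hc dN dPN).
rewrite (line_int_linear N c M' g) by easy.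
rewrite (line_int_linear (fun x => opp (N (P x))) c M f) by easy.
module_eq V.
Qed.
End Perturbation.

(** * The space of continuous functions of period two *)

Lemma norm_C (z : C) : @norm _ C_R_NormedModule z = Cmod z.
Proof.
unfold norm, Cmod; simpl; unfold prod_norm; f_equal; simpl.
unfold norm; simpl; unfold abs; simpl.
rewrite !Rmult_1_r, <- !Rabs_mult, !Rabs_right; try ring; apply Rle_ge, Rle_0_sqr.
Qed.

Lemma scal_C (r : R) (z : C) : @scal _ C_R_NormedModule r z = (RtoC r * z)%C.
Proof.
destruct z as [a b]; unfold scal; simpl; unfold prod_scal, Cmult; simpl.
unfold scal; simpl; unfold mult; simpl; f_equal; ring.
Qed.

Lemma continuous_R_Cmod (f : R -> C) (x : R) :
  continuous f x <->
  forall eps, 0 < eps -> exists d, 0 < d /\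
    forall y, Rabs (y - x) < d -> Cmod (f y - f x)%C < eps.
Proof.
rewrite (continuous_norm_iff (V := C_R_CompleteNormedModule)).
assert (E : forall y, @norm _ C_R_CompleteNormedModule (minus (f y) (f x)) =
  Cmod (f y - f x)%C) by (intros; apply norm_C).
split; intros h eps he; destruct (h eps he) as [d [hd H]]; exists d;
  (split; [easy|]); intros y hy; specialize (H y hy); 
  [apply (Rle_lt_trans _ _ _ (Req_le _ _ (eq_sym (E y))) H)
  | apply (Rle_lt_trans _ _ _ (Req_le _ _ (E y)) H)].
Qed.

Lemma Cmult_linear (c : C) :
  is_linear (U := C_R_NormedModule) (V := C_R_NormedModule) (fun z => (c * z)%C).
Proof.
split.
- intros x y; apply (Cmult_plus_distr_l c x y).
- intros k x; change (c * @scal _ C_R_NormedModule k x =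
    @scal _ C_R_NormedModule k (c * x))%C.
  rewrite !scal_C; ring.
- exists (Cmod c + 1); split; [pose proof (Cmod_ge_0 c); lra|].
  intros x; rewrite !norm_C, Cmod_mult.
  apply Rmult_le_compat_r; [apply Cmod_ge_0 | lra].
Qed.

Lemma locally_Cmod_bound (f : R -> C) (x : R) : continuous f x ->
  exists M, 0 < M /\ locally x (fun t => Cmod (f t) <= M).
Proof.
intros hf; exists (Cmod (f x) + 1); split; [pose proof (Cmod_ge_0 (f x)); lra|].
destruct (proj1 (continuous_R_Cmod f x) hf 1 Rlt_0_1) as [d [hd H]].
exists (mkposreal d hd); intros y hy.
replace (f y) with ((f y - f x) + f x)%C by ring.
apply Rle_trans with (1 := Cmod_triangle _ _).
specialize (H y hy); lra.
Qed.

Lemma continuous_Cmult (f g : R -> C) (x : R) :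
  continuous f x -> continuous g x -> continuous (fun x => f x * g x)%C x.
Proof.
intros hf hg; destruct (locally_Cmod_bound f x hf) as [M [hM H]].
apply (continuous_family (U := C_R_CompleteNormedModule)
  (V := C_R_CompleteNormedModule) (fun t z => (f t * z)%C) g x M); auto.
- intros t; apply Cmult_linear.
- apply filter_imp with (2 := H); intros t ht z.
  change (@norm _ C_R_NormedModule (f t * z)%C <= M * @norm _ C_R_NormedModule z).
  rewrite !norm_C, Cmod_mult; apply Rmult_le_compat_r; [apply Cmod_ge_0 | easy].
- apply (continuous_ext (fun t => (g x * f t)%C)); [intros; apply Cmult_comm|].
  apply (continuous_linear (U := C_R_CompleteNormedModule)
    (V := C_R_CompleteNormedModule) (fun z => (g x * z)%C) f); [|easy].
  apply Cmult_linear.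
Qed.

Record Per : Type := mkPer {
  per_fun :> R -> C;
  per_cont : forall x, continuous per_fun x;
  per_period : forall x, per_fun (x + 2) = per_fun x
}.

Lemma Per_ext (f g : Per) : (forall x, f x = g x) -> f = g.
Proof.
destruct f as [f hf pf], g as [g hg pg]; simpl; intros E.
assert (f = g) by (now apply functional_extensionality); subst g.
f_equal; apply proof_irrelevance.
Qed.

Lemma per_shift (f : Per) (k : Z) x : f (x + 2 * IZR k) = f x.
Proof.
assert (K : forall (n : nat) x, f (x + 2 * INR n) = f x).
{ clear; induction n as [|n IH]; intros x.
  - simpl INR; f_equal; ring.
  - rewrite S_INR, <- (IH x), <- (per_period f (x + 2 * INR n)).
    f_equal; ring. }
destruct (Z.le_gt_cases 0 k) as [h|h].
- rewrite <- (Z2Nat.id k h), <- INR_IZR_INZ; apply K.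
- rewrite <- (K (Z.to_nat (- k)) (x + 2 * IZR k)), INR_IZR_INZ, Z2Nat.id by lia.
  rewrite opp_IZR; f_equal; ring.
Qed.

Lemma period_reduce (x : R) : exists k : Z, -1 <= x - 2 * IZR k < 1.
Proof.
exists (up ((x - 1) / 2)); destruct (archimed ((x - 1) / 2)); lra.
Qed.

Definition Per_plus (f g : Per) : Per.
Proof.
refine (mkPer (fun x => plus (f x) (g x)) _ _).
- intros x; apply (continuous_plus (V := C_R_NormedModule)); apply per_cont.
- intros x; cbn beta; now rewrite !per_period.
Defined.
Definition Per_opp (f : Per) : Per.
Proof.
refine (mkPer (fun x => opp (f x)) _ _).
- intros x; apply (continuous_opp (V := C_R_NormedModule)); apply per_cont.
- intros x; cbn beta; now rewrite !per_period.
Defined.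
Definition Per_scal (c : R) (f : Per) : Per.
Proof.
refine (mkPer (fun x => @scal _ C_R_NormedModule c (f x)) _ _).
- intros x; apply (continuous_scal_r (V := C_R_NormedModule)); apply per_cont.
- intros x; cbn beta; now rewrite !per_period.
Defined.
Definition Per_zero : Per.
Proof.
refine (mkPer (fun x => zero) _ _); [|easy].
intros x; apply continuous_const.
Defined.

Definition Per_AbelianMonoid_mixin : AbelianMonoid.mixin_of Per.
Proof.
apply (AbelianMonoid.Mixin Per Per_plus Per_zero); intros; apply Per_ext;
  intros t; simpl.
- apply plus_comm.
- apply plus_assoc.
- apply plus_zero_r.
Defined.
Canonical Per_AbelianMonoid :=
  AbelianMonoid.Pack Per Per_AbelianMonoid_mixin Per.

Definition Per_AbelianGroup_mixin : AbelianGroup.mixin_of Per_AbelianMonoid.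
Proof.
apply (AbelianGroup.Mixin Per_AbelianMonoid Per_opp).
intros f; apply Per_ext; intros x; apply (plus_opp_r (G := C_AbelianGroup)).
Defined.
Canonical Per_AbelianGroup := AbelianGroup.Pack Per
  (AbelianGroup.Class _ Per_AbelianMonoid_mixin Per_AbelianGroup_mixin) Per.

Definition Per_ModuleSpace_mixin :
  ModuleSpace.mixin_of R_Ring Per_AbelianGroup.
Proof.
apply (ModuleSpace.Mixin R_Ring Per_AbelianGroup Per_scal); intros;
  apply Per_ext; intros t; simpl.
- apply (scal_assoc (V := C_R_NormedModule)).
- apply (scal_one (V := C_R_NormedModule)).
- apply (scal_distr_l (V := C_R_NormedModule)).
- apply (scal_distr_r (V := C_R_NormedModule)).
Defined.
Canonical Per_ModuleSpace := ModuleSpace.Pack R_Ring Per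
  (ModuleSpace.Class R_Ring Per (AbelianGroup.class Per_AbelianGroup)
     Per_ModuleSpace_mixin) Per.

Definition per_norm (f : Per) : R :=
  real (Lub_Rbar (fun r => exists x : R, r = Cmod (f x))).

Lemma per_bounded (f : Per) : exists M, forall x, Cmod (f x) <= M.
Proof.
destruct (bounded_continuity (V := C_R_NormedModule) f (-1) 1) as [M hM].
{ intros; apply per_cont. }
exists M; intros x; destruct (period_reduce x) as [k hk].
replace x with ((x - 2 * IZR k) + 2 * IZR k) by ring.
rewrite per_shift, <- norm_C; apply Rlt_le, hM; lra.
Qed.

Lemma per_norm_lub (f : Per) :
  is_lub_Rbar (fun r => exists x : R, r = Cmod (f x)) (per_norm f).
Proof.
unfold per_norm.
destruct (per_bounded f) as [M hM].
pose proof (Lub_Rbar_correct (fun r => exists x : R, r = Cmod (f x))) as H.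
destruct (Lub_Rbar _) as [r | |]; [exact H | |]; exfalso; destruct H as [h1 h2].
- apply (h2 M); intros r [x ->]; apply hM.
- apply (h1 (Cmod (f 0))); now exists 0.
Qed.

Lemma per_norm_ub (f : Per) x : Cmod (f x) <= per_norm f.
Proof. apply (proj1 (per_norm_lub f) (Cmod (f x))); now exists x. Qed.

Lemma per_norm_le (f : Per) (M : R) :
  (forall x, Cmod (f x) <= M) -> per_norm f <= M.
Proof.
intros h; apply (proj2 (per_norm_lub f) M); intros r [x ->]; apply h.
Qed.

Lemma per_norm_plus (f g : Per) : per_norm (plus f g) <= per_norm f + per_norm g.
Proof.
apply per_norm_le; intros x; apply Rle_trans with (1 := Cmod_triangle _ _).
apply Rplus_le_compat; apply per_norm_ub.
Qed.

Lemma per_norm_scal (c : R) (f : Per) :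
  per_norm (scal c f) <= Rabs c * per_norm f.
Proof.
apply per_norm_le; intros x.
change (Cmod (@scal _ C_R_NormedModule c (f x)) <= Rabs c * per_norm f).
rewrite scal_C, Cmod_mult, Cmod_R.
apply Rmult_le_compat_l; [apply Rabs_pos | apply per_norm_ub].
Qed.

Lemma per_norm_eq0 (f : Per) : per_norm f = 0 -> f = zero.
Proof.
intros h; apply Per_ext; intros x; apply Cmod_eq_0.
apply Rle_antisym; [rewrite <- h; apply per_norm_ub | apply Cmod_ge_0].
Qed.

Lemma per_norm_zero : per_norm zero = 0.
Proof.
apply Rle_antisym.
- apply per_norm_le; intros x; change (Cmod 0 <= 0); rewrite Cmod_0; lra.
- apply Rle_trans with (2 := per_norm_ub zero 0); apply Cmod_ge_0.
Qed.

Lemma per_norm_minus_sym (f g : Per) : per_norm (minus f g) = per_norm (minus g f).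
Proof.
assert (H : forall f g : Per, per_norm (minus f g) <= per_norm (minus g f)).
{ clear; intros f g; apply per_norm_le; intros x.
  apply Rle_trans with (2 := per_norm_ub (minus g f) x).
  right; rewrite <- Cmod_opp; f_equal.
  change (- (f x - g x) = g x - f x)%C; ring. }
now apply Rle_antisym.
Qed.

Definition Per_UniformSpace_mixin : UniformSpace.mixin_of Per.
Proof.
apply (UniformSpace.Mixin Per Per_zero (fun f e g => per_norm (minus g f) < e)).
- intros f e; rewrite (minus_eq_zero f : minus f f = Per_zero).
  rewrite (per_norm_zero : per_norm Per_zero = 0); apply cond_pos.
- intros f g e h; now rewrite per_norm_minus_sym.
- intros f g h e1 e2 h1 h2.
  rewrite (minus_trans g).
  apply Rle_lt_trans with (1 := per_norm_plus _ _); lra.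
Defined.
Canonical Per_UniformSpace := UniformSpace.Pack Per Per_UniformSpace_mixin Per.

Canonical Per_NormedModuleAux := NormedModuleAux.Pack R_AbsRing Per
  (NormedModuleAux.Class R_AbsRing Per
     (ModuleSpace.class R_Ring Per_ModuleSpace)
     (UniformSpace.class Per_UniformSpace)) Per.

Definition Per_NormedModule_mixin :
  NormedModule.mixin_of R_AbsRing Per_NormedModuleAux.
Proof.
apply (NormedModule.Mixin R_AbsRing Per_NormedModuleAux per_norm 1).
- apply per_norm_plus.
- apply per_norm_scal.
- intros f g e h; exact h.
- intros f g e h; rewrite Rmult_1_l; exact h.
- apply per_norm_eq0.
Defined.
Canonical Per_NormedModule := NormedModule.Pack R_AbsRing Per
  (NormedModule.Class R_AbsRing Per
     (NormedModuleAux.class R_AbsRing Per_NormedModuleAux)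
     Per_NormedModule_mixin) Per.

(** A Cauchy filter converges uniformly to its pointwise limit. *)
Lemma Per_complete (F : (Per -> Prop) -> Prop) :
  ProperFilter F -> cauchy F ->
  exists l : Per, forall eps : posreal, F (ball l eps).
Proof.
intros PF cF.
set (ev := fun x : R => filtermap (fun f : Per => (f x : C)) F).
assert (PE : forall x, ProperFilter (ev x)).
{ intros x; now apply filtermap_proper_filter. }
set (l := fun x => lim (T := C_CompleteNormedModule) (ev x)).
assert (hev : forall x eps, 0 < eps ->
  F (fun f : Per => Cmod (f x - l x)%C < eps)).
{ intros x eps he.
  assert (cE : cauchy (T := C_CompleteNormedModule) (ev x)).
  { intros e; destruct (cF e) as [g hg]; exists (g x).
    unfold ev, filtermap; apply filter_imp with (2 := hg).
    intros f hf; apply (norm_compat1 (V := C_NormedModule)).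
    apply Rle_lt_trans with (2 := hf).
    apply (per_norm_ub (minus f g) x). }
  pose proof (@norm_factor_gt_0 _ C_NormedModule) as hn.
  assert (hd : 0 < eps / @norm_factor _ C_NormedModule).
  { now apply Rdiv_lt_0_compat. }
  pose proof (complete_cauchy (T := C_CompleteNormedModule) (ev x) (PE x) cE
    (mkposreal _ hd)) as H.
  unfold ev at 1, filtermap in H; apply filter_imp with (2 := H).
  intros f hf; apply (norm_compat2 (V := C_NormedModule)) in hf; simpl in hf.
  apply Rlt_le_trans with (1 := hf); right; field; lra. }
assert (hun : forall eps, 0 < eps -> exists g : Per,
  F (ball g eps) /\ forall x, Cmod (g x - l x)%C <= eps).
{ intros eps he; destruct (cF (mkposreal eps he)) as [g hg]; exists g.
  split; [exact hg |]; intros x.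
  apply le_epsilon; intros e hpos.
  destruct (filter_ex _ (filter_and _ _ hg (hev x e hpos))) as [f [h1 h2]].
  replace (g x - l x)%C with ((g x - f x) + (f x - l x))%C by ring.
  apply Rle_trans with (1 := Cmod_triangle _ _).
  apply Rplus_le_compat; [| now apply Rlt_le].
  apply Rle_trans with (1 := per_norm_ub (minus g f) x).
  rewrite per_norm_minus_sym; apply Rlt_le; exact h1. }
assert (hl : forall x, continuous l x).
{ intros x; apply continuous_R_Cmod; intros eps he.
  destruct (hun (eps / 3)) as [g [_ hg]]; [lra |].
  destruct (proj1 (continuous_R_Cmod g x) (per_cont g x) (eps / 3))
    as [d [hd H]]; [lra |].
  exists d; split; [exact hd |]; intros y hy.
  replace (l y - l x)%C with
    (- (g y - l y) + ((g y - g x) + (g x - l x)))%C by ring.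
  apply Rle_lt_trans with (1 := Cmod_triangle _ _).
  pose proof (Cmod_triangle (g y - g x) (g x - l x)).
  rewrite Cmod_opp.
  specialize (H y hy); pose proof (hg x); pose proof (hg y); lra. }
assert (hp : forall x, l (x + 2) = l x).
{ intros x; unfold l; f_equal; unfold ev.
  f_equal; apply functional_extensionality; intros f; apply per_period. }
exists (mkPer l hl hp); intros eps.
destruct (hun (eps / 3)) as [g [h1 h2]].
{ pose proof (cond_pos eps); lra. }
apply filter_imp with (2 := h1); intros f hf.
change (per_norm (minus f (mkPer l hl hp)) < eps).
change (per_norm (minus f g) < eps / 3) in hf.
rewrite (minus_trans g).
apply Rle_lt_trans with (1 := per_norm_plus _ _).
assert (per_norm (minus g (mkPer l hl hp)) <= eps / 3).
{ apply per_norm_le; exact h2. }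
pose proof (cond_pos eps); lra.
Qed.

Definition Per_lim (F : (Per -> Prop) -> Prop) : Per :=
  epsilon (inhabits Per_zero) (fun l => forall eps : posreal, F (ball l eps)).

Definition Per_CompleteSpace_mixin : CompleteSpace.mixin_of Per_UniformSpace.
Proof.
apply (CompleteSpace.Mixin Per_UniformSpace Per_lim).
- intros F PF cF; unfold Per_lim; apply epsilon_spec; now apply Per_complete.
- intros F1 F2 h12 h21.
  assert (F1 = F2).
  { apply functional_extensionality; intros P.
    apply propositional_extensionality; split; [apply h21 | apply h12]. }
  subst F2; intros eps; apply ball_center.
Defined.
Canonical Per_CompleteNormedModule := CompleteNormedModule.Pack R_AbsRing Per
  (CompleteNormedModule.Class R_AbsRing Per
     (NormedModule.class R_AbsRing Per_NormedModule)
     Per_CompleteSpace_mixin) Per.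

(** * The complex heat kernel *)

Notation CR := C_R_CompleteNormedModule.
Notation is_derive_C := (is_derive (V := C_R_NormedModule)).

Lemma is_derive_C_iff (f : R -> C) (x : R) (l : C) :
  is_derive_C f x l <->
  is_derive (fun t => fst (f t)) x (fst l) /\ is_derive (fun t => snd (f t)) x (snd l).
Proof.
split.
- intros h; split.
  + apply (is_derive_linear (U := CR) (V := R_CompleteNormedModule) fst f); [|easy].
    apply (is_linear_fst (U := R_NormedModule) (V := R_NormedModule)).
  + apply (is_derive_linear (U := CR) (V := R_CompleteNormedModule) snd f); [|easy].
    apply (is_linear_snd (U := R_NormedModule) (V := R_NormedModule)).
- intros [h1 h2]; apply (is_derive_norm_iff (V := CR)); intros eps he.
  destruct (proj1 (is_derive_norm_iff (V := R_CompleteNormedModule) _ _ _) h1 (eps / 2))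
    as [d1 [hd1 H1]]; [lra|].
  destruct (proj1 (is_derive_norm_iff (V := R_CompleteNormedModule) _ _ _) h2 (eps / 2))
    as [d2 [hd2 H2]]; [lra|].
  exists (Rmin d1 d2); split; [now apply Rmin_pos|].
  intros y hy; apply Rmin_Rgt in hy as [hy1 hy2].
  specialize (H1 y hy1); specialize (H2 y hy2).
  match goal with |- norm ?X <= _ => set (X0 := X) end.
  rewrite (norm_C X0 : norm X0 = _).
  assert (K : forall z : C, Cmod z <= Rabs (fst z) + Rabs (snd z)).
  { intros z; assert (E : z = (RtoC (fst z) + Ci * RtoC (snd z))%C).
    { destruct z; unfold RtoC, Ci, Cmult, Cplus; simpl; f_equal; ring. }
    rewrite E at 1; apply Rle_trans with (1 := Cmod_triangle _ _).
    rewrite Cmod_mult, !Cmod_R.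
    replace (Cmod Ci) with 1; [lra|].
    symmetry; unfold Cmod, Ci; simpl; transitivity (sqrt 1); [f_equal; ring | apply sqrt_1]. }
  apply Rle_trans with (1 := K X0).
  replace (eps * Rabs (y - x)) with (eps / 2 * Rabs (y - x) + eps / 2 * Rabs (y - x))
    by field.
  apply Rplus_le_compat; [exact H1 | exact H2].
Qed.

Lemma is_derive_Cmult (f g : R -> C) (x : R) (df dg : C) :
  is_derive_C f x df ->
  is_derive_C g x dg ->
  is_derive_C (fun t => f t * g t)%C x (df * g x + f x * dg)%C.
Proof.
intros hf hg.
destruct (locally_Cmod_bound f x) as [M [hM H]].
{ apply (is_derive_continuous (V := CR) f x df hf). }
apply (is_derive_family (U := CR) (V := CR) (fun t z => (f t * z)%C) g x M); auto.
- apply filter_imp with (2 := H); intros t ht; split; [apply Cmult_linear|].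
  intros z.
  change (@norm _ C_R_NormedModule (f t * z)%C <= M * @norm _ C_R_NormedModule z).
  rewrite !norm_C, Cmod_mult; apply Rmult_le_compat_r; [apply Cmod_ge_0 | easy].
- apply (is_derive_ext (fun t => (g x * f t)%C)); [intros; apply Cmult_comm|].
  rewrite (Cmult_comm df).
  apply (is_derive_linear (U := CR) (V := CR) (fun z => (g x * z)%C) f); [|easy].
  apply Cmult_linear.
- apply (continuous_Cmult f (fun _ => dg)); [|apply continuous_const].
  apply (is_derive_continuous (V := CR) f x df hf).
Qed.

Lemma is_derive_C_eq (f : R -> C) (x : R) (l l' : C) :
  is_derive_C f x l -> l = l' ->
  is_derive_C f x l'.
Proof. now intros h <-. Qed.

Definition cexp (z : C) : C := (exp (fst z) * cos (snd z), exp (fst z) * sin (snd z)).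

Lemma Cmod_cexp z : Cmod (cexp z) = exp (fst z).
Proof.
unfold Cmod, cexp; simpl.
replace (exp (fst z) * cos (snd z) * (exp (fst z) * cos (snd z) * 1) +
  exp (fst z) * sin (snd z) * (exp (fst z) * sin (snd z) * 1)) with
  (Rsqr (exp (fst z)) * (Rsqr (sin (snd z)) + Rsqr (cos (snd z))))
  by (unfold Rsqr; ring).
rewrite sin2_cos2, Rmult_1_r, sqrt_Rsqr; [easy | apply Rlt_le, exp_pos].
Qed.

Lemma cexp_plus z w : cexp (z + w) = (cexp z * cexp w)%C.
Proof.
unfold cexp, Cmult; simpl; rewrite exp_plus, cos_plus, sin_plus; f_equal; ring.
Qed.

Lemma cexp_0 : cexp 0 = 1%C.
Proof. unfold cexp; simpl; rewrite exp_0, cos_0, sin_0; unfold RtoC; f_equal; ring. Qed.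

Lemma is_derive_cexp (f : R -> C) (x : R) (d : C) :
  is_derive_C f x d ->
  is_derive_C (fun t => cexp (f t)) x (d * cexp (f x))%C.
Proof.
intros h; apply is_derive_C_iff in h as [h1 h2]; apply is_derive_C_iff.
assert (K : forall (u v : R -> R) du dv, is_derive u x du -> is_derive v x dv ->
  is_derive (fun t => exp (u t) * cos (v t)) x
    (du * (exp (u x) * cos (v x)) - dv * (exp (u x) * sin (v x))) /\
  is_derive (fun t => exp (u t) * sin (v t)) x
    (du * (exp (u x) * sin (v x)) + dv * (exp (u x) * cos (v x)))).
{ intros u v du dv hu hv; split; auto_derive;
    try (repeat split; [now exists du | now exists dv]);
    replace (Derive (fun x => u x) x) with du
      by (symmetry; now apply is_derive_unique);
    replace (Derive (fun x => v x) x) with dv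
      by (symmetry; now apply is_derive_unique); ring. }
exact (K _ _ _ _ h1 h2).
Qed.

(** The principal logarithm on the right half plane. *)
Definition clog (z : C) : C := (ln (fst z ^ 2 + snd z ^ 2) / 2, atan (snd z / fst z)).

Lemma norm2_pos (z : C) : 0 < fst z -> 0 < fst z ^ 2 + snd z ^ 2.
Proof. intros h; nra. Qed.

Lemma is_derive_segment (z h : C) (t : R) :
  is_derive_C (fun t => z + RtoC t * h)%C t h.
Proof.
apply is_derive_C_iff; destruct z, h; simpl; split; auto_derive; try easy; ring.
Qed.

Lemma is_derive_clog (z h : C) (t : R) :
  0 < fst (z + RtoC t * h)%C ->
  is_derive_C (fun t => clog (z + RtoC t * h)) t
    (h * / (z + RtoC t * h))%C.
Proof.
intros hz; pose proof (norm2_pos _ hz) as hn.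
apply is_derive_C_iff; destruct z as [a b], h as [u v]; simpl in *; split; auto_derive.
- nra.
- field; nra.
- repeat split; nra.
- field. repeat split; nra.
Qed.

Lemma is_derive_Cinv_segment (z h : C) (t : R) :
  0 < fst (z + RtoC t * h)%C ->
  is_derive_C (fun t => / (z + RtoC t * h))%C t
    (- (h * (/ (z + RtoC t * h) * / (z + RtoC t * h))))%C.
Proof.
intros hz; pose proof (norm2_pos _ hz) as hn.
apply is_derive_C_iff; destruct z as [a b], h as [u v]; simpl in *; split; auto_derive.
- repeat split; nra.
- field; nra.
- repeat split; nra.
- field; nra.
Qed.

Lemma is_derive_RtoC (f : R -> R) (x l : R) :
  is_derive f x l -> is_derive_C (fun t => RtoC (f t)) x (RtoC l).
Proof.
intros h; apply is_derive_C_iff; split; [exact h|].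
exact (is_derive_const (V := R_NormedModule) 0 x).
Qed.

Lemma is_derive_Cplus (f g : R -> C) (x : R) (df dg : C) :
  is_derive_C f x df ->
  is_derive_C g x dg ->
  is_derive_C (fun t => f t + g t)%C x (df + dg)%C.
Proof. apply (is_derive_plus (V := C_R_NormedModule)). Qed.

Lemma is_derive_Cminus (f g : R -> C) (x : R) (df dg : C) :
  is_derive_C f x df ->
  is_derive_C g x dg ->
  is_derive_C (fun t => f t - g t)%C x (df - dg)%C.
Proof. apply (is_derive_minus (V := C_R_NormedModule)). Qed.

Lemma is_derive_Cscal (c : C) (f : R -> C) (x : R) (l : C) :
  is_derive_C f x l ->
  is_derive_C (fun t => c * f t)%C x (c * l)%C.
Proof.
apply (is_derive_linear (U := CR) (V := CR) (fun z => (c * z)%C) f).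
apply Cmult_linear.
Qed.

Lemma continuous_C_derive (f : R -> C) (x : R) (l : C) :
  is_derive_C f x l -> continuous f x.
Proof. apply (is_derive_continuous (V := CR)). Qed.

Lemma RtoC_m1 : RtoC (-1) = (- (1))%C.
Proof. unfold RtoC, Copp; simpl; f_equal; ring. Qed.

(** The factor [z^(-1/2)] of the kernel is written as an exponential, so that every
    derivative of the kernel is the kernel times a polynomial in [s] and [/ z]. *)
Definition heat_exponent (mu : R) (z : C) (s : R) : C :=
  (RtoC (- / 2) * clog z + RtoC (- (s ^ 2 / 4)) * / z + RtoC (- mu) * z)%C.

Definition heat (mu : R) (z : C) (s : R) : C := cexp (heat_exponent mu z s).

(** The logarithmic derivatives of the kernel in [z] (first and second order of
    the exponent) and in [s]. *)
Definition heat_rate (mu : R) (z : C) (s : R) : C :=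
  (RtoC (- / 2) * / z + RtoC (s ^ 2 / 4) * (/ z * / z) + RtoC (- mu))%C.

Definition heat_rate2 (z : C) (s : R) : C :=
  (RtoC (/ 2) * (/ z * / z) + RtoC (- (s ^ 2 / 2)) * (/ z * (/ z * / z)))%C.

Definition heat_slope (z : C) (s : R) : C := (RtoC (- (s / 2)) * / z)%C.

Lemma heat_derive_z mu z h s t : 0 < fst (z + RtoC t * h)%C ->
  is_derive_C (fun t => heat mu (z + RtoC t * h) s) t
    (h * heat_rate mu (z + RtoC t * h) s * heat mu (z + RtoC t * h) s)%C.
Proof.
intros hz; apply is_derive_cexp; unfold heat_exponent.
eapply is_derive_C_eq.
- apply is_derive_Cplus; [apply is_derive_Cplus|]; apply is_derive_Cscal.
  + now apply is_derive_clog.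
  + now apply is_derive_Cinv_segment.
  + apply is_derive_segment.
- unfold heat_rate; rewrite !RtoC_opp; ring.
Qed.

Lemma heat_derive_z2 mu z h s t : 0 < fst (z + RtoC t * h)%C ->
  is_derive_C
    (fun t => h * heat_rate mu (z + RtoC t * h) s * heat mu (z + RtoC t * h) s)%C t
    (h * h * ((heat_rate2 (z + RtoC t * h) s +
       heat_rate mu (z + RtoC t * h) s * heat_rate mu (z + RtoC t * h) s) *
       heat mu (z + RtoC t * h) s))%C.
Proof.
intros hz; eapply is_derive_C_eq.
- apply is_derive_Cmult; [apply is_derive_Cscal|now apply heat_derive_z].
  unfold heat_rate; apply is_derive_Cplus; [|apply (is_derive_const (V := C_R_NormedModule))].
  apply is_derive_Cplus; apply is_derive_Cscal.
  + now apply is_derive_Cinv_segment.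
  + apply is_derive_Cmult; now apply is_derive_Cinv_segment.
- change (@zero (NormedModule.AbelianMonoid R_AbsRing C_R_NormedModule)) with (RtoC 0).
  unfold heat_rate2.
  replace (RtoC (- (s ^ 2 / 2))) with (- (RtoC (s ^ 2 / 4) + RtoC (s ^ 2 / 4)))%C
    by (rewrite <- RtoC_plus, <- RtoC_opp; f_equal; field).
  rewrite !(RtoC_opp (/ 2)).
  set (H := heat mu (z + RtoC t * h) s); set (D := heat_rate mu (z + RtoC t * h) s).
  ring.
Qed.

Lemma heat_derive_s mu z s :
  is_derive_C (heat mu z) s (heat_slope z s * heat mu z s)%C.
Proof.
apply is_derive_cexp; unfold heat_exponent.
eapply is_derive_C_eq.
- apply is_derive_Cplus; [apply is_derive_Cplus|].
  + apply (is_derive_const (V := C_R_NormedModule)).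
  + apply is_derive_Cmult; [|apply (is_derive_const (V := C_R_NormedModule))].
    apply (is_derive_RtoC (fun s => - (s ^ 2 / 4)) s (- (s / 2))).
    auto_derive; [easy | field].
  + apply (is_derive_const (V := C_R_NormedModule)).
- change (@zero (NormedModule.AbelianMonoid R_AbsRing C_R_NormedModule)) with (RtoC 0).
  unfold heat_slope; ring.
Qed.

(** Together with [heat_derive_z], this is the heat equation. *)
Lemma heat_derive_s2 mu z s :
  is_derive_C (fun s => heat_slope z s * heat mu z s)%C s
    ((heat_rate mu z s + RtoC mu) * heat mu z s)%C.
Proof.
eapply is_derive_C_eq.
- apply is_derive_Cmult; [|apply heat_derive_s].
  unfold heat_slope; apply is_derive_Cmult;
    [|apply (is_derive_const (V := C_R_NormedModule))].
  apply (is_derive_RtoC (fun s => - (s / 2)) s (- / 2)).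
  auto_derive; [easy | field].
- change (@zero (NormedModule.AbelianMonoid R_AbsRing C_R_NormedModule)) with (RtoC 0).
  unfold heat_rate, heat_slope.
  replace (RtoC (s ^ 2 / 4)) with (RtoC (- (s / 2)) * RtoC (- (s / 2)))%C
    by (rewrite <- RtoC_mult; f_equal; field).
  rewrite (RtoC_opp mu); ring.
Qed.

Lemma continuous_RtoC (f : R -> R) (x : R) :
  continuous f x -> continuous (fun t => RtoC (f t)) x.
Proof.
intros h; apply continuous_R_Cmod; intros eps he.
destruct (proj1 (continuous_norm_iff (V := R_CompleteNormedModule) f x) h eps he)
  as [d [hd H]].
exists d; split; [easy|]; intros y hy.
rewrite <- RtoC_minus, Cmod_R; exact (H y hy).
Qed.

Lemma heat_rate_cont mu z s : continuous (heat_rate mu z) s.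
Proof.
unfold heat_rate.
assert (h : forall c : C, continuous (fun s => RtoC (s ^ 2 / 4) * c)%C s).
{ intros c; eapply continuous_C_derive, is_derive_Cmult;
    [|apply (is_derive_const (V := C_R_NormedModule))].
  apply (is_derive_RtoC (fun s => s ^ 2 / 4) s (s / 2)); auto_derive; [easy | field]. }
apply (continuous_plus (V := C_R_NormedModule)); [|apply continuous_const].
apply (continuous_plus (V := C_R_NormedModule)); [apply continuous_const | apply h].
Qed.

Lemma heat_cont mu z s : continuous (heat mu z) s.
Proof. eapply continuous_C_derive, heat_derive_s. Qed.

Lemma heat_even mu z s : heat mu z (- s) = heat mu z s.
Proof.
unfold heat, heat_exponent; replace ((- s) ^ 2) with (s ^ 2) by ring; easy.
Qed.

Lemma heat_mu mu z s : heat mu z s = (cexp (RtoC (- mu) * z) * heat 0 z s)%C.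
Proof.
unfold heat; rewrite <- cexp_plus; f_equal; unfold heat_exponent.
rewrite Ropp_0; ring.
Qed.

Lemma Cmod_heat mu z s : 0 < fst z ->
  Cmod (heat mu z s) =
  exp (- / 4 * ln (fst z ^ 2 + snd z ^ 2)
       - s ^ 2 / 4 * (fst z / (fst z ^ 2 + snd z ^ 2)) - mu * fst z).
Proof.
intros hz; unfold heat; rewrite Cmod_cexp; f_equal.
unfold heat_exponent, clog; simpl. pose proof (norm2_pos z hz); simpl in *.
field; lra.
Qed.

Lemma Cmod_sqr (z : C) : Cmod z ^ 2 = fst z ^ 2 + snd z ^ 2.
Proof.
unfold Cmod; rewrite pow2_sqrt; [easy|].
apply Rplus_le_le_0_compat; apply pow2_ge_0.
Qed.

(** Completing the square. *)
Lemma gauss_decay (b c : R) : 0 < b ->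
  exists M, 0 < M /\ forall s,
    (1 + s ^ 2) ^ 2 * exp (- b * s ^ 2) <= M * exp (- c * Rabs s).
Proof.
intros hb; set (K := Rmax 1 (4 / b)).
assert (hK : 1 <= K) by apply Rmax_l.
assert (hK4 : 4 / b <= K) by apply Rmax_r.
assert (hKb : 4 <= K * b).
{ apply Rmult_le_compat_r with (r := b) in hK4; [|lra].
  replace (4 / b * b) with 4 in hK4 by (field; lra). exact hK4. }
exists (K ^ 2 * exp (c ^ 2 / (2 * b))); split.
{ apply Rmult_lt_0_compat; [apply pow_lt; lra | apply exp_pos]. }
intros s; set (e := exp (b / 4 * s ^ 2)).
assert (h1 : 1 + s ^ 2 <= K * e).
{ pose proof (exp_ineq1_le (b / 4 * s ^ 2)) as h; fold e in h.
  pose proof (pow2_ge_0 s). nra. }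
assert (h2 : (1 + s ^ 2) ^ 2 <= K ^ 2 * exp (b / 2 * s ^ 2)).
{ replace (b / 2 * s ^ 2) with (b / 4 * s ^ 2 + b / 4 * s ^ 2) by field.
  rewrite exp_plus; fold e; pose proof (pow2_ge_0 s). nra. }
apply Rle_trans with (K ^ 2 * exp (b / 2 * s ^ 2) * exp (- b * s ^ 2)).
{ apply Rmult_le_compat_r; [apply Rlt_le, exp_pos | easy]. }
rewrite !Rmult_assoc, <- !exp_plus.
apply Rmult_le_compat_l; [apply pow2_ge_0|].
apply exp_monotone.
assert (E : Rabs s ^ 2 = s ^ 2) by apply pow2_abs.
rewrite <- E. set (u := Rabs s).
assert (0 <= b / 2 * (u - c / b) ^ 2).
{ apply Rmult_le_pos; [lra | apply pow2_ge_0]. }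
replace (c ^ 2 / (2 * b) + - c * u) with
  (b / 2 * u ^ 2 + - b * u ^ 2 + (b / 2 * (u - c / b) ^ 2)) by (field; lra).
lra.
Qed.

Lemma heat_gauss_bound mu a0 rad z s :
  0 <= mu -> 0 < a0 -> a0 <= fst z -> Cmod z <= rad ->
  Cmod (heat mu z s) <= exp (- / 4 * ln (a0 ^ 2)) * exp (- (a0 / (4 * rad ^ 2)) * s ^ 2).
Proof.
intros hmu ha hz hr; rewrite Cmod_heat by lra; rewrite <- exp_plus.
apply exp_monotone.
pose proof (norm2_pos z ltac:(lra)) as hn.
assert (h1 : a0 ^ 2 <= fst z ^ 2 + snd z ^ 2) by nra.
assert (h2 : ln (a0 ^ 2) <= ln (fst z ^ 2 + snd z ^ 2)).
{ apply ln_le; [nra | easy]. }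
assert (h3 : fst z ^ 2 + snd z ^ 2 <= rad ^ 2).
{ rewrite <- Cmod_sqr; apply pow_incr; split; [apply Cmod_ge_0 | easy]. }
assert (h4 : a0 / rad ^ 2 <= fst z / (fst z ^ 2 + snd z ^ 2)).
{ apply Rmult_le_compat; try lra.
  - apply Rlt_le, Rinv_0_lt_compat; lra.
  - apply Rinv_le_contravar; lra. }
assert (h5 : 0 <= s ^ 2 / 4) by (pose proof (pow2_ge_0 s); lra).
assert (h6 : 0 <= mu * fst z) by (apply Rmult_le_pos; lra).
replace (- (a0 / (4 * rad ^ 2)) * s ^ 2) with (- (s ^ 2 / 4 * (a0 / rad ^ 2)))
  by (field; intros E; rewrite E in h3; lra).
pose proof (Rmult_le_compat_l _ _ _ h5 h4). lra.
Qed.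

Lemma Cmod_Cinv_le (z : C) a0 : 0 < a0 -> a0 <= fst z -> Cmod (/ z) <= / a0.
Proof.
intros ha hz.
assert (hm : a0 <= Cmod z).
{ apply Rle_trans with (Rabs (fst z)); [rewrite Rabs_right; lra|].
  apply Rle_trans with (2 := Rmax_Cmod z); apply Rmax_l. }
rewrite Cmod_inv.
- apply Rinv_le_contravar; lra.
- intros E; rewrite E, Cmod_0 in hm; lra.
Qed.

Lemma heat_rate_bound mu a0 z s : 0 <= mu -> 0 < a0 -> a0 <= fst z ->
  Cmod (heat_rate mu z s) <= (/ a0 + (/ a0) ^ 2 + mu) * (1 + s ^ 2) ^ 1.
Proof.
intros hmu ha hz; pose proof (Cmod_Cinv_le z a0 ha hz) as hi.
pose proof (Cmod_ge_0 (/ z)) as hi0; pose proof (pow2_ge_0 s) as hs.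
assert (hp : 0 < / a0) by now apply Rinv_0_lt_compat.
unfold heat_rate; eapply Rle_trans; [apply Cmod_triangle|].
eapply Rle_trans; [apply Rplus_le_compat_r, Cmod_triangle|].
rewrite !Cmod_mult, !Cmod_R.
rewrite Rabs_left by lra; rewrite Rabs_right by lra.
rewrite Rabs_Ropp, (Rabs_right mu) by lra.
assert (Cmod (/ z) * Cmod (/ z) <= (/ a0) ^ 2).
{ simpl; rewrite Rmult_1_r; now apply Rmult_le_compat. }
assert (0 <= Cmod (/ z) * Cmod (/ z)) by now apply Rmult_le_pos.
assert (s ^ 2 / 4 * (Cmod (/ z) * Cmod (/ z)) <= s ^ 2 / 4 * (/ a0) ^ 2)
  by (apply Rmult_le_compat_l; lra).
assert (0 <= s ^ 2 * / a0) by (apply Rmult_le_pos; lra).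
assert (0 <= s ^ 2 * (/ a0) ^ 2) by (apply Rmult_le_pos; [lra | apply pow2_ge_0]).
assert (0 <= s ^ 2 * mu) by (apply Rmult_le_pos; lra).
pose proof (pow2_ge_0 (/ a0)). lra.
Qed.

Lemma heat_rate2_bound a0 z s : 0 < a0 -> a0 <= fst z ->
  Cmod (heat_rate2 z s) <= ((/ a0) ^ 2 + (/ a0) ^ 3) * (1 + s ^ 2).
Proof.
intros ha hz; pose proof (Cmod_Cinv_le z a0 ha hz) as hi.
pose proof (Cmod_ge_0 (/ z)) as hi0; pose proof (pow2_ge_0 s) as hs.
assert (hp : 0 < / a0) by now apply Rinv_0_lt_compat.
unfold heat_rate2; eapply Rle_trans; [apply Cmod_triangle|].
rewrite !Cmod_mult, !Cmod_R, Rabs_Ropp, !Rabs_right by lra.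
set (i := Cmod (/ z)) in *; set (j := / a0) in *.
assert (h2 : i * i <= j ^ 2) by (simpl; rewrite Rmult_1_r; now apply Rmult_le_compat).
assert (h0 : 0 <= i * i) by now apply Rmult_le_pos.
assert (h3 : i * (i * i) <= j ^ 3).
{ replace (j ^ 3) with (j * j ^ 2) by ring; now apply Rmult_le_compat. }
assert (s ^ 2 / 2 * (i * (i * i)) <= s ^ 2 / 2 * j ^ 3)
  by (apply Rmult_le_compat_l; lra).
assert (hj : 0 < j ^ 3) by now apply pow_lt.
assert (hj2 : 0 < j ^ 2) by now apply pow_lt.
assert (0 <= s ^ 2 * j ^ 2) by (apply Rmult_le_pos; lra).
assert (0 <= s ^ 2 * j ^ 3) by (apply Rmult_le_pos; lra).
lra.
Qed.

Lemma heat_slope_bound a0 z s : 0 < a0 -> a0 <= fst z ->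
  Cmod (heat_slope z s) <= / a0 * (1 + s ^ 2).
Proof.
intros ha hz; pose proof (Cmod_Cinv_le z a0 ha hz) as hi.
unfold heat_slope; rewrite Cmod_mult, Cmod_R, Rabs_Ropp, Rmult_comm.
apply Rmult_le_compat; [apply Cmod_ge_0 | apply Rabs_pos | easy|].
unfold Rdiv; rewrite Rabs_mult, (Rabs_right (/ 2)) by lra.
rewrite <- pow2_abs; pose proof (pow2_ge_0 (Rabs s - 1)); nra.
Qed.

(** The Gaussian absorbs the polynomial factor [w] as well as any exponential growth of
    the group. *)
Lemma heat_decay mu a0 rad c B : 0 <= mu -> 0 < a0 -> 0 < rad -> 0 <= B ->
  exists M, 0 < M /\ forall z s (w : C), a0 <= fst z -> Cmod z <= rad ->
    Cmod w <= B * (1 + s ^ 2) ^ 2 ->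
    Cmod (w * heat mu z s) <= M * exp (- c * Rabs s).
Proof.
intros hmu ha hr hB.
assert (hb : 0 < a0 / (4 * rad ^ 2)).
{ apply Rdiv_lt_0_compat; [easy|]; pose proof (pow_lt rad 2 hr); lra. }
destruct (gauss_decay _ c hb) as [M [hM H]].
set (A := exp (- / 4 * ln (a0 ^ 2))).
assert (hA : 0 < A) by apply exp_pos.
exists ((B + 1) * A * M); split; [repeat apply Rmult_lt_0_compat; lra|].
intros z s w hz hzr hw; rewrite Cmod_mult.
pose proof (heat_gauss_bound mu a0 rad z s hmu ha hz hzr) as hg; fold A in hg.
set (g := exp (- (a0 / (4 * rad ^ 2)) * s ^ 2)) in *.
assert (hp : 0 <= (1 + s ^ 2) ^ 2) by apply pow2_ge_0.
apply Rle_trans with (B * (1 + s ^ 2) ^ 2 * (A * g)).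
{ apply Rmult_le_compat; try easy; apply Cmod_ge_0. }
replace (B * (1 + s ^ 2) ^ 2 * (A * g)) with (B * A * ((1 + s ^ 2) ^ 2 * g)) by ring.
apply Rle_trans with (B * A * (M * exp (- c * Rabs s))).
{ apply Rmult_le_compat_l; [apply Rmult_le_pos; lra | apply H]. }
assert (0 <= A * (M * exp (- c * Rabs s))).
{ repeat apply Rmult_le_pos; try lra; apply Rlt_le, exp_pos. }
lra.
Qed.

Lemma mean_value_ineq (V : CompleteNormedModule R_AbsRing) (f df : R -> V) (a b K : R) :
  a <= b ->
  (forall x, a <= x <= b -> is_derive f x (df x)) ->
  (forall x, a <= x <= b -> continuous df x) ->
  (forall x, a <= x <= b -> norm (df x) <= K) ->
  norm (minus (f b) (f a)) <= (b - a) * K.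
Proof.
intros hab h1 h2 h3.
apply (norm_RInt_le_const df a b); [easy | exact h3|].
apply is_RInt_derive; rewrite Rmin_left, Rmax_right by easy; easy.
Qed.

Lemma taylor_C (f f1 f2 : R -> C) (K : R) :
  (forall x, 0 <= x <= 1 -> is_derive_C f x (f1 x)) ->
  (forall x, 0 <= x <= 1 -> is_derive_C f1 x (f2 x)) ->
  (forall x, 0 <= x <= 1 -> continuous f2 x) ->
  (forall x, 0 <= x <= 1 -> Cmod (f2 x) <= K) ->
  Cmod (f 1 - f 0 - f1 0)%C <= K.
Proof.
intros d1 d2 c hK.
assert (hK0 : 0 <= K) by (apply Rle_trans with (2 := hK 0 ltac:(lra)), Cmod_ge_0).
assert (h1 : forall x, 0 <= x <= 1 -> Cmod (f1 x - f1 0)%C <= K).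
{ intros x hx; rewrite <- norm_C.
  apply Rle_trans with ((x - 0) * K); [|nra].
  apply (mean_value_ineq CR f1 f2 0 x K); try lra; intros y hy;
    [apply d2 | apply c | apply Rle_trans with (1 := Req_le _ _ (norm_C (f2 y))), hK]; lra. }
replace (f 1 - f 0 - f1 0)%C with
  ((f 1 - RtoC 1 * f1 0) - (f 0 - RtoC 0 * f1 0))%C by ring.
rewrite <- norm_C.
replace K with ((1 - 0) * K) by ring.
apply (mean_value_ineq CR (fun x => f x - RtoC x * f1 0)%C (fun x => f1 x - f1 0)%C);
  try lra.
- intros x hx.
  apply (is_derive_C_eq _ _ (f1 x - (RtoC 1 * f1 0 + RtoC x * 0))%C); [|ring].
  apply is_derive_Cminus; [now apply d1|].
  apply (is_derive_Cmult (fun t => RtoC t) (fun _ => f1 0)); [|apply (is_derive_const (V := C_R_NormedModule))].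
  apply is_derive_RtoC; auto_derive; easy.
- intros x hx; apply (continuous_minus (V := C_R_NormedModule)); [|apply continuous_const].
  eapply continuous_C_derive; now apply d2.
- intros x hx; apply Rle_trans with (1 := Req_le _ _ (norm_C (f1 x - f1 0)%C)); now apply h1.
Qed.

Lemma Re_segment (z h : C) t a0 : 0 <= t <= 1 -> a0 <= fst z -> a0 <= fst (z + h)%C ->
  a0 <= fst (z + RtoC t * h)%C.
Proof. destruct z as [a b], h as [u v]; simpl; intros; nra. Qed.

Lemma Cmod_segment (z h : C) t rad : 0 <= t <= 1 -> Cmod z <= rad -> Cmod (z + h)%C <= rad ->
  Cmod (z + RtoC t * h)%C <= rad.
Proof.
intros ht h1 h2.
replace (z + RtoC t * h)%C with (RtoC (1 - t) * z + RtoC t * (z + h))%C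
  by (rewrite RtoC_minus; ring).
apply Rle_trans with (1 := Cmod_triangle _ _).
rewrite !Cmod_mult, !Cmod_R, !Rabs_right by lra. nra.
Qed.

(** Taylor's formula along the segment from [z] to [z + h]. The decay of the remainder
    in [s] is what turns this into differentiability in operator norm. *)
Lemma heat_taylor mu a0 rad c : 0 <= mu -> 0 < a0 -> 0 < rad ->
  exists M, 0 < M /\ forall z h s,
    a0 <= fst z -> a0 <= fst (z + h)%C -> Cmod z <= rad -> Cmod (z + h)%C <= rad ->
    Cmod (heat mu (z + h) s - heat mu z s - h * (heat_rate mu z s * heat mu z s))%C
      <= Cmod h ^ 2 * (M * exp (- c * Rabs s)).
Proof.
intros hmu ha hr.
set (B1 := / a0 + (/ a0) ^ 2 + mu). set (B2 := (/ a0) ^ 2 + (/ a0) ^ 3).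
assert (hp : 0 < / a0) by now apply Rinv_0_lt_compat.
assert (hB1 : 0 <= B1).
{ unfold B1; pose proof (pow2_ge_0 (/ a0)); lra. }
assert (hB2 : 0 <= B2).
{ unfold B2; pose proof (pow_lt (/ a0) 2 hp); pose proof (pow_lt (/ a0) 3 hp); lra. }
destruct (heat_decay mu a0 rad c (B2 + B1 ^ 2) hmu ha hr) as [M [hM H]].
{ pose proof (pow2_ge_0 B1); lra. }
exists M; split; [easy|]; intros z h s h1 h2 h3 h4.
set (zt := fun t => (z + RtoC t * h)%C).
pose proof (taylor_C (fun t => heat mu (zt t) s)
  (fun t => h * heat_rate mu (zt t) s * heat mu (zt t) s)%C
  (fun t => h * h * ((heat_rate2 (zt t) s + heat_rate mu (zt t) s * heat_rate mu (zt t) s) *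
       heat mu (zt t) s))%C (Cmod h ^ 2 * (M * exp (- c * Rabs s)))) as T.
cbn beta in T.
assert (E1 : zt 1 = (z + h)%C) by (unfold zt; ring).
assert (E0 : zt 0 = z) by (unfold zt; ring).
rewrite E1, E0 in T.
replace (h * (heat_rate mu z s * heat mu z s))%C with
  (h * heat_rate mu z s * heat mu z s)%C by ring.
assert (hre : forall t, 0 <= t <= 1 -> a0 <= fst (zt t))
  by (intros; now apply Re_segment).
assert (hcm : forall t, 0 <= t <= 1 -> Cmod (zt t) <= rad)
  by (intros; now apply Cmod_segment).
apply T; clear T E1 E0; intros t ht; specialize (hre t ht); specialize (hcm t ht).
- apply heat_derive_z; unfold zt in hre; lra.
- apply heat_derive_z2; unfold zt in hre; lra.
- assert (ci : continuous (fun t => / zt t)%C t).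
  { eapply continuous_C_derive, is_derive_Cinv_segment; unfold zt in hre; lra. }
  assert (ch : continuous (fun t => heat mu (zt t) s) t).
  { eapply continuous_C_derive, heat_derive_z; unfold zt in hre; lra. }
  assert (cc : forall c, continuous (fun _ : R => (c : C)) t)
    by (intros; apply continuous_const).
  assert (cp : forall f g : R -> C, continuous f t -> continuous g t ->
    continuous (fun x => f x + g x)%C t)
    by (intros; now apply (continuous_plus (V := C_R_NormedModule))).
  unfold heat_rate2, heat_rate.
  repeat lazymatch goal with
    | |- continuous (fun _ => ?c) _ => exact (cc c)
    | |- continuous (fun x => Cmult (@?f x) (@?g x)) _ => apply (continuous_Cmult f g)
    | |- continuous (fun x => Cplus (@?f x) (@?g x)) _ => apply (cp f g)
    | |- continuous (fun x => Cinv _) _ => exact ci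
    | |- continuous (fun x => heat _ _ _) _ => exact ch
    end.
- rewrite Cmod_mult; replace (Cmod (h * h)) with (Cmod h ^ 2)
    by (rewrite Cmod_mult; ring).
  apply Rmult_le_compat_l; [apply pow2_ge_0|].
  apply H; try easy.
  apply Rle_trans with (1 := Cmod_triangle _ _); rewrite Cmod_mult.
  pose proof (heat_rate_bound mu a0 (zt t) s hmu ha hre) as k1.
  pose proof (heat_rate2_bound a0 (zt t) s ha hre) as k2.
  fold B1 in k1; fold B2 in k2; rewrite pow_1 in k1.
  assert (k3 : Cmod (heat_rate mu (zt t) s) * Cmod (heat_rate mu (zt t) s) <=
    B1 * (1 + s ^ 2) * (B1 * (1 + s ^ 2)))
    by (apply Rmult_le_compat; try easy; apply Cmod_ge_0).
  pose proof (pow2_ge_0 s) as hs.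
  assert (k4 : B2 * (1 + s ^ 2) <= B2 * (1 + s ^ 2) ^ 2)
    by (apply Rmult_le_compat_l; [easy|]; nra).
  replace ((B2 + B1 ^ 2) * (1 + s ^ 2) ^ 2) with
    (B2 * (1 + s ^ 2) ^ 2 + B1 * (1 + s ^ 2) * (B1 * (1 + s ^ 2))) by ring.
  lra.
Qed.

(** In the cone [|z|] is at most [2 Re z], so that the real part of [/ z] is at least
    [/ (2 |z|)]. *)
Lemma heat_cone_bound z s : 0 < fst z -> Rabs (snd z) <= fst z ->
  Cmod (heat 0 z s) <= / sqrt (Cmod z) * exp (- (s ^ 2 / (8 * Cmod z))).
Proof.
intros ha hb; set (r := Cmod z).
pose proof (norm2_pos z ha) as hn; pose proof (Cmod_sqr z) as hr; fold r in hr.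
assert (hr0 : 0 < r).
{ pose proof (Cmod_ge_0 z); fold r in H; nra. }
assert (hb2 : snd z ^ 2 <= fst z ^ 2).
{ rewrite <- (pow2_abs (snd z)); apply pow_incr; split; [apply Rabs_pos | easy]. }
assert (hra : r <= 2 * fst z) by nra.
rewrite Cmod_heat, <- hr by easy.
replace (/ sqrt r) with (exp (- / 4 * ln (r ^ 2))).
- rewrite <- exp_plus; apply exp_monotone.
  assert (h : / (2 * r) <= fst z / r ^ 2).
  { apply Rmult_le_reg_r with (2 * r ^ 2); [pose proof (pow_lt r 2 hr0); lra|].
    replace (/ (2 * r) * (2 * r ^ 2)) with r by (field; lra).
    replace (fst z / r ^ 2 * (2 * r ^ 2)) with (2 * fst z) by (field; lra). lra. }
  assert (h5 : 0 <= s ^ 2 / 4) by (pose proof (pow2_ge_0 s); lra).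
  pose proof (Rmult_le_compat_l _ _ _ h5 h) as h6.
  replace (s ^ 2 / (8 * r)) with (s ^ 2 / 4 * / (2 * r)) by (field; lra). lra.
- assert (hs : 0 < sqrt r) by now apply sqrt_lt_R0.
  replace (r ^ 2) with (sqrt r ^ 4).
  + rewrite ln_pow by easy. rewrite <- (exp_ln (/ sqrt r)) by now apply Rinv_0_lt_compat.
    rewrite ln_Rinv by easy; f_equal; simpl; field.
  + rewrite <- (sqrt_sqrt r) at 2 by lra; ring.
Qed.

(** * The Gaussian functional calculus of a group *)

(** What the calculus uses of a group [W] with generator [B]: [wg_int] and [wg_orbit]
    say that [B] is the generator, and [cs] is the multiplication by complex scalars
    on the real space [V]. *)
Record wave_group {V : CompleteNormedModule R_AbsRing} (cs : C -> V -> V)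
  (W : R -> V -> V) (B : V -> V -> Prop) (K a : R) : Prop := {
  wg_cs_linear : forall c, is_linear (cs c);
  wg_cs_linear_l : forall x, is_linear (U := CR) (fun c => cs c x);
  wg_cs_norm : forall c x, norm (cs c x) <= Cmod c * norm x;
  wg_cs_mul : forall c d x, cs c (cs d x) = cs (c * d)%C x;
  wg_cs_real : forall r x, cs (RtoC r) x = scal r x;
  wg_K : 0 < K;
  wg_a : 0 < a;
  wg_linear : forall t, is_linear (W t);
  wg_norm : forall t x, norm (W t x) <= K * exp (a * Rabs t) * norm x;
  wg_cont : forall x t, continuous (fun t => W t x) t;
  wg_cs : forall c t x, W t (cs c x) = cs c (W t x);
  wg_0 : forall x, W 0 x = x;
  wg_int : forall x t, B (RInt (fun s => W s x) 0 t) (minus (W t x) x);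
  wg_orbit : forall x y t, B x y -> W t x = plus x (RInt (fun s => W s y) 0 t);
  wg_gen_cs : forall c x y, B x y -> B (cs c x) (cs c y);
  wg_gen_line_int : forall c M f M' g, 0 < c ->
    exp_decay c M f -> exp_decay c M' g -> (forall s, B (f s) (g s)) ->
    B (line_int f) (line_int g);
  wg_gen_closed : forall x y,
    (forall eps, 0 < eps -> exists x' y', B x' y' /\
       norm (minus x' x) <= eps /\ norm (minus y' y) <= eps) -> B x y
}.

Arguments wg_cs_linear {V cs W B K a} _.
Arguments wg_cs_linear_l {V cs W B K a} _.
Arguments wg_cs_norm {V cs W B K a} _.
Arguments wg_cs_mul {V cs W B K a} _.
Arguments wg_cs_real {V cs W B K a} _.
Arguments wg_K {V cs W B K a} _.
Arguments wg_a {V cs W B K a} _.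
Arguments wg_linear {V cs W B K a} _.
Arguments wg_norm {V cs W B K a} _.
Arguments wg_cont {V cs W B K a} _.
Arguments wg_cs {V cs W B K a} _.
Arguments wg_0 {V cs W B K a} _.
Arguments wg_int {V cs W B K a} _.
Arguments wg_orbit {V cs W B K a} _.
Arguments wg_gen_cs {V cs W B K a} _.
Arguments wg_gen_line_int {V cs W B K a} _.
Arguments wg_gen_closed {V cs W B K a} _.

Section GaussianCalculus.
Context {V : CompleteNormedModule R_AbsRing} {cs : C -> V -> V}
  {W : R -> V -> V} {B : V -> V -> Prop} {K a : R}.
Variable wg : wave_group cs W B K a.

Local Notation csl := (wg_cs_linear wg).
Local Notation csl' := (wg_cs_linear_l wg).

Lemma cs_cont (k : R -> C) (h : R -> V) (s : R) :
  continuous k s -> continuous h s -> continuous (fun s => cs (k s) (h s)) s.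
Proof.
intros hk hh; destruct (locally_Cmod_bound k s hk) as [M [hM H]].
apply (continuous_family (fun s x => cs (k s) x) h s M); auto.
- intros t; apply csl.
- apply filter_imp with (2 := H); intros t ht x.
  apply Rle_trans with (1 := wg_cs_norm wg _ _).
  apply Rmult_le_compat_r; [apply vnorm_ge_0 | easy].
- apply (continuous_linear (U := CR) (fun c => cs c (h s)) k); [apply csl' | easy].
Qed.

Lemma cs_derive (k : R -> C) (h : R -> V) (s : R) (dk : C) (dh : V) :
  is_derive_C k s dk -> is_derive h s dh ->
  is_derive (fun s => cs (k s) (h s)) s (plus (cs dk (h s)) (cs (k s) dh)).
Proof.
intros hk hh; destruct (locally_Cmod_bound k s) as [M [hM H]].
{ now apply continuous_C_derive with dk. }
apply (is_derive_family (fun s x => cs (k s) x) h s M); auto.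
- apply filter_imp with (2 := H); intros t ht; split; [apply csl|].
  intros x; apply Rle_trans with (1 := wg_cs_norm wg _ _).
  apply Rmult_le_compat_r; [apply vnorm_ge_0 | easy].
- apply (is_derive_linear (U := CR) (fun c => cs c (h s)) k); [apply csl' | easy].
- apply (cs_cont k (fun _ => dh)); [now apply continuous_C_derive with dk|].
  apply continuous_const.
Qed.

(** Kernels that decay faster than the group grows. *)
Definition kernel_decay (M : R) (k : R -> C) : Prop :=
  exp_decay (V := CR) (a + 1) M k.

Lemma kernel_decay_Cmod M k s : kernel_decay M k ->
  Cmod (k s) <= M * exp (- (a + 1) * Rabs s).
Proof. intros [_ h]; rewrite <- norm_C; apply h. Qed.

Lemma kernel_decay_intro M k : (forall s, continuous k s) ->
  (forall s, Cmod (k s) <= M * exp (- (a + 1) * Rabs s)) -> kernel_decay M k.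
Proof.
intros h1 h2; split; [exact h1|]; intros s.
apply Rle_trans with (1 := Req_le _ _ (norm_C (k s))), h2.
Qed.

Lemma kernel_decay_growth M L k (h : R -> V) :
  kernel_decay M k -> (forall s, continuous h s) ->
  (forall s, norm (h s) <= L * exp (a * Rabs s)) ->
  exp_decay 1 (M * L) (fun s => cs (k s) (h s)).
Proof.
intros hk ch hh; split.
- intros s; apply cs_cont; [apply hk | apply ch].
- intros s; apply Rle_trans with (1 := wg_cs_norm wg _ _).
  replace (M * L * exp (- (1) * Rabs s)) with
    (M * exp (- (a + 1) * Rabs s) * (L * exp (a * Rabs s))).
  + apply Rmult_le_compat; [apply Cmod_ge_0 | apply vnorm_ge_0 | | apply hh].
    now apply kernel_decay_Cmod.
  + replace (- (1) * Rabs s) with (- (a + 1) * Rabs s + a * Rabs s) by ring.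
    rewrite exp_plus; ring.
Qed.

Lemma orbit_decay M k x : kernel_decay M k ->
  exp_decay 1 (M * (K * norm x)) (fun s => cs (k s) (W s x)).
Proof.
intros hk; apply kernel_decay_growth; [easy | apply (wg_cont wg) |].
intros s; apply Rle_trans with (1 := wg_norm wg _ _); right; ring.
Qed.

Definition smear (k : R -> C) (x : V) : V := line_int (fun s => cs (k s) (W s x)).

Lemma smear_norm M k x : kernel_decay M k ->
  norm (smear k x) <= 2 * M * K * norm x.
Proof.
intros hk; apply Rle_trans with (1 := line_int_norm _ _ _ Rlt_0_1 (orbit_decay M k x hk)).
right; field.
Qed.

Lemma smear_plus_k M k M' k' x : kernel_decay M k -> kernel_decay M' k' ->
  smear (fun s => k s + k' s)%C x = plus (smear k x) (smear k' x).
Proof.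
intros hk hk'; unfold smear.
rewrite <- (line_int_plus 1 _ _ _ _ Rlt_0_1 (orbit_decay M k x hk)
  (orbit_decay M' k' x hk')).
apply line_int_ext; intros s; apply (linear_plus _ (csl' (W s x))).
Qed.

Lemma smear_cs_k M k c x : kernel_decay M k ->
  smear (fun s => c * k s)%C x = cs c (smear k x).
Proof.
intros hk; unfold smear.
rewrite <- (line_int_linear (cs c) 1 _ _ (csl c) Rlt_0_1 (orbit_decay M k x hk)).
apply line_int_ext; intros s; symmetry; apply (wg_cs_mul wg).
Qed.

Lemma smear_intertwine (Q : V -> V) M k x : kernel_decay M k ->
  (forall s, k (- s) = k s) -> is_linear Q ->
  (forall c x, Q (cs c x) = cs c (Q x)) ->
  (forall t x, Q (W t x) = W (- t) (Q x)) -> Q (smear k x) = smear k (Q x).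
Proof.
intros hk he hQ hc hW; unfold smear.
rewrite <- (line_int_linear Q 1 _ _ hQ Rlt_0_1 (orbit_decay M k x hk)).
rewrite <- line_int_reflect; apply line_int_ext; intros s.
now rewrite hc, hW, Ropp_involutive, he.
Qed.

Lemma smear_commute (Q : V -> V) M k x : kernel_decay M k -> is_linear Q ->
  (forall c x, Q (cs c x) = cs c (Q x)) ->
  (forall t x, Q (W t x) = W t (Q x)) -> Q (smear k x) = smear k (Q x).
Proof.
intros hk hQ hc hW; unfold smear.
rewrite <- (line_int_linear Q 1 _ _ hQ Rlt_0_1 (orbit_decay M k x hk)).
apply line_int_ext; intros s; now rewrite hc, hW.
Qed.

Lemma smear_linear M k : kernel_decay M k -> is_linear (smear k).
Proof.
intros hk; assert (hM : 0 <= M) by (apply (exp_decay_ge_0 _ _ _ hk)).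
split.
- intros x y; unfold smear.
  etransitivity; [|apply (line_int_plus 1 _ _ _ _ Rlt_0_1 (orbit_decay M k x hk)
    (orbit_decay M k y hk))].
  apply line_int_ext; intros s.
  now rewrite (linear_plus _ (wg_linear wg s)), (linear_plus _ (csl _)).
- intros r x; symmetry; apply (smear_commute (scal r) M); [easy| | |].
  + apply (is_linear_scal_r (V := V)); intros; apply Rmult_comm.
  + intros c y; symmetry; apply (linear_scal _ (csl c)).
  + intros t y; symmetry; apply (linear_scal _ (wg_linear wg t)).
- exists (2 * M * K + 1); pose proof (wg_K wg) as hK.
  assert (0 <= 2 * M * K) by (apply Rmult_le_pos; lra).
  split; [lra|]; intros x; apply Rle_trans with (1 := smear_norm M k x hk).
  pose proof (vnorm_ge_0 x).
  change (2 * M * K * norm x <= (2 * M * K + 1) * norm x); nra.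
Qed.

Lemma smear_cs M k c x : kernel_decay M k -> smear k (cs c x) = cs c (smear k x).
Proof.
intros hk; symmetry; apply (smear_commute (cs c) M); [easy | apply csl | |].
- intros d y; rewrite !(wg_cs_mul wg); f_equal; ring.
- intros t y; symmetry; apply (wg_cs wg).
Qed.

Lemma orbit_int_growth x s :
  norm (RInt (fun s => W s x) 0 s) <= K * norm x / a * exp (a * Rabs s).
Proof.
pose proof (wg_a wg) as ha; pose proof (wg_K wg) as hK.
pose proof (vnorm_ge_0 x) as hx.
apply norm_RInt_exp; [easy | | apply (wg_cont wg) |].
- apply Rdiv_le_0_compat; [apply Rmult_le_pos; lra | lra].
- intros r _; apply Rle_trans with (1 := wg_norm wg _ _); right; field; lra.
Qed.

(** Integration by parts turns the generator into a derivative of the kernel. *)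
Lemma smear_gen M k M1 k1 x : kernel_decay M k -> kernel_decay M1 k1 ->
  (forall s, is_derive_C k s (k1 s)) ->
  B (smear k x) (opp (smear k1 x)).
Proof.
intros hk hk1 hd.
pose proof (wg_cont wg x) as cW.
set (I := fun s => RInt (fun s => W s x) 0 s).
assert (dI : forall s, is_derive I s (W s x))
  by (intros s; apply (is_derive_RInt_cont (fun s => W s x)); apply cW).
assert (cI : forall s, continuous I s)
  by (intros s; apply is_derive_continuous with (1 := dI s)).
set (L := K * norm x / a).
assert (gI : forall s, norm (I s) <= L * exp (a * Rabs s)) by apply orbit_int_growth.
pose proof (kernel_decay_growth M L k I hk cI gI) as dk.
pose proof (kernel_decay_growth M1 L k1 I hk1 cI gI) as dk1.
pose proof (orbit_decay M k x hk) as dW.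
pose proof (orbit_decay M1 k1 x hk1) as dW1.
(* [k W x] plus [k' I] is the derivative of [k I], where [I' = W x]. *)
assert (E1 : plus (line_int (fun s => cs (k1 s) (I s))) (smear k x) = zero).
{ unfold smear; rewrite <- (line_int_plus 1 _ _ _ _ Rlt_0_1 dk1 dW).
  apply (line_int_derive 1 _ (fun s => cs (k s) (I s)) _ Rlt_0_1 dk).
  - intros s; now apply cs_derive.
  - intros s; apply (continuous_plus (V := V)); [apply dk1 | apply dW]. }
assert (E2 : line_int (fun s => cs (k1 s) x) = zero).
{ rewrite (line_int_linear (U := CR) (fun c => cs c x) (a + 1) M1 k1);
    [|apply csl' | pose proof (wg_a wg); lra | exact hk1].
  rewrite (line_int_derive (V := CR) (a + 1) M k k1); auto.
  - apply (linear_zero _ (csl' x)).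
  - pose proof (wg_a wg); lra.
  - apply hk1. }
assert (dx : exp_decay 1 (M1 * norm x) (fun s => cs (k1 s) x)).
{ apply kernel_decay_growth; [easy | intros; apply continuous_const |].
  intros s; pose proof (vnorm_ge_0 x).
  pose proof (exp_ineq1_le (a * Rabs s)).
  assert (0 <= a * Rabs s) by (apply Rmult_le_pos;
    [apply Rlt_le, (wg_a wg) | apply Rabs_pos]). nra. }
assert (dx' : exp_decay 1 (M1 * norm x) (fun s => opp (cs (k1 s) x))).
{ split; [intros s; apply (continuous_opp (V := V)), dx|].
  intros s; rewrite vnorm_opp; apply dx. }
assert (G : B (line_int (fun s => cs (k1 s) (I s)))
  (line_int (fun s => plus (cs (k1 s) (W s x)) (opp (cs (k1 s) x))))).
{ apply (wg_gen_line_int wg 1 _ _ _ _ Rlt_0_1 dk1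
    (exp_decay_plus _ _ _ _ _ dW1 dx')).
  intros s.
  replace (plus (cs (k1 s) (W s x)) (opp (cs (k1 s) x))) with
    (cs (k1 s) (minus (W s x) x)) by apply (linear_minus _ _ _ (csl (k1 s))).
  apply (wg_gen_cs wg), (wg_int wg). }
rewrite (line_int_plus 1 _ _ _ _ Rlt_0_1 dW1 dx') in G.
rewrite (line_int_linear opp 1 _ _ (is_linear_opp (V := V)) Rlt_0_1 dx) in G.
rewrite E2 in G.
apply (wg_gen_cs wg (RtoC (-1))) in G.
rewrite !(wg_cs_real wg) in G.
assert (E3 : smear k x = scal (-1) (line_int (fun s => cs (k1 s) (I s)))).
{ transitivity (plus (plus (line_int (fun s => cs (k1 s) (I s))) (smear k x))
    (scal (-1) (line_int (fun s => cs (k1 s) (I s))))); [module_eq V|].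
  rewrite E1; module_eq V. }
rewrite E3.
replace (opp (smear k1 x)) with
   (scal (-1) (plus (line_int (fun s => cs (k1 s) (W s x))) (opp zero))); [easy|].
unfold smear; module_eq V.
Qed.

(** The same integration by parts, along an orbit that starts in the domain. *)
Lemma smear_of_gen M k M1 k1 x y : kernel_decay M k -> kernel_decay M1 k1 ->
  (forall s, is_derive_C k s (k1 s)) ->
  B x y -> smear k y = opp (smear k1 x).
Proof.
intros hk hk1 hd hxy.
pose proof (orbit_decay M1 k1 x hk1) as dx.
pose proof (orbit_decay M k y hk) as dy.
assert (E : plus (smear k1 x) (smear k y) = zero).
{ unfold smear; rewrite <- (line_int_plus 1 _ _ _ _ Rlt_0_1 dx dy).
  apply (line_int_derive 1 _ (fun s => cs (k s) (W s x)) _ Rlt_0_1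
    (orbit_decay M k x hk)).
  - intros s; apply cs_derive; [easy|].
    apply is_derive_ext with (fun t => plus x (RInt (fun s => W s y) 0 t)).
    { intros t; symmetry; now apply (wg_orbit wg). }
    eapply is_derive_eq.
    + apply (is_derive_plus (V := V)); [apply is_derive_const|].
      apply (is_derive_RInt_cont (fun s => W s y)), (wg_cont wg).
    + module_eq V.
  - intros s; apply (continuous_plus (V := V)); [apply dx | apply dy]. }
transitivity (plus (plus (smear k1 x) (smear k y)) (opp (smear k1 x))); [module_eq V|].
rewrite E; module_eq V.
Qed.

Section HeatSemigroup.
Variable mu : R.
Hypothesis mu_ge_0 : 0 <= mu.

Lemma heat_kernel_decay z : 0 < fst z -> exists M,
  0 < M /\ kernel_decay M (heat mu z) /\
  kernel_decay M (fun s => heat_slope z s * heat mu z s)%C /\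
  kernel_decay M (fun s => (heat_rate mu z s + RtoC mu) * heat mu z s)%C /\
  kernel_decay M (fun s => heat_rate mu z s * heat mu z s)%C.
Proof.
intros hz.
assert (hp : 0 < / fst z) by now apply Rinv_0_lt_compat.
set (B0 := 1 + / fst z + (/ fst z + (/ fst z) ^ 2 + mu) + mu).
assert (hi2 : 0 < (/ fst z) ^ 2) by now apply pow_lt.
assert (hrad : 0 < Cmod z + 1) by (pose proof (Cmod_ge_0 z); lra).
destruct (heat_decay mu (fst z) (Cmod z + 1) (a + 1) B0 mu_ge_0 hz hrad) as [M [hM H]].
{ unfold B0; lra. }
exists M; split; [easy|].
assert (D : forall s w, Cmod w <= B0 * (1 + s ^ 2) ^ 2 ->
  Cmod (w * heat mu z s) <= M * exp (- (a + 1) * Rabs s))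
  by (intros; apply H; lra || easy).
assert (q1 : forall s, 1 <= (1 + s ^ 2) ^ 2).
{ intros s; pose proof (pow2_ge_0 s); nra. }
assert (q2 : forall s, 1 + s ^ 2 <= (1 + s ^ 2) ^ 2).
{ intros s; pose proof (pow2_ge_0 s); nra. }
assert (hr : forall s, Cmod (heat_rate mu z s) <=
  (/ fst z + (/ fst z) ^ 2 + mu) * (1 + s ^ 2) ^ 2).
{ intros s; apply Rle_trans with (1 := heat_rate_bound mu (fst z) z s mu_ge_0 hz (Rle_refl _)).
  apply Rmult_le_compat_l; [lra|]; rewrite pow_1; apply q2. }
assert (cs1 : forall s, continuous (heat_slope z) s).
{ intros s; eapply continuous_C_derive; unfold heat_slope; apply is_derive_Cmult;
    [|apply (is_derive_const (V := C_R_NormedModule))].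
  apply (is_derive_RtoC (fun s => - (s / 2)) s (- / 2)).
  auto_derive; [easy | field]. }
split; [|split; [|split]]; apply kernel_decay_intro.
- apply heat_cont.
- intros s; rewrite <- (Cmult_1_l (heat mu z s)); apply D.
  rewrite Cmod_1; specialize (q1 s); unfold B0; nra.
- intros s; apply continuous_Cmult; [apply cs1 | apply heat_cont].
- intros s; apply D.
  apply Rle_trans with (1 := heat_slope_bound (fst z) z s hz (Rle_refl _)).
  specialize (q2 s); specialize (q1 s); unfold B0; nra.
- intros s; apply continuous_Cmult; [|apply heat_cont].
  apply (continuous_plus (V := C_R_NormedModule)); [apply heat_rate_cont|].
  apply continuous_const.
- intros s; apply D, Rle_trans with (1 := Cmod_triangle _ _).
  rewrite Cmod_R, Rabs_right by lra.
  specialize (q1 s); specialize (hr s); unfold B0; nra.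
- intros s; apply continuous_Cmult; [apply heat_rate_cont | apply heat_cont].
- intros s; apply D; specialize (q1 s); specialize (hr s); unfold B0; nra.
Qed.

(** The graph of the square of [B], shifted by [- mu]. *)
Definition gen_square (x y : V) : Prop :=
  exists x1 x2, B x x1 /\ B x1 x2 /\ y = minus x2 (scal mu x).

Definition heat_op (z : C) : V -> V := smear (heat mu z).
Definition heat_op' (z : C) : V -> V :=
  smear (fun s => heat_rate mu z s * heat mu z s)%C.

Lemma smear_rate_mu z x : 0 < fst z ->
  smear (fun s => (heat_rate mu z s + RtoC mu) * heat mu z s)%C x =
  plus (heat_op' z x) (scal mu (heat_op z x)).
Proof.
intros hz; destruct (heat_kernel_decay z hz) as [M [hM [d0 [_ [_ dr]]]]].
assert (dm : kernel_decay (mu * M) (fun s => RtoC mu * heat mu z s)%C).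
{ apply kernel_decay_intro.
  - intros s; apply continuous_Cmult; [apply continuous_const | apply heat_cont].
  - intros s; rewrite Cmod_mult, Cmod_R, Rabs_right, Rmult_assoc by lra.
    apply Rmult_le_compat_l; [easy | now apply kernel_decay_Cmod]. }
transitivity (smear (fun s => heat_rate mu z s * heat mu z s + RtoC mu * heat mu z s)%C x).
- f_equal; apply functional_extensionality; intros; ring.
- rewrite (smear_plus_k M _ (mu * M)) by easy.
  rewrite (smear_cs_k M) by easy.
  now rewrite (wg_cs_real wg).
Qed.

(** Two integrations by parts and the heat equation. *)
Lemma gen_square_heat_op z x : 0 < fst z -> gen_square (heat_op z x) (heat_op' z x).
Proof.
intros hz; destruct (heat_kernel_decay z hz) as [M [hM [d0 [d1 [d2 dr]]]]].
exists (opp (smear (fun s => heat_slope z s * heat mu z s)%C x)),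
  (smear (fun s => (heat_rate mu z s + RtoC mu) * heat mu z s)%C x); split; [|split].
- apply (smear_gen M _ M); auto; apply heat_derive_s.
- pose proof (smear_gen M _ M _ x d1 d2 (heat_derive_s2 mu z)) as G.
  apply (wg_gen_cs wg (RtoC (-1))) in G.
  rewrite !(wg_cs_real wg) in G.
  match type of G with B ?u ?v =>
    match goal with |- B ?u' ?v' =>
      replace u' with u by module_eq V; replace v' with v by module_eq V end end.
  exact G.
- rewrite smear_rate_mu by easy; module_eq V.
Qed.

Lemma heat_op_gen_square z x y : 0 < fst z -> gen_square x y ->
  heat_op z y = heat_op' z x.
Proof.
intros hz [x1 [x2 [h1 [h2 ->]]]].
destruct (heat_kernel_decay z hz) as [M [hM [d0 [d1 [d2 dr]]]]].
unfold heat_op at 1; rewrite (linear_minus _ _ _ (smear_linear M _ d0)).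
rewrite (linear_scal _ (smear_linear M _ d0)).
rewrite (smear_of_gen M _ M _ x1 x2 d0 d1 (heat_derive_s mu z) h2).
rewrite (smear_of_gen M _ M _ x x1 d1 d2 (heat_derive_s2 mu z) h1).
rewrite smear_rate_mu by easy; unfold heat_op; module_eq V.
Qed.

Lemma heat_op_linear z : 0 < fst z -> is_linear (heat_op z).
Proof.
intros hz; destruct (heat_kernel_decay z hz) as [M [hM [d0 _]]].
now apply smear_linear with M.
Qed.

Lemma heat_op'_linear z : 0 < fst z -> is_linear (heat_op' z).
Proof.
intros hz; destruct (heat_kernel_decay z hz) as [M [hM [_ [_ [_ d]]]]].
now apply smear_linear with M.
Qed.

Lemma heat_op_cs z c x : 0 < fst z -> heat_op z (cs c x) = cs c (heat_op z x).
Proof.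
intros hz; destruct (heat_kernel_decay z hz) as [M [hM [d0 _]]].
now apply smear_cs with M.
Qed.

Lemma heat_op'_cs z c x : 0 < fst z -> heat_op' z (cs c x) = cs c (heat_op' z x).
Proof.
intros hz; destruct (heat_kernel_decay z hz) as [M [hM [_ [_ [_ d]]]]].
now apply smear_cs with M.
Qed.

(** The constant is uniform in [z] because [sg_contraction] sums this expansion over
    the steps of a partition. *)
Lemma heat_op_taylor a0 rad : 0 < a0 -> 0 < rad ->
  exists M, 0 < M /\ forall z h x,
    a0 <= fst z -> a0 <= fst (z + h)%C -> Cmod z <= rad -> Cmod (z + h)%C <= rad ->
    norm (minus (minus (heat_op (z + h)%C x) (heat_op z x)) (cs h (heat_op' z x)))
      <= Cmod h ^ 2 * (M * norm x).
Proof.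
intros ha hr; pose proof (wg_K wg) as hK.
destruct (heat_taylor mu a0 rad (a + 1) mu_ge_0 ha hr) as [M [hM H]].
exists (2 * M * K); split; [repeat apply Rmult_lt_0_compat; lra|].
intros z h x h1 h2 h3 h4.
destruct (heat_kernel_decay z ltac:(lra)) as [M1 [_ [d0 [_ [_ dr]]]]].
destruct (heat_kernel_decay (z + h)%C ltac:(lra)) as [M2 [_ [d0' _]]].
assert (D : kernel_decay (Cmod h ^ 2 * M)
  (fun s => heat mu (z + h) s - heat mu z s - h * (heat_rate mu z s * heat mu z s))%C).
{ apply kernel_decay_intro.
  - intros s.
    apply (continuous_minus (V := C_R_NormedModule)).
    + apply (continuous_minus (V := C_R_NormedModule)); apply heat_cont.
    + apply continuous_Cmult; [apply continuous_const|].
      apply continuous_Cmult; [apply heat_rate_cont | apply heat_cont].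
  - intros s; rewrite Rmult_assoc; now apply H. }
replace (minus (minus (heat_op (z + h)%C x) (heat_op z x)) (cs h (heat_op' z x))) with
  (smear (fun s => heat mu (z + h) s - heat mu z s -
     h * (heat_rate mu z s * heat mu z s))%C x).
- apply Rle_trans with (1 := smear_norm _ _ x D); right; ring.
- assert (Dm : kernel_decay M1 (fun s => (-1) * heat mu z s)%C).
  { apply kernel_decay_intro.
    - intros s; apply continuous_Cmult; [apply continuous_const | apply heat_cont].
    - intros s; rewrite Cmod_mult, Cmod_R, Rabs_left by lra.
      replace (- -1) with 1 by ring; rewrite Rmult_1_l.
      now apply kernel_decay_Cmod. }
  assert (Dh : kernel_decay (Cmod h * M1)
    (fun s => (- h) * (heat_rate mu z s * heat mu z s))%C).
  { apply kernel_decay_intro.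
    - intros s; apply continuous_Cmult; [apply continuous_const | apply dr].
    - intros s; rewrite Cmod_mult, Cmod_opp, Rmult_assoc.
      apply Rmult_le_compat_l; [apply Cmod_ge_0|].
      now apply (kernel_decay_Cmod M1 (fun s => heat_rate mu z s * heat mu z s)%C). }
  transitivity (smear (fun s => (heat mu (z + h) s +
     ((-1) * heat mu z s + (- h) * (heat_rate mu z s * heat mu z s))))%C x).
  { f_equal; apply functional_extensionality; intros s.
    rewrite RtoC_m1.
    ring. }
  rewrite (smear_plus_k M2 _ _ _ _ d0' (exp_decay_plus _ _ _ _ _ Dm Dh)).
  rewrite (smear_plus_k M1 _ _ _ _ Dm Dh).
  rewrite (smear_cs_k M1 _ (-1) _ d0), (smear_cs_k M1 _ (- h)%C _ dr).
  rewrite (wg_cs_real wg).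
  change (cs (- h)%C) with (cs (opp (h : CR))).
  rewrite (linear_opp _ _ (csl' _)).
  unfold heat_op, heat_op'; module_eq V.
Qed.

Lemma heat_op_bound a0 rad : 0 < a0 -> 0 < rad ->
  exists M, 0 < M /\ forall z x, a0 <= fst z -> Cmod z <= rad ->
    norm (heat_op z x) <= M * norm x.
Proof.
intros ha hr; pose proof (wg_K wg) as hK.
destruct (heat_decay mu a0 rad (a + 1) 1 mu_ge_0 ha hr ltac:(lra)) as [M [hM H]].
exists (2 * M * K); split; [repeat apply Rmult_lt_0_compat; lra|].
intros z x h1 h2; apply smear_norm, kernel_decay_intro; [apply heat_cont|].
intros s; rewrite <- (Cmult_1_l (heat mu z s)); apply H; try easy.
rewrite Cmod_1; pose proof (pow2_ge_0 s); nra.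
Qed.

Lemma heat_op_derive z h x t : 0 < fst (z + RtoC t * h)%C ->
  is_derive (fun t => heat_op (z + RtoC t * h)%C x) t
    (cs h (heat_op' (z + RtoC t * h)%C x)).
Proof.
set (w := (z + RtoC t * h)%C); intros hw.
pose proof (Cmod_ge_0 w) as hw0; pose proof (Cmod_ge_0 h) as hh0.
pose proof (vnorm_ge_0 x) as hx.
destruct (heat_op_taylor (fst w / 2) (Cmod w + 1)) as [M [hM H]]; [lra | lra |].
apply is_derive_norm_iff; intros eps he.
set (m := fst w / 2). set (A := Cmod h ^ 2 * (M * norm x) + 1).
assert (hA0 : 0 <= Cmod h ^ 2 * (M * norm x)).
{ apply Rmult_le_pos; [apply pow2_ge_0 | apply Rmult_le_pos; lra]. }
assert (hA : 0 < A) by (unfold A; lra).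
set (d := Rmin (Rmin m 1 / (Cmod h + 1)) (eps / A)).
assert (hm1 : 0 < Rmin m 1) by (apply Rmin_pos; unfold m; lra).
assert (hd : 0 < d).
{ apply Rmin_pos; apply Rdiv_lt_0_compat; lra. }
exists d; split; [easy|]; intros y hy.
apply Rmin_Rgt in hy as [hy1 hy2].
set (k := (RtoC (y - t) * h)%C).
assert (E : (z + RtoC y * h)%C = (w + k)%C).
{ unfold w, k; rewrite RtoC_minus; ring. }
assert (hk : Cmod k <= Rmin m 1).
{ unfold k; rewrite Cmod_mult, Cmod_R.
  apply Rgt_lt, Rlt_le in hy1.
  apply Rmult_le_compat_r with (r := Cmod h + 1) in hy1; [|lra].
  replace (Rmin m 1 / (Cmod h + 1) * (Cmod h + 1)) with (Rmin m 1) in hy1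
    by (field; lra).
  pose proof (Rabs_pos (y - t)); nra. }
pose proof (Rmin_l m 1) as hl; pose proof (Rmin_r m 1) as hr.
assert (hf : Rabs (fst k) <= m).
{ apply Rle_trans with (2 := Rle_trans _ _ _ hk hl).
  apply Rle_trans with (2 := Rmax_Cmod k), Rmax_l. }
rewrite E.
replace (scal (y - t) (cs h (heat_op' w x))) with (cs k (heat_op' w x))
  by (unfold k; rewrite <- (wg_cs_mul wg); apply (wg_cs_real wg)).
apply Rle_trans with (Cmod k ^ 2 * (M * norm x)).
- apply H; [lra | | lra |].
  + apply Rabs_le_between in hf; change (fst w / 2 <= fst w + fst k).
    unfold m in hf; lra.
  + apply Rle_trans with (1 := Cmod_triangle _ _); lra.
- unfold k; rewrite Cmod_mult, Cmod_R.
  replace ((Rabs (y - t) * Cmod h) ^ 2 * (M * norm x)) with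
    (Rabs (y - t) * (Cmod h ^ 2 * (M * norm x)) * Rabs (y - t)) by ring.
  apply Rmult_le_compat_r; [apply Rabs_pos|].
  apply Rgt_lt, Rlt_le in hy2.
  apply Rmult_le_compat_r with (r := A) in hy2; [|lra].
  replace (eps / A * A) with eps in hy2 by (field; lra).
  unfold A in hy2; pose proof (Rabs_pos (y - t)); nra.
Qed.

End HeatSemigroup.
End GaussianCalculus.

(** * The mass of the heat kernel *)

(** The trivial group on [C], with generator zero: its functional calculus computes
    the mass of the heat kernel. *)
Lemma trivial_wave_group :
  wave_group (V := CR) Cmult (fun _ x => x) (fun _ y => y = zero) 1 1.
Proof.
split.
- intros c; apply Cmult_linear.
- intros x; apply (is_linear_ext (fun c : CR => (x * c)%C)).
  + intros c; apply Cmult_comm.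
  + apply Cmult_linear.
- intros c x.
  change (@norm _ C_R_NormedModule (c * x)%C <= Cmod c * @norm _ C_R_NormedModule x).
  rewrite !norm_C, Cmod_mult; apply Rle_refl.
- intros c d x; apply Cmult_assoc.
- intros r x; symmetry; apply scal_C.
- lra.
- lra.
- intros t; apply is_linear_id.
- intros t x; pose proof (exp_ineq1_le (1 * Rabs t)); pose proof (Rabs_pos t).
  pose proof (vnorm_ge_0 x); nra.
- intros x t; apply continuous_const.
- easy.
- easy.
- intros x t; module_eq CR.
- intros x y t ->; rewrite RInt_const; module_eq CR.
- intros c x y ->; apply Cmult_0_r.
- intros c M f M' g hc hf hg h.
  rewrite (line_int_ext g (fun _ => zero)) by exact h.
  apply (line_int_derive (V := CR) 1 0 (fun _ => zero)); [lra | | |].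
  + split; [intros; apply continuous_const|].
    intros s; rewrite vnorm_zero; lra.
  + intros s; apply (is_derive_const (V := CR)).
  + intros s; apply continuous_const.
- intros x y h; apply (vnorm_eq_0 (V := CR)), le_epsilon; intros eps he.
  destruct (h eps he) as [x' [y' [-> [_ h2]]]].
  rewrite Rplus_0_l; rewrite <- (vnorm_opp (V := CR)).
  replace (opp y) with (minus zero y) by module_eq CR; exact h2.
Qed.

Definition heat_mass : C := line_int (V := CR) (heat 0 (RtoC 1)).

(** The derivative of the mass in [z] is the integral of a second derivative in [s].
    In the calculus of the trivial group this reads: the generator is zero. *)
Lemma heat_mass_const (z : C) : 0 < fst z -> line_int (V := CR) (heat 0 z) = heat_mass.
Proof.
intros hz.
assert (E : forall w, heat_op (V := CR) (cs := Cmult) (W := fun _ x => x) 0 w (RtoC 1 : CR) =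
  line_int (V := CR) (heat 0 w)).
{ intros w; apply line_int_ext; intros s; apply Cmult_1_r. }
set (h := (z - RtoC 1)%C).
set (phi := fun t : R => heat_op (V := CR) (cs := Cmult) (W := fun _ x => x) 0
  (RtoC 1 + RtoC t * h)%C (RtoC 1 : CR)).
assert (d : forall t, 0 <= t <= 1 -> is_derive phi t zero).
{ intros t ht.
  assert (hp : 0 < fst (RtoC 1 + RtoC t * h)%C).
  { unfold h; destruct z as [u v]; simpl in *.
    destruct (Rlt_dec u 1); nra. }
  apply (is_derive_eq (V := CR) phi t (h * heat_op' (V := CR) (cs := Cmult)
    (W := fun _ x => x) 0 (RtoC 1 + RtoC t * h)%C (RtoC 1 : CR))%C).
  - exact (heat_op_derive trivial_wave_group 0 (Rle_refl 0) (RtoC 1) h _ t hp).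
  - assert (G : gen_square (V := CR) (B := fun _ y : CR => y = zero) 0 (RtoC 1) zero).
    { exists zero, zero; repeat split.
      rewrite scal_R0; module_eq CR. }
    rewrite <- (heat_op_gen_square trivial_wave_group 0 (Rle_refl 0) _ _ _ hp G).
    pose proof (linear_zero _ (heat_op_linear trivial_wave_group 0 (Rle_refl 0) _ hp))
      as Z.
    exact (eq_trans (f_equal (Cmult h) Z) (Cmult_0_r h)). }
pose proof (eq_is_derive (V := CR) phi 0 1 d Rlt_0_1) as Q.
unfold phi in Q; rewrite !E in Q.
replace (RtoC 1 + RtoC 0 * h)%C with (RtoC 1) in Q by ring.
replace (RtoC 1 + RtoC 1 * h)%C with z in Q by (unfold h; ring).
symmetry; exact Q.
Qed.

Lemma heat_one s : heat 0 (RtoC 1) s = RtoC (exp (- (s ^ 2 / 4))).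
Proof.
unfold heat, heat_exponent, clog, cexp; simpl.
replace (1 * (1 * 1) + 0 * (0 * 1)) with 1 by ring.
replace (0 / 1) with 0 by field.
rewrite ln_1, atan_0.
match goal with |- (exp ?X * cos ?Y, exp ?X * sin ?Y) = _ =>
  replace Y with 0 by field; replace X with (- (s * (s * 1) / 4)) by field end.
rewrite cos_0, sin_0; unfold RtoC; f_equal; ring.
Qed.

Lemma heat_mass_neq_0 : heat_mass <> 0%C.
Proof.
destruct (heat_kernel_decay (a := 1) 0 (Rle_refl 0) (RtoC 1) ltac:(simpl; lra))
  as [M [hM [hd _]]].
pose proof (line_int_correct (V := CR) (1 + 1) M _ ltac:(lra) hd) as L.
fold heat_mass in L.
intros E; rewrite E in L.
set (f := fun s => exp (- (s ^ 2 / 4)) + exp (- ((- s) ^ 2 / 4))).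
assert (cf : forall s, continuous f s).
{ intros s; apply (ex_derive_continuous (V := R_NormedModule)); unfold f.
  auto_derive; easy. }
assert (hm : 0 < RInt f 0 1).
{ apply RInt_gt_0; [lra | | intros; apply cf].
  intros s _; unfold f; apply Rplus_lt_0_compat; apply exp_pos. }
destruct (L _ hm) as [N hN]; specialize (hN (S N) ltac:(lia)).
assert (e1 : RInt (V := CR) (fold_line (V := CR) (heat 0 (RtoC 1))) 0 (INR (S N)) =
  RtoC (RInt f 0 (INR (S N)))).
{ assert (hl : is_linear (U := R_CompleteNormedModule) (V := CR) RtoC).
  { split.
    - intros x y; apply RtoC_plus.
    - intros k x; change (RtoC (k * x) = @scal _ C_R_NormedModule k (RtoC x)).
      now rewrite scal_C, RtoC_mult.
    - exists 1; split; [lra|]; intros x.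
      rewrite Rmult_1_l; apply Rle_trans with (1 := Req_le _ _ (norm_C (RtoC x))).
      rewrite Cmod_R; apply Rle_refl. }
  rewrite (linear_RInt (U := R_CompleteNormedModule) (V := CR) RtoC f) by easy.
  apply (RInt_ext (V := CR)); intros s _; unfold fold_line, f.
  rewrite !heat_one, RtoC_plus; reflexivity. }
rewrite e1 in hN.
assert (hn : norm (minus (RtoC (RInt f 0 (INR (S N))) : CR) (RtoC 0)) =
  Rabs (RInt f 0 (INR (S N)))).
{ replace (minus (RtoC (RInt f 0 (INR (S N))) : CR) (RtoC 0)) with
    (RtoC (RInt f 0 (INR (S N))) : CR)
    by (symmetry; apply (minus_zero_r (G := C_AbelianGroup))).
  apply (eq_trans (norm_C _)), Cmod_R. }
assert (I : RInt f 0 1 <= RInt f 0 (INR (S N))).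
{ assert (ei : forall u v, ex_RInt f u v).
  { intros u v; apply (ex_RInt_cont (V := R_CompleteNormedModule)); apply cf. }
  assert (hS : 1 <= INR (S N)) by (rewrite S_INR; pose proof (pos_INR N); lra).
  rewrite <- (RInt_Chasles (V := R_CompleteNormedModule) f 0 1 (INR (S N))) by easy.
  change (RInt f 0 1 <= RInt f 0 1 + RInt f 1 (INR (S N))).
  assert (0 <= RInt f 1 (INR (S N))); [|lra].
  apply RInt_ge_0; [easy | easy|]; intros s _; unfold f.
  apply Rlt_le, Rplus_lt_0_compat; apply exp_pos. }
rewrite Rabs_right in hn by lra.
pose proof (Rle_lt_trans _ _ _ (Req_le _ _ (eq_sym hn)) hN); lra.
Qed.

(** * The analytic semigroup *)

Section Semigroup.
Context {V : CompleteNormedModule R_AbsRing} {cs : C -> V -> V}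
  {W : R -> V -> V} {B : V -> V -> Prop} {K a : R}.
Variable wg : wave_group cs W B K a.
Variable mu : R.
Hypothesis mu_ge_0 : 0 <= mu.

Local Notation csl := (wg_cs_linear wg).
Local Notation csl' := (wg_cs_linear_l wg).
Local Notation HO := (heat_op (cs := cs) (W := W)).
Local Notation HO' := (heat_op' (cs := cs) (W := W)).
Local Notation G := (gen_square (B := B) mu).

Definition sg (z : C) (x : V) : V :=
  cs (/ heat_mass)%C (HO mu z x).
Definition sg' (z : C) (x : V) : V :=
  cs (/ heat_mass)%C (HO' mu z x).

Definition mass_factor : R := Cmod (/ heat_mass)%C.

Lemma mass_factor_pos : 0 < mass_factor.
Proof.
unfold mass_factor; apply Cmod_gt_0; intros E.
pose proof heat_mass_neq_0 as h.
pose proof (Cinv_r _ h) as e; rewrite E, Cmult_0_r in e.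
apply C1_nz; now symmetry.
Qed.

Lemma gen_square_cs c x y : G x y -> G (cs c x) (cs c y).
Proof.
intros [x1 [x2 [h1 [h2 ->]]]]; exists (cs c x1), (cs c x2).
repeat split; try now apply (wg_gen_cs wg).
rewrite (linear_minus _ _ _ (csl c)), (linear_scal _ (csl c)); easy.
Qed.

Lemma sg_gen (z : C) x : 0 < fst z -> G (sg z x) (sg' z x).
Proof. intros hz; now apply gen_square_cs, (gen_square_heat_op wg). Qed.

Lemma sg_of_gen (z : C) x y : 0 < fst z -> G x y -> sg z y = sg' z x.
Proof.
intros hz h; unfold sg; now rewrite (heat_op_gen_square wg mu mu_ge_0 z x y hz h).
Qed.

Lemma sg_linear z : 0 < fst z -> is_linear (sg z).
Proof.
intros hz; apply (is_linear_comp (HO mu z) (cs (/ heat_mass)%C));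
  [now apply (heat_op_linear wg) | apply csl].
Qed.

Lemma sg'_linear z : 0 < fst z -> is_linear (sg' z).
Proof.
intros hz; apply (is_linear_comp (heat_op' mu z) (cs (/ heat_mass)%C));
  [now apply (heat_op'_linear wg) | apply csl].
Qed.

Lemma sg_cs z c x : 0 < fst z -> sg z (cs c x) = cs c (sg z x).
Proof.
intros hz; unfold sg; rewrite (heat_op_cs wg) by easy.
rewrite !(wg_cs_mul wg); f_equal; ring.
Qed.

Lemma sg'_cs z c x : 0 < fst z -> sg' z (cs c x) = cs c (sg' z x).
Proof.
intros hz; unfold sg'; rewrite (heat_op'_cs wg) by easy.
rewrite !(wg_cs_mul wg); f_equal; ring.
Qed.

(** The kernel is even, so the semigroup commutes with a map that reverses the
    group. *)
Lemma sg_intertwine (Q : V -> V) (z : C) x : 0 < fst z -> is_linear Q ->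
  (forall c x, Q (cs c x) = cs c (Q x)) ->
  (forall t x, Q (W t x) = W (- t) (Q x)) -> Q (sg z x) = sg z (Q x).
Proof.
intros hz hQ hc hW; unfold sg; rewrite hc; f_equal.
destruct (heat_kernel_decay (a := a) mu mu_ge_0 z hz) as [M [hM [d _]]].
apply (smear_intertwine wg Q M); auto; apply heat_even.
Qed.

Lemma cs_norm_mass x : norm (cs (/ heat_mass)%C x) <= mass_factor * norm x.
Proof. apply (wg_cs_norm wg). Qed.

Lemma sg_bound a0 rad : 0 < a0 -> 0 < rad ->
  exists M, 0 < M /\ forall z x, a0 <= fst z -> Cmod z <= rad ->
    norm (sg z x) <= M * norm x.
Proof.
intros ha hr; destruct (heat_op_bound wg mu mu_ge_0 a0 rad ha hr) as [M [hM H]].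
exists (mass_factor * M); split.
{ apply Rmult_lt_0_compat; [apply mass_factor_pos | easy]. }
intros z x h1 h2; apply Rle_trans with (1 := cs_norm_mass _); rewrite Rmult_assoc.
apply Rmult_le_compat_l; [apply Rlt_le, mass_factor_pos | now apply H].
Qed.

Lemma sg_taylor a0 rad : 0 < a0 -> 0 < rad ->
  exists M, 0 < M /\ forall z h x,
    a0 <= fst z -> a0 <= fst (z + h)%C -> Cmod z <= rad -> Cmod (z + h)%C <= rad ->
    norm (minus (minus (sg (z + h)%C x) (sg z x)) (cs h (sg' z x)))
      <= Cmod h ^ 2 * (M * norm x).
Proof.
intros ha hr; destruct (heat_op_taylor wg mu mu_ge_0 a0 rad ha hr) as [M [hM H]].
exists (mass_factor * M); split.
{ apply Rmult_lt_0_compat; [apply mass_factor_pos | easy]. }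
intros z h x h1 h2 h3 h4; specialize (H z h x h1 h2 h3 h4).
assert (E : minus (minus (sg (z + h)%C x) (sg z x)) (cs h (sg' z x)) =
  cs (/ heat_mass)%C (minus (minus (HO mu (z + h)%C x) (HO mu z x))
    (cs h (HO' mu z x)))).
{ rewrite !(linear_minus _ _ _ (csl _)); unfold sg, sg'.
  rewrite !(wg_cs_mul wg).
  now rewrite (Cmult_comm h). }
rewrite E; apply Rle_trans with (1 := cs_norm_mass _).
pose proof mass_factor_pos.
replace (Cmod h ^ 2 * (mass_factor * M * norm x)) with
  (mass_factor * (Cmod h ^ 2 * (M * norm x))) by ring.
apply Rmult_le_compat_l; lra.
Qed.

Lemma sg_derive z h x t : 0 < fst (z + RtoC t * h)%C ->
  is_derive (fun t => sg (z + RtoC t * h)%C x) t (cs h (sg' (z + RtoC t * h)%C x)).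
Proof.
intros hz; eapply is_derive_eq.
- apply (is_derive_linear (cs (/ heat_mass)%C)); [apply csl|].
  now apply (heat_op_derive wg).
- cbn beta; unfold sg'; rewrite !(wg_cs_mul wg).
  now rewrite (Cmult_comm h).
Qed.

(** * Strong continuity at the origin *)

(** On this cone the kernel is dominated by real Gaussians of comparable width and
    mass. *)
Definition in_cone (z : C) : Prop := 0 < fst z /\ Rabs (snd z) <= fst z.

Lemma in_cone_plus z w : in_cone z -> in_cone w -> in_cone (z + w)%C.
Proof.
intros [h1 h2] [h1' h2']; split; simpl; [lra|].
apply Rle_trans with (1 := Rabs_triang _ _); lra.
Qed.

Lemma in_cone_scal t z : 0 < t -> in_cone z -> in_cone (RtoC t * z)%C.
Proof.
intros ht [h1 h2]; split; destruct z as [u v]; simpl in *.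
- rewrite Rmult_0_l, Rminus_0_r; now apply Rmult_lt_0_compat.
- rewrite !Rmult_0_l, Rminus_0_r, Rplus_0_r, Rabs_mult, Rabs_right by lra.
  apply Rmult_le_compat_l; lra.
Qed.

Lemma in_cone_Cmod z : in_cone z -> 0 < Cmod z.
Proof. intros [h _]; apply Cmod_gt_0; intros ->; simpl in h; lra. Qed.

Lemma heat_cone_decay : exists M, 0 < M /\ forall z s, in_cone z -> Cmod z <= 1 ->
  Cmod (heat 0 z s) * ((1 + s ^ 2 / Cmod z) * exp (a * Rabs s)) <=
  M / sqrt (Cmod z) * exp (- / sqrt (Cmod z) * Rabs s).
Proof.
destruct (gauss_decay (1 / 8) (a + 1) ltac:(lra)) as [M [hM H]].
exists M; split; [easy|]; intros z s hz h1.
pose proof (wg_a wg) as ha.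
pose proof (in_cone_Cmod z hz) as hr; set (r := Cmod z) in *.
(* [u] is the parabolic variable: in terms of it the bound does not depend on [z]. *)
set (q := sqrt r). assert (hq : 0 < q) by now apply sqrt_lt_R0.
assert (hqq : q * q = r) by (apply sqrt_sqrt; lra).
assert (hq1 : q <= 1) by nra.
set (u := s / q). assert (hu : s = u * q) by (unfold u; field; lra).
assert (hs2 : s ^ 2 / r = u ^ 2) by (rewrite <- hqq, hu; field; lra).
assert (hs : Rabs s = Rabs u * q).
{ rewrite hu, Rabs_mult, (Rabs_right q); lra. }
assert (hau : Rabs s <= Rabs u) by (pose proof (Rabs_pos u); rewrite hs; nra).
pose proof (heat_cone_bound z s (proj1 hz) (proj2 hz)) as hk; fold r q in hk.
replace (s ^ 2 / (8 * r)) with (1 / 8 * (s ^ 2 / r)) in hk by (field; lra).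
rewrite hs2 in hk; rewrite hs2.
apply Rle_trans with (/ q * exp (- (1 / 8 * u ^ 2)) *
  ((1 + u ^ 2) ^ 2 * exp (a * Rabs u))).
- pose proof (pow2_ge_0 u).
  apply Rmult_le_compat; [apply Cmod_ge_0 | | easy |].
  + apply Rmult_le_pos; [lra | apply Rlt_le, exp_pos].
  + apply Rmult_le_compat; [lra | apply Rlt_le, exp_pos | nra |].
    apply exp_monotone, Rmult_le_compat_l; lra.
- replace (- / q * Rabs s) with (- (a + 1) * Rabs u + a * Rabs u)
    by (rewrite hs; field; lra).
  rewrite exp_plus; specialize (H u).
  replace (- (1 / 8) * u ^ 2) with (- (1 / 8 * u ^ 2)) in H by ring.
  replace (/ q * exp (- (1 / 8 * u ^ 2)) * ((1 + u ^ 2) ^ 2 * exp (a * Rabs u))) with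
    (/ q * exp (a * Rabs u) * ((1 + u ^ 2) ^ 2 * exp (- (1 / 8 * u ^ 2)))) by ring.
  replace (M / q * (exp (- (a + 1) * Rabs u) * exp (a * Rabs u))) with
    (/ q * exp (a * Rabs u) * (M * exp (- (a + 1) * Rabs u))) by (field; lra).
  apply Rmult_le_compat_l; [|exact H].
  apply Rmult_le_pos; [apply Rlt_le, Rinv_0_lt_compat; lra | apply Rlt_le, exp_pos].
Qed.

(** The heat kernel is an approximate identity in the cone. *)
Lemma smear_cone_bound : exists M, 0 < M /\ forall z (h : R -> V) A L,
  in_cone z -> Cmod z <= 1 -> 0 <= A -> 0 <= L -> (forall s, continuous h s) ->
  (forall s, norm (h s) <= (A + L * s ^ 2) * exp (a * Rabs s)) ->
  norm (line_int (fun s => cs (heat 0 z s) (h s))) <= M * (A + L * Cmod z).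
Proof.
destruct heat_cone_decay as [M [hM H]].
exists (2 * M); split; [lra|]; intros z h A L hz h1 hA hL ch hh.
pose proof (in_cone_Cmod z hz) as hr.
assert (hq : 0 < sqrt (Cmod z)) by now apply sqrt_lt_R0.
set (r := Cmod z) in *.
assert (D : exp_decay (/ sqrt r) (M / sqrt r * (A + L * r))
  (fun s => cs (heat 0 z s) (h s))).
{ split; [intros s; apply (cs_cont wg); [apply heat_cont | apply ch]|].
  intros s; apply Rle_trans with (1 := wg_cs_norm wg _ _).
  specialize (H z s hz h1); specialize (hh s); fold r in H.
  pose proof (pow2_ge_0 s) as hs2.
  assert (hsr : 0 <= s ^ 2 / r) by (apply Rdiv_le_0_compat; lra).
  assert (q : A + L * s ^ 2 <= (A + L * r) * (1 + s ^ 2 / r)).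
  { replace (L * s ^ 2) with (L * r * (s ^ 2 / r)) by (field; lra).
    assert (0 <= L * r) by (apply Rmult_le_pos; lra).
    assert (0 <= A * (s ^ 2 / r)) by now apply Rmult_le_pos. lra. }
  assert (hAL : 0 <= A + L * r).
  { assert (0 <= L * r) by (apply Rmult_le_pos; lra). lra. }
  apply Rle_trans with (Cmod (heat 0 z s) *
    ((A + L * r) * ((1 + s ^ 2 / r) * exp (a * Rabs s)))).
  - apply Rmult_le_compat_l; [apply Cmod_ge_0|].
    apply Rle_trans with (1 := hh); rewrite <- Rmult_assoc.
    apply Rmult_le_compat_r; [apply Rlt_le, exp_pos | exact q].
  - replace (Cmod (heat 0 z s) * ((A + L * r) * ((1 + s ^ 2 / r) * exp (a * Rabs s))))
      with ((A + L * r) * (Cmod (heat 0 z s) * ((1 + s ^ 2 / r) * exp (a * Rabs s))))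
      by ring.
    replace (M / sqrt r * (A + L * r) * exp (- / sqrt r * Rabs s)) with
      ((A + L * r) * (M / sqrt r * exp (- / sqrt r * Rabs s))) by ring.
    now apply Rmult_le_compat_l. }
apply Rle_trans with (1 := line_int_norm _ _ _ (Rinv_0_lt_compat _ hq) D).
right; field; lra.
Qed.

Lemma Cmod_cexp_minus_1 (w : C) : fst w <= 0 -> Cmod (cexp w - 1)%C <= Cmod w.
Proof.
intros hw; rewrite <- norm_C.
replace (cexp w - 1)%C with (cexp (0 + RtoC 1 * w) - cexp (0 + RtoC 0 * w))%C.
2: { replace (0 + RtoC 1 * w)%C with w by ring.
     replace (0 + RtoC 0 * w)%C with (RtoC 0) by ring. now rewrite cexp_0. }
replace (Cmod w) with ((1 - 0) * Cmod w) by ring.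
apply (mean_value_ineq CR (fun t => cexp (0 + RtoC t * w)%C)
  (fun t => w * cexp (0 + RtoC t * w))%C); [lra | | |].
- intros t _; apply is_derive_cexp, is_derive_segment.
- intros t _; apply continuous_Cmult; [apply continuous_const|].
  eapply continuous_C_derive, is_derive_cexp, is_derive_segment.
- intros t ht; apply Rle_trans with (1 := Req_le _ _ (norm_C _)).
  rewrite Cmod_mult, Cmod_cexp.
  rewrite <- (Rmult_1_r (Cmod w)) at 2; apply Rmult_le_compat_l; [apply Cmod_ge_0|].
  rewrite <- exp_0; apply exp_monotone; destruct w; simpl in *; nra.
Qed.

Lemma sg_mu (z : C) x : 0 < fst z ->
  sg z x = cs (cexp (RtoC (- mu) * z) * / heat_mass)%C (HO 0 z x).
Proof.
intros hz; unfold sg; rewrite Cmult_comm, <- (wg_cs_mul wg); f_equal.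
destruct (heat_kernel_decay (a := a) 0 (Rle_refl 0) z hz) as [M [hM [d _]]].
unfold heat_op; rewrite <- (smear_cs_k wg M) by easy.
f_equal; apply functional_extensionality; intros s.
apply heat_mu.
Qed.

Lemma Cmod_decay_factor (z : C) : 0 < fst z -> Cmod (cexp (RtoC (- mu) * z)) <= 1.
Proof.
intros hz; rewrite Cmod_cexp, <- exp_0; apply exp_monotone.
destruct z; simpl in *; nra.
Qed.

(** The quadratic term has weight [s ^ 2], whose average against the kernel is of
    order [|z|]. *)
Lemma orbit_modulus x eps : 0 < eps -> exists L, 0 <= L /\ forall s,
  norm (minus (W s x) x) <= (eps + L * s ^ 2) * exp (a * Rabs s).
Proof.
intros he.
destruct (proj1 (continuous_norm_iff _ _) (wg_cont wg x 0) eps he)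
  as [d [hd H]].
cbn beta in H; rewrite (wg_0 wg) in H.
pose proof (wg_K wg) as hK; pose proof (wg_a wg) as ha.
pose proof (vnorm_ge_0 x) as hx.
assert (hL : 0 <= (K + 1) * norm x / d ^ 2).
{ apply Rdiv_le_0_compat; [apply Rmult_le_pos; lra | now apply pow_lt]. }
exists ((K + 1) * norm x / d ^ 2); split; [easy|].
intros s; pose proof (pow2_ge_0 s) as hs.
assert (he1 : 1 <= exp (a * Rabs s)).
{ rewrite <- exp_0; apply exp_monotone, Rmult_le_pos; [lra | apply Rabs_pos]. }
destruct (Rlt_dec (Rabs s) d) as [hsd|hsd].
- apply Rle_trans with eps; [apply Rlt_le, H; now rewrite Rminus_0_r|].
  assert (0 <= (K + 1) * norm x / d ^ 2 * s ^ 2) by now apply Rmult_le_pos.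
  nra.
- apply Rle_trans with ((K + 1) * norm x * exp (a * Rabs s)).
  + apply Rle_trans with (1 := vnorm_minus _ _).
    pose proof (wg_norm wg s x). nra.
  + apply Rmult_le_compat_r; [lra|].
    assert (hd2 : d ^ 2 <= s ^ 2).
    { rewrite <- (pow2_abs s); apply pow_incr; lra. }
    assert (hq : (K + 1) * norm x <= (K + 1) * norm x / d ^ 2 * s ^ 2).
    { pose proof (pow_lt d 2 hd).
      replace ((K + 1) * norm x) with ((K + 1) * norm x / d ^ 2 * d ^ 2) at 1
        by (field; lra).
      now apply Rmult_le_compat_l. }
    lra.
Qed.

(** After normalization [sg z x - x] is the average of [W s x - x], up to the factor
    [exp (- mu z)]. *)
Lemma sg_limit x eps : 0 < eps -> exists d, 0 < d /\ forall z,
  in_cone z -> Cmod z < d -> norm (minus (sg z x) x) <= eps.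
Proof.
intros he; destruct smear_cone_bound as [M [hM H]].
pose proof mass_factor_pos as hm; pose proof (vnorm_ge_0 x) as hx.
set (e1 := eps / (4 * mass_factor * M)).
assert (he1 : 0 < e1).
{ apply Rdiv_lt_0_compat; [easy | repeat apply Rmult_lt_0_compat; lra]. }
destruct (orbit_modulus x e1 he1) as [L [hL HL]].
set (q := mass_factor * M * L + mu * norm x + 1).
assert (hq0 : 0 <= mass_factor * M * L) by (repeat apply Rmult_le_pos; lra).
assert (hq1 : 0 <= mu * norm x) by (apply Rmult_le_pos; lra).
assert (hq : 0 < q) by (unfold q; lra).
exists (Rmin 1 (eps / (2 * q))); split.
{ apply Rmin_pos; [lra | apply Rdiv_lt_0_compat; lra]. }
intros z hz hzd; apply Rmin_Rgt in hzd as [hz1 hz2].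
pose proof (in_cone_Cmod z hz) as hr.
destruct (heat_kernel_decay (a := a) 0 (Rle_refl 0) z (proj1 hz)) as [M1 [hM1 [d0 _]]].
set (D := line_int (fun s => cs (heat 0 z s) (minus (W s x) x))).
assert (hD : norm D <= M * (e1 + L * Cmod z)).
{ apply H; auto; try lra.
  intros s; apply (continuous_minus (V := V));
    [apply (wg_cont wg) | apply continuous_const]. }
assert (ED : HO 0 z x = plus (cs heat_mass x) D).
{ assert (dx : exp_decay 1 (M1 * norm x) (fun s => cs (heat 0 z s) x)).
  { apply (kernel_decay_growth wg); [easy | intros; apply continuous_const |].
    intros s; pose proof (exp_ineq1_le (a * Rabs s)).
    assert (0 <= a * Rabs s) by (apply Rmult_le_pos;
      [apply Rlt_le, (wg_a wg) | apply Rabs_pos]). nra. }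
  assert (dd : exp_decay 1 (M1 * (e1 + L + (K + 1) * norm x))
    (fun s => cs (heat 0 z s) (minus (W s x) x))).
  { pose proof (wg_K wg) as hK.
    apply (kernel_decay_growth wg); [easy | |].
    - intros s; apply (continuous_minus (V := V));
        [apply (wg_cont wg) | apply continuous_const].
    - intros s; apply Rle_trans with (1 := vnorm_minus _ _).
      pose proof (wg_norm wg s x).
      assert (1 <= exp (a * Rabs s)).
      { rewrite <- exp_0; apply exp_monotone, Rmult_le_pos;
          [apply Rlt_le, (wg_a wg) | apply Rabs_pos]. }
      nra. }
  rewrite <- (heat_mass_const z (proj1 hz)).
  rewrite <- (line_int_linear (U := CR) (fun c => cs c x) (a + 1) M1);
    [|apply csl' | pose proof (wg_a wg); lra | exact d0].
  unfold D; rewrite <- (line_int_plus 1 _ _ _ _ Rlt_0_1 dx dd).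
  apply line_int_ext; intros s.
  rewrite (linear_minus _ _ _ (csl _)); module_eq V. }
set (w := (RtoC (- mu) * z)%C).
assert (E : minus (sg z x) x =
  plus (cs (cexp w - 1)%C x) (cs (cexp w * / heat_mass)%C D)).
{ rewrite sg_mu, ED, (linear_plus _ (csl _)), (wg_cs_mul wg) by apply hz.
  fold w.
  replace (cexp w * / heat_mass * heat_mass)%C with (cexp w)
    by (rewrite <- Cmult_assoc, Cinv_l, Cmult_1_r by apply heat_mass_neq_0; easy).
  pose proof (linear_minus _ (cexp w : CR) (RtoC 1 : CR) (csl' x)) as e2.
  change (cs (cexp w - 1)%C x = minus (cs (cexp w) x) (cs (RtoC 1) x)) in e2.
  rewrite e2, (wg_cs_real wg); module_eq V. }
rewrite E; apply Rle_trans with (1 := vnorm_plus _ _).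
assert (h1 : norm (cs (cexp w - 1)%C x) <= mu * Cmod z * norm x).
{ apply Rle_trans with (1 := wg_cs_norm wg _ _).
  apply Rmult_le_compat_r; [easy|].
  apply Rle_trans with (Cmod w).
  - apply Cmod_cexp_minus_1; unfold w; destruct z as [u v], hz; simpl in *; nra.
  - unfold w; rewrite Cmod_mult, Cmod_R, Rabs_Ropp, Rabs_right by lra; apply Rle_refl. }
assert (h2 : norm (cs (cexp w * / heat_mass)%C D) <=
  mass_factor * (M * (e1 + L * Cmod z))).
{ apply Rle_trans with (1 := wg_cs_norm wg _ _).
  rewrite Cmod_mult; fold mass_factor.
  pose proof (Cmod_decay_factor z (proj1 hz)) as hc; fold w in hc.
  apply Rmult_le_compat; [| apply vnorm_ge_0 | | easy].
  - apply Rmult_le_pos; [apply Cmod_ge_0 | lra].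
  - rewrite <- (Rmult_1_l mass_factor) at 2; apply Rmult_le_compat_r; lra. }
assert (h3 : mass_factor * M * e1 = eps / 4) by (unfold e1; field; lra).
assert (h4 : (mass_factor * M * L + mu * norm x) * Cmod z <= eps / 2).
{ apply Rle_trans with (q * (eps / (2 * q))); [|right; field; lra].
  apply Rmult_le_compat; unfold q in *; lra. }
lra.
Qed.

(** Along [s |-> sg (z + w - s w) (sg (s w) x)] the derivative vanishes, because
    [sg' z y = sg z (G y)] on the domain of the generator. *)
Lemma sg_add (z w : C) x : in_cone z -> in_cone w -> sg (z + w)%C x = sg z (sg w x).
Proof.
intros hz hw.
pose proof (proj1 hz) as rz; pose proof (proj1 hw) as rw.
set (phi := fun s => sg (z + w + RtoC s * - w)%C (sg (0 + RtoC s * w)%C x)).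
assert (re1 : forall s, 0 < s <= 1 -> 0 < fst (0 + RtoC s * w)%C).
{ intros s hs; destruct w; simpl in *; nra. }
assert (re2 : forall s, 0 <= s <= 1 -> fst z <= fst (z + w + RtoC s * - w)%C).
{ intros s hs; destruct z, w; simpl in *; nra. }
destruct (sg_bound (fst z / 2) (Cmod z + 3 * Cmod w + 1)) as [M [hM HM]].
{ lra. }
{ pose proof (Cmod_ge_0 z); pose proof (Cmod_ge_0 w); lra. }
assert (loc : forall s, 0 <= s <= 1 -> locally s (fun t =>
  is_linear (sg (z + w + RtoC t * - w)%C) /\
  forall y, norm (sg (z + w + RtoC t * - w)%C y) <= M * norm y)).
{ intros s hs.
  assert (hd : 0 < Rmin 1 (fst z / (2 * fst w))).
  { apply Rmin_pos; [lra | apply Rdiv_lt_0_compat; lra]. }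
  exists (mkposreal _ hd); intros t ht.
  change (Rabs (t - s) < Rmin 1 (fst z / (2 * fst w))) in ht.
  apply Rmin_Rgt in ht as [ht1 ht2].
  assert (r : fst z / 2 <= fst (z + w + RtoC t * - w)%C).
  { apply Rgt_lt in ht2.
    apply Rmult_lt_compat_r with (r := fst w) in ht2; [|easy].
    replace (fst z / (2 * fst w) * fst w) with (fst z / 2) in ht2 by (field; lra).
    pose proof (Rle_abs (t - s)).
    destruct z, w; simpl in *; nra. }
  split; [apply sg_linear; lra|].
  intros y; apply HM; [easy|].
  apply Rle_trans with (1 := Cmod_triangle _ _).
  pose proof (Cmod_triangle z w); pose proof (Cmod_ge_0 w).
  rewrite Cmod_mult, Cmod_R, Cmod_opp.
  assert (Rabs t <= 2).
  { replace t with ((t - s) + s) by ring.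
    apply Rle_trans with (1 := Rabs_triang _ _).
    rewrite (Rabs_right s) by lra; lra. }
  assert (Rabs t * Cmod w <= 2 * Cmod w) by (apply Rmult_le_compat_r; lra).
  lra. }
assert (cN : forall s y, 0 <= s <= 1 ->
  continuous (fun t => sg (z + w + RtoC t * - w)%C y) s).
{ intros s y hs; eapply is_derive_continuous, sg_derive.
  specialize (re2 s hs); lra. }
assert (dphi : forall s, 0 < s <= 1 -> is_derive phi s zero).
{ intros s hs; specialize (re1 s hs).
  assert (hs0 : 0 <= s <= 1) by lra; specialize (re2 s hs0).
  eapply is_derive_eq.
  - apply (is_derive_family (fun t => sg (z + w + RtoC t * - w)%C)
      (fun t => sg (0 + RtoC t * w)%C x) s M).
    + easy.
    + now apply loc.
    + apply sg_derive; lra.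
    + now apply sg_derive.
    + now apply cN.
  - rewrite sg_cs by lra.
    assert (hp : 0 < fst (z + w + RtoC s * - w)%C) by lra.
    rewrite (sg_of_gen _ _ _ hp (sg_gen _ x re1)).
    change (cs (- w)%C) with (cs (opp (w : CR))).
    rewrite (linear_opp _ _ (csl' _)); module_eq V. }
assert (E1 : phi 1 = sg z (sg w x)).
{ unfold phi; f_equal; [|f_equal]; ring. }
assert (Z : minus (sg z (sg w x)) (sg (z + w)%C x) = zero).
{ apply vnorm_eq_0, le_epsilon; intros eps he; rewrite Rplus_0_l.
  destruct (proj1 (continuous_norm_iff _ _) (cN 0 x ltac:(lra)) (eps / 2))
    as [d1 [hd1 H1]]; [lra|].
  destruct (sg_limit x (eps / (2 * M))) as [d2 [hd2 H2]].
  { apply Rdiv_lt_0_compat; lra. }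
  pose proof (in_cone_Cmod w hw) as hwp.
  set (e := Rmin (1 / 2) (Rmin (d1 / 2) (d2 / (2 * Cmod w)))).
  assert (he0 : 0 < e).
  { repeat apply Rmin_pos; try lra; apply Rdiv_lt_0_compat; lra. }
  assert (he1 : e <= 1 / 2) by apply Rmin_l.
  assert (he2 : e <= d1 / 2) by
    (eapply Rle_trans; [apply Rmin_r | apply Rmin_l]).
  assert (he3 : e <= d2 / (2 * Cmod w)) by
    (eapply Rle_trans; [apply Rmin_r | apply Rmin_r]).
  rewrite <- E1, <- (eq_is_derive phi e 1) by (try lra; intros; apply dphi; lra).
  assert (he' : 0 <= e <= 1) by lra.
  destruct (loc e he') as [dd Hd].
  destruct (Hd e (ball_center (e : R_UniformSpace) dd)) as [lN bN].
  specialize (H1 e ltac:(rewrite Rminus_0_r, Rabs_right; lra)).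
  replace (z + w + RtoC 0 * - w)%C with (z + w)%C in H1 by ring.
  assert (H2' : norm (minus (sg (0 + RtoC e * w)%C x) x) <= eps / (2 * M)).
  { rewrite Cplus_0_l; apply H2; [now apply in_cone_scal|].
    rewrite Cmod_mult, Cmod_R, Rabs_right by lra.
    apply Rmult_le_compat_r with (r := Cmod w) in he3; [|lra].
    replace (d2 / (2 * Cmod w) * Cmod w) with (d2 / 2) in he3 by (field; lra). lra. }
  unfold phi.
  match goal with |- norm (minus ?X ?Y) <= _ => replace (minus X Y) with
    (plus (sg (z + w + RtoC e * - w)%C (minus (sg (0 + RtoC e * w)%C x) x))
       (minus (sg (z + w + RtoC e * - w)%C x) Y))
    by (rewrite (linear_minus _ _ _ lN); module_eq V) end.
  apply Rle_trans with (1 := vnorm_plus _ _).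
  specialize (bN (minus (sg (0 + RtoC e * w)%C x) x)).
  assert (k : M * norm (minus (sg (0 + RtoC e * w)%C x) x) <= M * (eps / (2 * M)))
    by (apply Rmult_le_compat_l; lra).
  replace (M * (eps / (2 * M))) with (eps / 2) in k by (field; lra). lra. }
transitivity (minus (sg z (sg w x)) (minus (sg z (sg w x)) (sg (z + w)%C x)));
  [module_eq V|].
rewrite Z; module_eq V.
Qed.

(** * The generator *)

(** [B x] is recovered boundedly from [x] and [B (B x)] by expanding the orbit to
    second order; hence the square of [B] is closed. *)
Lemma gen_square_closed x y :
  (forall eps, 0 < eps -> exists x' y', G x' y' /\
     norm (minus x' x) <= eps /\ norm (minus y' y) <= eps) -> G x y.
Proof.
intros h.
pose proof (wg_K wg) as hK; pose proof (wg_a wg) as ha.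
set (N := fun s x => RInt (fun r => W r x) 0 s).
set (bd := K * exp a).
assert (hbd : 0 < bd) by (apply Rmult_lt_0_compat; [easy | apply exp_pos]).
assert (bW : forall s x, Rabs s <= 1 -> norm (W s x) <= bd * norm x).
{ intros s u hs; apply Rle_trans with (1 := wg_norm wg s u).
  apply Rmult_le_compat_r; [apply vnorm_ge_0|].
  apply Rmult_le_compat_l; [lra|]; apply exp_monotone; nra. }
assert (lN : forall s, is_linear (N s)).
{ intros s; apply (RInt_family_linear W s (K * exp (a * Rabs s))).
  - apply Rmult_le_pos; [lra | apply Rlt_le, exp_pos].
  - apply (wg_linear wg).
  - apply (wg_cont wg).
  - intros r u hr; apply Rle_trans with (1 := wg_norm wg r u).
    apply Rmult_le_compat_r; [apply vnorm_ge_0|].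
    apply Rmult_le_compat_l; [lra|]; apply exp_monotone, Rmult_le_compat_l; lra. }
assert (cN : forall x s, continuous (fun s => N s x) s).
{ intros u s; apply (continuous_RInt_cont (fun r => W r u)), (wg_cont wg). }
assert (bN : forall s x, Rabs s <= Rabs 1 -> norm (N s x) <= bd * norm x).
{ rewrite Rabs_R1; intros s u hs.
  apply Rle_trans with (bd * norm u * Rabs (s - 0)).
  - apply norm_RInt_bound; [apply (wg_cont wg)|].
    intros r hr; apply bW; revert hs hr.
    unfold Rmin, Rmax; destruct (Rle_dec 0 s); unfold Rabs;
      repeat destruct (Rcase_abs _); lra.
  - rewrite Rminus_0_r; pose proof (vnorm_ge_0 u).
    assert (0 <= bd * norm u) by (apply Rmult_le_pos; lra).
    pose proof (Rabs_pos s); nra. }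
(* Second order expansion: [W 1 x = x + B x + Phi (B (B x))]. *)
set (Phi := fun x => RInt (fun s => N s x) 0 1).
assert (lPhi : is_linear Phi) by
  (apply (RInt_family_linear N 1 bd); auto; lra).
destruct (linear_norm _ lPhi) as [m [hm Hm]].
set (first := fun x x2 => minus (minus (W 1 x) x) (Phi x2)).
assert (F : forall x x1 x2, B x x1 -> B x1 x2 -> x1 = first x x2).
{ intros u u1 u2 h1 h2; unfold first.
  rewrite (wg_orbit wg _ _ 1 h1).
  rewrite (RInt_ext _ (fun s => plus u1 (N s u2)))
    by (intros; now apply (wg_orbit wg)).
  rewrite RInt_plus_cont by (try apply cN; intros; apply continuous_const).
  rewrite RInt_const; fold (Phi u2).
  replace (1 - 0) with 1 by ring; module_eq V. }
set (x2 := plus y (scal mu x)).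
set (c := bd + 1 + m * (1 + mu)).
assert (hc : 0 < c).
{ unfold c; assert (0 <= m * (1 + mu)) by (apply Rmult_le_pos; lra). lra. }
assert (K0 : forall eps, 0 < eps -> exists x' x1' x2', B x' x1' /\ B x1' x2' /\
  norm (minus x' x) <= eps /\ norm (minus x1' (first x x2)) <= eps /\
  norm (minus x2' x2) <= eps).
{ intros eps he.
  set (e := Rmin (eps / c) (eps / (1 + mu))).
  assert (he0 : 0 < e) by (apply Rmin_pos; apply Rdiv_lt_0_compat; lra).
  assert (hec : e * c <= eps).
  { apply Rle_trans with (eps / c * c); [|right; field; lra].
    apply Rmult_le_compat_r; [lra | apply Rmin_l]. }
  assert (hem : e * (1 + mu) <= eps).
  { apply Rle_trans with (eps / (1 + mu) * (1 + mu)); [|right; field; lra].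
    apply Rmult_le_compat_r; [lra | apply Rmin_r]. }
  assert (hee : e <= eps) by nra.
  destruct (h e he0) as [x' [y' [[x1' [x2' [h1 [h2 hy]]]] [n1 n2]]]].
  exists x', x1', x2'.
  assert (n3 : norm (minus x2' x2) <= e * (1 + mu)).
  { replace (minus x2' x2) with (plus (minus y' y) (scal mu (minus x' x)))
      by (unfold x2; rewrite hy; module_eq V).
    apply Rle_trans with (1 := vnorm_plus _ _).
    pose proof (vnorm_scal mu (minus x' x)) as h3.
    rewrite Rabs_right in h3 by lra.
    assert (mu * norm (minus x' x) <= mu * e) by (apply Rmult_le_compat_l; lra).
    lra. }
  repeat split; try easy; try lra.
  rewrite (F x' x1' x2' h1 h2).
  replace (minus (first x' x2') (first x x2)) with
    (minus (minus (W 1 (minus x' x)) (minus x' x)) (Phi (minus x2' x2))).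
  - apply Rle_trans with (1 := vnorm_minus _ _).
    pose proof (vnorm_minus (W 1 (minus x' x)) (minus x' x)).
    pose proof (bW 1 (minus x' x) ltac:(rewrite Rabs_R1; lra)).
    pose proof (Hm (minus x2' x2)).
    assert (bd * norm (minus x' x) <= bd * e) by (apply Rmult_le_compat_l; lra).
    assert (m * norm (minus x2' x2) <= m * (e * (1 + mu)))
      by (apply Rmult_le_compat_l; lra).
    unfold c in hec; lra.
  - rewrite (linear_minus _ _ _ (wg_linear wg 1)),
      (linear_minus _ _ _ lPhi); unfold first; module_eq V. }
exists (first x x2), x2; repeat split.
- apply (wg_gen_closed wg); intros eps he.
  destruct (K0 eps he) as [x' [x1' [x2' [h1 [h2 [n1 [n2 n3]]]]]]]; now exists x', x1'.
- apply (wg_gen_closed wg); intros eps he.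
  destruct (K0 eps he) as [x' [x1' [x2' [h1 [h2 [n1 [n2 n3]]]]]]]; now exists x1', x2'.
- unfold x2; module_eq V.
Qed.

Lemma in_cone_real t : 0 < t -> in_cone (RtoC t).
Proof. intros h; split; simpl; [easy | rewrite Rabs_R0; lra]. Qed.

Lemma sg_derive_real x t : 0 < t ->
  is_derive (fun t => sg (RtoC t) x) t (sg' (RtoC t) x).
Proof.
intros ht; apply is_derive_ext with (fun t => sg (0 + RtoC t * RtoC 1)%C x).
{ intros s; f_equal; ring. }
eapply is_derive_eq; [apply sg_derive; simpl; lra|].
rewrite (wg_cs_real wg).
replace (0 + RtoC t * RtoC 1)%C with (RtoC t) by ring; module_eq V.
Qed.

Definition right_derivative (x y : V) : Prop :=
  forall eps, 0 < eps -> exists d, 0 < d /\ forall t, 0 < t < d ->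
    norm (minus (scal (/ t) (minus (sg (RtoC t) x) x)) y) <= eps.

(** On the domain the derivative at time [r] is [sg r y], which is close to [y]. *)
Lemma gen_right_derivative x y : G x y -> right_derivative x y.
Proof.
intros h eps he.
destruct (sg_limit y eps he) as [d [hd Hd]].
exists d; split; [easy|]; intros t ht.
assert (K0 : norm (minus (minus (sg (RtoC t) x) x) (scal t y)) <= t * eps).
{ apply le_epsilon; intros e hpos.
  destruct (sg_limit x (e / 2)) as [d1 [hd1 Hd1]]; [lra|].
  pose proof (vnorm_ge_0 y) as hy.
  set (s := Rmin (t / 2) (Rmin (d1 / 2) (e / (2 * (norm y + 1))))).
  assert (hs0 : 0 < s).
  { repeat apply Rmin_pos; try lra; apply Rdiv_lt_0_compat; lra. }
  assert (hs1 : s <= t / 2) by apply Rmin_l.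
  assert (hs2 : s <= d1 / 2) by
    (eapply Rle_trans; [apply Rmin_r | apply Rmin_l]).
  assert (hs3 : s <= e / (2 * (norm y + 1))) by
    (eapply Rle_trans; [apply Rmin_r | apply Rmin_r]).
  assert (hs4 : s * norm y <= e / 2).
  { apply Rle_trans with (e / (2 * (norm y + 1)) * (norm y + 1)).
    - apply Rmult_le_compat; lra.
    - right; field; lra. }
  pose proof (Hd1 (RtoC s) (in_cone_real s hs0)
    ltac:(rewrite Cmod_R, Rabs_right; lra)) as k1.
  assert (k2 : norm (minus (minus (sg (RtoC t) x) (scal t y))
    (minus (sg (RtoC s) x) (scal s y))) <= (t - s) * eps).
  { apply (mean_value_ineq V (fun r => minus (sg (RtoC r) x) (scal r y))
      (fun r => minus (sg (RtoC r) y) y)); [lra | | |].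
    - intros r hr; apply (is_derive_minus (V := V)).
      + rewrite (sg_of_gen (RtoC r) x y) by (simpl; lra || easy).
        apply sg_derive_real; lra.
      + eapply is_derive_eq.
        * apply (is_derive_scal_l (V := V) (fun r => r)), is_derive_id.
        * apply (scal_one (V := V)).
    - intros r hr; apply (continuous_minus (V := V)); [|apply continuous_const].
      eapply is_derive_continuous, sg_derive_real; lra.
    - intros r hr; apply Hd; [apply in_cone_real; lra|].
      rewrite Cmod_R, Rabs_right; lra. }
  replace (minus (minus (sg (RtoC t) x) x) (scal t y)) with
    (plus (minus (minus (sg (RtoC t) x) (scal t y)) (minus (sg (RtoC s) x) (scal s y)))
       (minus (minus (sg (RtoC s) x) x) (scal s y))) by module_eq V.
  apply Rle_trans with (1 := vnorm_plus _ _).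
  pose proof (vnorm_minus (minus (sg (RtoC s) x) x) (scal s y)) as k3.
  pose proof (vnorm_scal s y) as k4; rewrite Rabs_right in k4 by lra.
  assert (0 <= s * eps) by (apply Rmult_le_pos; lra). lra. }
replace (minus (scal (/ t) (minus (sg (RtoC t) x) x)) y) with
  (scal (/ t) (minus (minus (sg (RtoC t) x) x) (scal t y))).
- apply Rle_trans with (1 := vnorm_scal _ _).
  assert (hi : 0 < / t) by (apply Rinv_0_lt_compat; lra).
  rewrite Rabs_right by lra.
  apply Rle_trans with (/ t * (t * eps)); [apply Rmult_le_compat_l; lra|].
  right; field; lra.
- module_eq V; field; lra.
Qed.

(** The semigroup maps into the domain, and there the generator gives [sg t y] by
    differentiating [sg (t + r) x] in [r]; letting [t] tend to zero uses that the
    square is closed. *)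
Lemma right_derivative_gen x y : right_derivative x y -> G x y.
Proof.
intros h.
assert (E : forall t, 0 < t -> sg (RtoC t) y = sg' (RtoC t) x).
{ intros t ht.
  assert (hz : 0 < fst (RtoC t)) by easy.
  destruct (linear_norm _ (sg_linear _ hz)) as [m [hm Hm]].
  assert (Z : minus (sg (RtoC t) y) (sg' (RtoC t) x) = zero).
  { apply vnorm_eq_0, le_epsilon; intros eps he; rewrite Rplus_0_l.
    destruct (proj1 (is_derive_norm_iff _ _ _) (sg_derive_real x t ht) (eps / 2))
      as [d1 [hd1 H1]]; [lra|].
    destruct (h (eps / (2 * m))) as [d2 [hd2 H2]]; [apply Rdiv_lt_0_compat; lra|].
    set (r := Rmin d1 d2 / 2).
    pose proof (Rmin_l d1 d2); pose proof (Rmin_r d1 d2).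
    assert (hr : 0 < Rmin d1 d2) by now apply Rmin_pos.
    specialize (H1 (t + r)); specialize (H2 r ltac:(unfold r; lra)).
    replace (t + r - t) with r in H1 by ring.
    rewrite Rabs_right in H1 by (unfold r; lra).
    specialize (H1 ltac:(unfold r; lra)).
    assert (hr0 : 0 < r) by (unfold r; lra).
    rewrite RtoC_plus, (sg_add _ _ x (in_cone_real t ht) (in_cone_real r hr0)) in H1.
    set (q := minus (scal (/ r) (minus (sg (RtoC r) x) x)) y) in *.
    replace (minus (sg (RtoC t) y) (sg' (RtoC t) x)) with
      (minus (scal (/ r) (minus (minus (sg (RtoC t) (sg (RtoC r) x)) (sg (RtoC t) x))
         (scal r (sg' (RtoC t) x)))) (sg (RtoC t) q)).
    - apply Rle_trans with (1 := vnorm_minus _ _).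
      pose proof (Hm q) as k1.
      assert (k2 : m * norm q <= m * (eps / (2 * m))) by (apply Rmult_le_compat_l; lra).
      replace (m * (eps / (2 * m))) with (eps / 2) in k2 by (field; lra).
      match goal with |- norm (scal ?u ?v) + _ <= _ =>
        pose proof (vnorm_scal u v) as k3; set (v0 := v) in * end.
      assert (hi : 0 < / r) by now apply Rinv_0_lt_compat.
      rewrite Rabs_right in k3 by lra.
      assert (k4 : / r * norm v0 <= / r * (eps / 2 * r))
        by (apply Rmult_le_compat_l; [lra | exact H1]).
      replace (/ r * (eps / 2 * r)) with (eps / 2) in k4 by (field; lra). lra.
    - unfold q; rewrite (linear_minus _ _ _ (sg_linear _ hz)),
        (linear_scal _ (sg_linear _ hz)), (linear_minus _ _ _ (sg_linear _ hz)).
      module_eq V; field; lra. }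
  transitivity (plus (minus (sg (RtoC t) y) (sg' (RtoC t) x)) (sg' (RtoC t) x));
    [module_eq V|].
  rewrite Z; module_eq V. }
apply gen_square_closed; intros eps he.
destruct (sg_limit x eps he) as [d1 [hd1 H1]].
destruct (sg_limit y eps he) as [d2 [hd2 H2]].
set (t := Rmin d1 d2 / 2).
pose proof (Rmin_l d1 d2); pose proof (Rmin_r d1 d2).
assert (hr : 0 < Rmin d1 d2) by now apply Rmin_pos.
assert (ht : 0 < t) by (unfold t; lra).
exists (sg (RtoC t) x), (sg' (RtoC t) x); repeat split.
- now apply sg_gen.
- apply H1; [now apply in_cone_real|].
  rewrite Cmod_R, Rabs_right; unfold t; lra.
- rewrite <- E by easy; apply H2; [now apply in_cone_real|].
  rewrite Cmod_R, Rabs_right; unfold t; lra.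
Qed.
End Semigroup.

(** * Translations, reflection and the drift *)

Notation PV := Per_CompleteNormedModule.

Lemma continuous_affine (f : R -> C) (k c x : R) :
  (forall x, continuous f x) -> continuous (fun x => f (k * x + c)) x.
Proof.
intros hf; apply (continuous_comp (fun x => k * x + c) f); [|apply hf].
apply (ex_derive_continuous (V := R_NormedModule)); auto_derive; easy.
Qed.

Definition transl (t : R) (f : Per) : Per.
Proof.
refine (mkPer (fun x => f (1 * x + t)) _ _).
- intros x; apply continuous_affine, per_cont.
- intros x; rewrite <- (per_period f (1 * x + t)); f_equal; ring.
Defined.

Definition refl (f : Per) : Per.
Proof.
refine (mkPer (fun x => f (-1 * x + 0)) _ _).
- intros x; apply continuous_affine, per_cont.
- intros x; rewrite <- (per_period f (-1 * (x + 2) + 0)); f_equal; ring.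
Defined.

Definition per_mult (q f : Per) : Per.
Proof.
refine (mkPer (fun x => q x * f x)%C _ _).
- intros x; apply continuous_Cmult; apply per_cont.
- intros x; cbn beta; now rewrite !per_period.
Defined.

Definition cscal (c : C) (f : Per) : Per.
Proof.
refine (mkPer (fun x => c * f x)%C _ _).
- intros x; apply continuous_Cmult; [apply continuous_const | apply per_cont].
- intros x; cbn beta; now rewrite !per_period.
Defined.

Lemma transl_apply t f x : transl t f x = f (x + t).
Proof. simpl; f_equal; ring. Qed.

Lemma refl_apply f x : refl f x = f (- x).
Proof. simpl; f_equal; ring. Qed.

Lemma per_plus_apply (f g : Per) x : (plus f g : Per) x = (f x + g x)%C.
Proof. reflexivity. Qed.

Lemma per_opp_apply (f : Per) x : (opp f : Per) x = (- f x)%C.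
Proof. reflexivity. Qed.

Lemma per_minus_apply (f g : Per) x : (minus f g : Per) x = (f x - g x)%C.
Proof. reflexivity. Qed.

Lemma per_scal_apply (r : R) (f : Per) x : (scal r f : Per) x = (RtoC r * f x)%C.
Proof. apply scal_C. Qed.

Lemma per_zero_apply x : (zero : Per) x = RtoC 0.
Proof. reflexivity. Qed.

Lemma per_mult_apply (q f : Per) x : per_mult q f x = (q x * f x)%C.
Proof. reflexivity. Qed.

Lemma cscal_apply c (f : Per) x : cscal c f x = (c * f x)%C.
Proof. reflexivity. Qed.

Lemma per_norm_bound (f : Per) x : Cmod (f x) <= norm f.
Proof. apply per_norm_ub. Qed.

Lemma per_norm_intro (f : Per) M : (forall x, Cmod (f x) <= M) -> norm f <= M.
Proof. apply per_norm_le. Qed.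

Lemma per_norm_ge_0 (f : Per) : 0 <= norm f.
Proof. apply (vnorm_ge_0 (V := Per_CompleteNormedModule)). Qed.

Lemma per_norm_minus (f g : Per) : norm (minus f g) <= norm f + norm g.
Proof. apply (vnorm_minus (V := Per_CompleteNormedModule)). Qed.

Lemma per_norm_scal_le (r : R) (f : Per) : norm (scal r f) <= Rabs r * norm f.
Proof. apply per_norm_scal. Qed.

Lemma per_linear_intro (l : Per -> Per) M : 0 < M ->
  (forall f g, l (plus f g) = plus (l f) (l g)) ->
  (forall r f, l (scal r f) = scal r (l f)) ->
  (forall f, norm (l f) <= M * norm f) -> is_linear l.
Proof. intros hM h1 h2 h3; split; [easy | easy | now exists M]. Qed.

Lemma per_mult_linear q : is_linear (per_mult q).
Proof.
apply (per_linear_intro _ (norm q + 1)).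
- pose proof (per_norm_ge_0 q); lra.
- intros f g; apply Per_ext; intros x; rewrite per_plus_apply; simpl.
  change (q x * (f x + g x) = q x * f x + q x * g x)%C; ring.
- intros r f; apply Per_ext; intros x; rewrite per_scal_apply.
  change (q x * (scal r f : Per) x = r * (q x * f x))%C; rewrite per_scal_apply; ring.
- intros f; apply per_norm_intro; intros x; simpl; rewrite Cmod_mult.
  apply Rmult_le_compat; try apply Cmod_ge_0; [|apply per_norm_bound].
  pose proof (per_norm_bound q x); lra.
Qed.

Lemma cscal_norm c f : norm (cscal c f) <= Cmod c * norm f.
Proof.
apply per_norm_intro; intros x; simpl; rewrite Cmod_mult.
apply Rmult_le_compat_l; [apply Cmod_ge_0 | apply per_norm_bound].
Qed.

Lemma cscal_linear c : is_linear (cscal c).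
Proof.
apply (per_linear_intro _ (Cmod c + 1)).
- pose proof (Cmod_ge_0 c); lra.
- intros f g; apply Per_ext; intros x; rewrite per_plus_apply.
  change (c * (f x + g x) = c * f x + c * g x)%C; ring.
- intros r f; apply Per_ext; intros x; rewrite per_scal_apply.
  change (c * (scal r f : Per) x = r * (c * f x))%C; rewrite per_scal_apply; ring.
- intros f; apply Rle_trans with (1 := cscal_norm c f).
  pose proof (per_norm_ge_0 f); nra.
Qed.

Lemma cscal_linear_l f : is_linear (U := CR) (fun c => cscal c f).
Proof.
split.
- intros c d; apply Per_ext; intros x; rewrite per_plus_apply.
  change ((c + d) * f x = c * f x + d * f x)%C; ring.
- intros r c; apply Per_ext; intros x; rewrite per_scal_apply.
  change (@scal _ C_R_NormedModule r c * f x = r * (c * f x))%C; rewrite scal_C; ring.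
- exists (norm f + 1); split; [pose proof (per_norm_ge_0 f); lra|].
  intros c; apply Rle_trans with (1 := cscal_norm c f).
  rewrite Rmult_comm.
  apply Rle_trans with ((norm f + 1) * Cmod c).
  + apply Rmult_le_compat_r; [apply Cmod_ge_0 | lra].
  + right; f_equal; symmetry; apply norm_C.
Qed.

Lemma transl_norm t f : norm (transl t f) <= norm f.
Proof. apply per_norm_intro; intros x; exact (per_norm_bound f _). Qed.

Lemma transl_linear t : is_linear (transl t).
Proof.
apply (per_linear_intro _ 1); [lra | | |].
- intros f g; now apply Per_ext.
- intros r f; now apply Per_ext.
- intros f; rewrite Rmult_1_l; apply transl_norm.
Qed.

Lemma refl_norm f : norm (refl f) <= norm f.
Proof. apply per_norm_intro; intros x; exact (per_norm_bound f _). Qed.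

Lemma refl_linear : is_linear refl.
Proof.
apply (per_linear_intro _ 1); [lra | | |].
- intros f g; now apply Per_ext.
- intros r f; now apply Per_ext.
- intros f; rewrite Rmult_1_l; apply refl_norm.
Qed.

Lemma transl_0 f : transl 0 f = f.
Proof. apply Per_ext; intros x; rewrite transl_apply; f_equal; ring. Qed.

Lemma transl_add s t f : transl (s + t) f = transl s (transl t f).
Proof. apply Per_ext; intros x; rewrite !transl_apply; f_equal; ring. Qed.

Lemma refl_transl t f : refl (transl t f) = transl (-1 * t) (refl f).
Proof.
apply Per_ext; intros x; rewrite refl_apply, !transl_apply, refl_apply; f_equal; ring.
Qed.

Lemma per_uniformly_continuous (f : Per) eps : 0 < eps -> exists d, 0 < d /\
  forall x y, Rabs (y - x) < d -> Cmod (f y - f x)%C < eps.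
Proof.
intros he.
destruct (unifcont_normed_1d (V := C_R_NormedModule) f (-2) 2
  (fun x _ => per_cont f x) (mkposreal eps he)) as [d Hd].
exists (Rmin d 1); split; [apply Rmin_pos; [apply cond_pos | lra]|].
intros x y hxy; apply Rmin_Rgt in hxy as [h1 h2].
destruct (period_reduce x) as [k hk].
rewrite <- (per_shift f (- k) x), <- (per_shift f (- k) y), opp_IZR.
apply Rgt_lt in h1; apply Rgt_lt in h2.
pose proof (Rle_abs (y - x)); pose proof (Rle_abs (- (y - x))) as h3.
rewrite Rabs_Ropp in h3.
apply Rle_lt_trans with (1 := Req_le _ _ (eq_sym (norm_C _))).
apply Hd; [lra | lra |].
change (Rabs (y + 2 * - IZR k - (x + 2 * - IZR k)) < d).
replace (y + 2 * - IZR k - (x + 2 * - IZR k)) with (y - x) by ring; easy.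
Qed.

Lemma transl_cont f t : continuous (fun t => transl t f) t.
Proof.
apply (continuous_norm_iff (V := PV)); intros eps he.
destruct (per_uniformly_continuous f (eps / 2)) as [d [hd H]]; [lra|].
exists d; split; [easy|]; intros s hs.
apply Rle_lt_trans with (eps / 2); [|lra].
apply per_norm_intro; intros x; rewrite per_minus_apply, !transl_apply.
apply Rlt_le, H; now replace (x + s - (x + t)) with (s - t) by ring.
Qed.

Lemma eval_linear x : is_linear (U := Per_CompleteNormedModule) (V := CR)
  (fun f : Per => f x).
Proof.
split; [easy | easy |].
exists 1; split; [lra|]; intros f; rewrite Rmult_1_l.
apply Rle_trans with (1 := Req_le _ _ (norm_C (f x))), per_norm_bound.
Qed.

Lemma transl_gen_iff (f k : Per) :
  T_gen transl f k <-> forall x, is_derive_C f x (k x).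
Proof.
assert (E : forall t x, (plus f (RInt (fun s => transl s k) 0 t) : Per) x =
  (f x + RInt (V := CR) (fun s => k (1 * s + x)%R) 0 t)%C).
{ intros t x; rewrite per_plus_apply; f_equal.
  rewrite (linear_RInt (U := Per_CompleteNormedModule) (V := CR)
    (fun f : Per => f x)); [|apply eval_linear | apply transl_cont].
  apply (RInt_ext (V := CR)); intros s _; rewrite transl_apply; f_equal; ring. }
split.
- intros h x.
  assert (D : is_derive_C (fun t => f (1 * t + x)) 0 (k x)).
  { apply is_derive_ext with
      (fun t => f x + RInt (V := CR) (fun s => k (1 * s + x)%R) 0 t)%C.
    { intros t; rewrite <- E, <- h, transl_apply; f_equal; ring. }
    apply (is_derive_C_eq _ _ (0 + k (1 * 0 + x)%R)%C).
    - apply is_derive_Cplus; [apply (is_derive_const (V := C_R_NormedModule))|].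
      apply (is_derive_RInt_cont (V := CR) (fun s => k (1 * s + x))).
      intros s; apply continuous_affine, per_cont.
    - rewrite Cplus_0_l; f_equal; ring. }
  apply is_derive_ext with (fun y => f (1 * (1 * y + - x) + x)).
  { intros y; f_equal; ring. }
  apply (is_derive_eq (V := CR) _ _ (scal 1 (k x))); [|apply (scal_one (V := CR))].
  apply (is_derive_affine (V := CR) (fun t => f (1 * t + x)) 1 (- x) x).
  now replace (1 * x + - x) with 0 by ring.
- intros h t; apply Per_ext; intros x; rewrite E, transl_apply.
  rewrite (RInt_of_derive (V := CR) (fun s => f (1 * s + x))).
  + change (f (x + t)%R = f x + (f (1 * t + x)%R - f (1 * 0 + x)%R))%C.
    replace (1 * 0 + x) with x by ring; replace (1 * t + x) with (x + t) by ring.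
    ring.
  + intros s.
    apply (is_derive_eq (V := CR) _ _ (scal 1 (k (1 * s + x))));
      [|apply (scal_one (V := CR))].
    apply (is_derive_affine (V := CR)); apply h.
  + intros s; apply continuous_affine, per_cont.
Qed.

(** * The drift operator and its wave group *)

Section Drift.
Variable q : Per.
Hypothesis q_odd : refl q = opp q.

(** This term vanishes on even functions and multiplies odd ones by [q]: the sum of
    [d/dx] and [drift] maps even functions to odd ones and back, and its square is the
    second-order operator on the even ones. *)
Definition drift (f : Per) : Per := per_mult q (scal (/ 2) (minus f (refl f))).

Definition drift_bound : R := norm q + 1.

Lemma drift_apply f x : drift f x = (q x * (RtoC (/ 2) * (f x - f (- x)%R)))%C.
Proof.
unfold drift; now rewrite per_mult_apply, per_scal_apply, per_minus_apply, refl_apply.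
Qed.

Lemma drift_linear : is_linear drift.
Proof.
apply (is_linear_comp (fun f => scal (/ 2) (minus f (refl f))) (per_mult q));
  [|apply per_mult_linear].
apply (per_linear_intro _ 1); [lra | | |].
- intros f g; rewrite (linear_plus _ refl_linear); module_eq PV.
- intros r f; rewrite (linear_scal _ refl_linear); module_eq PV.
- intros f; apply Rle_trans with (1 := per_norm_scal_le _ _).
  rewrite Rabs_right by lra; pose proof (refl_norm f).
  apply Rle_trans with (/ 2 * (norm f + norm (refl f))); [|lra].
  apply Rmult_le_compat_l; [lra | apply per_norm_minus].
Qed.

Lemma drift_norm f : norm (drift f) <= drift_bound * norm f.
Proof.
apply per_norm_intro; intros x; unfold drift; rewrite per_mult_apply, Cmod_mult.
apply Rmult_le_compat; try apply Cmod_ge_0.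
- unfold drift_bound; pose proof (per_norm_bound q x); lra.
- apply Rle_trans with (1 := per_norm_bound _ x).
  apply Rle_trans with (1 := per_norm_scal_le _ _).
  rewrite Rabs_right by lra; pose proof (refl_norm f).
  apply Rle_trans with (/ 2 * (norm f + norm (refl f))); [|lra].
  apply Rmult_le_compat_l; [lra | apply per_norm_minus].
Qed.

Lemma drift_bound_pos : 0 < drift_bound.
Proof. unfold drift_bound; pose proof (per_norm_ge_0 q); lra. Qed.

(** Reflection reverses the group, because it changes the sign of the derivative and
    of the odd coefficient [q]. *)
Lemma refl_drift f : refl (drift f) = scal (-1) (drift (refl f)).
Proof.
apply Per_ext; intros x.
rewrite refl_apply, per_scal_apply, !drift_apply, !refl_apply.
assert (e : q (- x) = (- q x)%C).
{ rewrite <- refl_apply, q_odd; easy. }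
rewrite e; rewrite RtoC_m1.
ring.
Qed.

Definition wave : R -> Per -> Per :=
  perturbed transl drift drift_bound transl_linear transl_norm transl_cont
    drift_bound_pos drift_linear drift_norm.

Definition wave_gen : Per -> Per -> Prop := perturbed_gen transl drift.

Lemma cscal_commutes c t f : cscal c (transl t f) = transl (1 * t) (cscal c f).
Proof. rewrite Rmult_1_l; now apply Per_ext. Qed.

Lemma cscal_drift c f : cscal c (drift f) = scal 1 (drift (cscal c f)).
Proof.
apply Per_ext; intros x; rewrite per_scal_apply, cscal_apply, !drift_apply.
rewrite !cscal_apply; ring.
Qed.

Lemma wave_wave_group : wave_group cscal wave wave_gen 2 (2 * drift_bound).
Proof.
pose proof drift_bound_pos as hb.
split.
- apply cscal_linear.
- apply cscal_linear_l.
- apply cscal_norm.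
- intros c d f; apply Per_ext; intros x; rewrite !cscal_apply; ring.
- intros r f; apply Per_ext; intros x; now rewrite per_scal_apply.
- lra.
- lra.
- intros t; apply perturbed_linear.
- intros t f; apply perturbed_norm.
- intros f t; apply perturbed_cont.
- intros c t f; symmetry; rewrite <- (Rmult_1_l t) at 2.
  apply (perturbed_intertwine transl drift drift_bound) with (Q := cscal c);
    [ring | apply cscal_linear | apply cscal_commutes | apply cscal_drift].
- intros f; apply perturbed_0; apply transl_0.
- intros f t; apply perturbed_gen_RInt; auto using transl_0, transl_add.
- intros f g t; apply perturbed_gen_orbit; auto using transl_0, transl_add.
- intros c f g h.
  replace (cscal c g) with (scal 1 (cscal c g)) by module_eq PV.
  apply (perturbed_gen_intertwine transl drift) with (Q := cscal c) (sg := 1);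
    auto using transl_linear, transl_cont, drift_linear, transl_norm, cscal_linear,
      cscal_commutes, cscal_drift; ring.
- intros c M f M' g; apply perturbed_gen_line_int; auto using transl_linear,
    transl_cont, drift_linear, transl_norm.
- intros f g; apply (perturbed_gen_closed transl drift drift_bound); auto using
    transl_linear, transl_cont, drift_linear, transl_norm, drift_norm.
Qed.

Lemma refl_wave t f : refl (wave t f) = wave (- t) (refl f).
Proof.
replace (- t) with (-1 * t) by ring.
apply (perturbed_intertwine transl drift drift_bound) with (Q := refl);
  [ring | apply refl_linear | apply refl_transl | apply refl_drift].
Qed.

Lemma wave_gen_iff f h : wave_gen f h <->
  forall x, is_derive_C f x ((minus h (drift f) : Per) x).
Proof. apply transl_gen_iff. Qed.
End Drift.

(** * Even functions and the maximum principle *)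

Definition per_derive (f g : Per) : Prop :=
  forall x, is_derive_C f x (g x).

Lemma is_derive_C_unique (f : R -> C) x (l l' : C) :
  is_derive_C f x l -> is_derive_C f x l' ->
  l = l'.
Proof.
intros h h'; apply is_derive_C_iff in h as [h1 h2]; apply is_derive_C_iff in h' as [h1' h2'].
apply is_derive_unique in h1, h2, h1', h2'.
rewrite h1 in h1'; rewrite h2 in h2'.
destruct l, l'; simpl in *; congruence.
Qed.

Lemma per_derive_even f g : per_derive f g -> refl f = f -> refl g = opp g.
Proof.
intros h he; apply Per_ext; intros x; rewrite refl_apply, per_opp_apply.
assert (D : is_derive_C f x (- g (- x)%R)%C).
{ apply is_derive_ext with (fun y => f (-1 * y + 0)).
  { intros y; rewrite <- he at 2; easy. }
  apply (is_derive_C_eq _ _ (@scal _ C_R_NormedModule (-1) (g (- x)%R))).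
  - apply (is_derive_affine (V := CR)); replace (-1 * x + 0) with (- x) by ring; apply h.
  - rewrite scal_C; rewrite RtoC_m1.
    ring. }
rewrite (is_derive_C_unique _ _ _ _ (h x) D); ring.
Qed.

Section EvenDrift.
Variable q : Per.

Lemma drift_even f : refl f = f -> drift q f = zero.
Proof.
intros he; apply Per_ext; intros x.
rewrite drift_apply, <- refl_apply, he, per_zero_apply; ring.
Qed.

Lemma drift_odd f : refl f = opp f -> drift q f = per_mult q f.
Proof.
intros he; apply Per_ext; intros x.
rewrite drift_apply, <- refl_apply, he, per_opp_apply, per_mult_apply.
rewrite RtoC_inv by lra; field.
Qed.

(** The first factor acts on an even function, where the drift vanishes, and the second
    on an odd one, where it is multiplication by [q]. *)
Lemma gen_square_even mu f g : refl f = f ->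
  gen_square (B := wave_gen q) mu f g <->
  exists f1 f2, per_derive f f1 /\ per_derive f1 f2 /\
    g = minus (plus f2 (per_mult q f1)) (scal mu f).
Proof.
intros he; split.
- intros [f1 [f2 [h1 [h2 ->]]]].
  assert (d1 : per_derive f f1).
  { intros x; apply (is_derive_C_eq _ _ _ _ (proj1 (wave_gen_iff q f f1) h1 x)).
    rewrite drift_even, per_minus_apply, per_zero_apply by easy; ring. }
  pose proof (per_derive_even _ _ d1 he) as ho.
  exists f1, (minus f2 (per_mult q f1)); split; [easy | split].
  + intros x; apply (is_derive_C_eq _ _ _ _ (proj1 (wave_gen_iff q f1 f2) h2 x)).
    now rewrite drift_odd by easy.
  + module_eq PV.
- intros [f1 [f2 [d1 [d2 ->]]]].
  pose proof (per_derive_even _ _ d1 he) as ho.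
  exists f1, (plus f2 (per_mult q f1)); repeat split.
  + apply wave_gen_iff; intros x; apply (is_derive_C_eq _ _ _ _ (d1 x)).
    rewrite drift_even, per_minus_apply, per_zero_apply by easy; ring.
  + apply wave_gen_iff; intros x; apply (is_derive_C_eq _ _ _ _ (d2 x)).
    rewrite drift_odd, per_minus_apply, per_plus_apply by easy; ring.
Qed.

Hypothesis q_real : forall x, snd (q x) = 0.

Lemma second_derivative_test (f f1 : R -> R) (x0 d : R) :
  (forall x, is_derive f x (f1 x)) -> is_derive f1 x0 d ->
  (forall x, f x <= f x0) -> f1 x0 = 0 /\ d <= 0.
Proof.
intros h1 h2 hm.
assert (mvt : forall a b, a < b -> exists c, f b - f a = f1 c * (b - a) /\ a < c < b).
{ intros a b hab; apply MVT_cor2; [easy|]; intros c _; now apply is_derive_Reals. }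
assert (right : forall e, 0 < e -> ~ (forall x, x0 < x < x0 + e -> 0 < f1 x)).
{ intros e he hp; destruct (mvt x0 (x0 + e / 2)) as [c [E hc]]; [lra|].
  specialize (hp c ltac:(lra)); specialize (hm (x0 + e / 2)).
  pose proof (Rmult_lt_0_compat _ _ hp (ltac:(lra) : 0 < x0 + e / 2 - x0)); lra. }
assert (left : forall e, 0 < e -> ~ (forall x, x0 - e < x < x0 -> f1 x < 0)).
{ intros e he hp; destruct (mvt (x0 - e / 2) x0) as [c [E hc]]; [lra|].
  specialize (hp c ltac:(lra)); specialize (hm (x0 - e / 2)).
  pose proof (Rmult_lt_0_compat (- f1 c) (x0 - (x0 - e / 2))); lra. }
assert (c1 : forall eps, 0 < eps -> exists e, 0 < e /\
  forall x, Rabs (x - x0) < e -> Rabs (f1 x - f1 x0) < eps).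
{ apply (continuous_norm_iff (V := R_CompleteNormedModule)).
  now apply (is_derive_continuous (V := R_CompleteNormedModule)) with d. }
assert (z : f1 x0 = 0).
{ destruct (Rtotal_order (f1 x0) 0) as [h|[h|h]]; [exfalso | easy | exfalso].
  - destruct (c1 (- f1 x0) ltac:(lra)) as [e [he He]].
    apply (left e he); intros x hx; specialize (He x).
    rewrite Rabs_left in He by lra; specialize (He ltac:(lra)).
    apply Rabs_lt_between in He; lra.
  - destruct (c1 (f1 x0) ltac:(lra)) as [e [he He]].
    apply (right e he); intros x hx; specialize (He x).
    rewrite Rabs_right in He by lra; specialize (He ltac:(lra)).
    apply Rabs_lt_between in He; lra. }
split; [easy|].
destruct (Rle_dec d 0) as [h|h]; [easy | exfalso].
destruct (proj1 (is_derive_norm_iff (V := R_CompleteNormedModule) f1 x0 d) h2 (d / 2))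
  as [e [he He]]; [lra|].
apply (right e he); intros x hx; specialize (He x).
rewrite Rabs_right in He by lra; specialize (He ltac:(lra)).
change (Rabs ((f1 x - f1 x0) - (x - x0) * d) <= d / 2 * (x - x0)) in He.
rewrite z in He; apply Rabs_le_between in He.
assert (0 < d * (x - x0)) by (apply Rmult_lt_0_compat; lra). lra.
Qed.

Lemma per_max (f : Per) : exists x0, norm f = Cmod (f x0) /\
  forall x, Cmod (f x) <= Cmod (f x0).
Proof.
destruct (continuity_ab_maj (fun x => Cmod (f x)) (-1) 1) as [m [hm _]].
- lra.
- intros c _; apply continuity_pt_filterlim.
  apply (continuous_norm_iff (V := R_CompleteNormedModule)); intros eps he.
  destruct (proj1 (continuous_R_Cmod f c) (per_cont f c) eps he) as [d [hd H]].
  exists d; split; [easy|]; intros y hy.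
  apply Rle_lt_trans with (2 := H y hy).
  apply (norm_triangle_inv (V := C_NormedModule)).
- assert (M : forall x, Cmod (f x) <= Cmod (f m)).
  { intros x; destruct (period_reduce x) as [k hk].
    replace x with ((x - 2 * IZR k) + 2 * IZR k) by ring.
    rewrite per_shift; apply hm; lra. }
  exists m; split; [|easy].
  apply Rle_antisym; [now apply per_norm_intro | apply per_norm_bound].
Qed.

(** At a point where [|f|] is largest, [Re (conj (f x0) f)] has a maximum, so its
    first derivative vanishes there and its second derivative is nonpositive. *)
Lemma gen_square_dissipative f g h : refl f = f -> 0 <= h ->
  gen_square (B := wave_gen q) 0 f g -> norm f <= norm (minus f (scal h g)).
Proof.
intros he hh hg; apply gen_square_even in hg as [f1 [f2 [d1 [d2 ->]]]]; [|easy].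
destruct (per_max f) as [x0 [E0 M]].
set (u := fst (f x0)); set (v := snd (f x0)).
set (dot := fun z : C => u * fst z + v * snd z).
assert (dr : forall (k : R -> C) x (l : C),
  is_derive_C k x l -> is_derive (fun x => dot (k x)) x (dot l)).
{ intros k x l hk; apply is_derive_C_iff in hk as [a1 a2].
  apply (is_derive_plus (V := R_NormedModule));
    [apply (is_derive_scal (fun t => fst (k t))) | apply (is_derive_scal (fun t => snd (k t)))];
    easy. }
assert (r2 : dot (f x0) = Cmod (f x0) ^ 2).
{ rewrite Cmod_sqr; unfold dot, u, v; ring. }
assert (dl : forall z, dot z <= Cmod (f x0) * Cmod z).
{ intros z.
  replace (dot z) with (fst ((u, (- v)%R) * z)%C) by (unfold dot; simpl; ring).
  replace (Cmod (f x0)) with (Cmod (u, - v)).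
  - rewrite <- Cmod_mult; apply Rle_trans with (1 := Rle_abs _).
    apply Rle_trans with (2 := Rmax_Cmod _), Rmax_l.
  - unfold Cmod; f_equal; unfold u, v; simpl; ring. }
destruct (second_derivative_test (fun x => dot (f x)) (fun x => dot (f1 x)) x0
  (dot (f2 x0))) as [z1 z2].
- intros x; apply (dr f), d1.
- apply (dr f1), d2.
- intros x; apply Rle_trans with (1 := dl (f x)); rewrite r2; simpl; rewrite Rmult_1_r.
  apply Rmult_le_compat_l; [apply Cmod_ge_0 | apply M].
- set (y := minus f (scal h (minus (plus f2 (per_mult q f1)) (scal 0 f)))).
  assert (ey : dot (y x0) = dot (f x0) - h * dot (f2 x0)).
  { unfold y; rewrite per_minus_apply, per_scal_apply, per_minus_apply,
      per_plus_apply, per_scal_apply, per_mult_apply.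
    transitivity (dot (f x0) - h * (dot (f2 x0) + fst (q x0) * dot (f1 x0)));
      [|rewrite z1; ring].
    pose proof (q_real x0) as hq; unfold dot.
    destruct (q x0) as [qr qi]; simpl in *; rewrite hq; ring. }
  pose proof (dl (y x0)) as k1; pose proof (per_norm_bound y x0) as k2.
  pose proof (Cmod_ge_0 (f x0)) as k3.
  assert (k4 : 0 <= h * - dot (f2 x0)) by (apply Rmult_le_pos; lra).
  rewrite E0; destruct k3 as [k3|k3]; [|rewrite <- k3; apply per_norm_ge_0].
  apply Rmult_le_reg_l with (1 := k3).
  apply Rle_trans with (Cmod (f x0) * Cmod (y x0)).
  + apply Rle_trans with (2 := k1); rewrite ey, r2; simpl; lra.
  + apply Rmult_le_compat_l; [lra | exact k2].
Qed.

(** Over [n] equal steps the quadratic errors add up to order [/ n]. *)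
Lemma quadratic_increments (phi : R -> R) (s t c : R) : s <= t ->
  (forall u v, s <= u <= v -> v <= t -> phi v <= phi u + c * (v - u) ^ 2) ->
  phi t <= phi s.
Proof.
intros hst h; apply le_epsilon; intros eps he.
set (A := Rabs c * (t - s) ^ 2).
assert (hA : 0 <= A) by (apply Rmult_le_pos; [apply Rabs_pos | apply pow2_ge_0]).
destruct (INR_archimed eps A he) as [n hn].
assert (hn' : A < eps * INR (S n)).
{ rewrite S_INR; lra. }
set (N := INR (S n)) in *.
assert (hN : 0 < N) by (unfold N; apply lt_0_INR; lia).
set (d := (t - s) / N).
assert (hd : 0 <= d) by (apply Rdiv_le_0_compat; lra).
assert (K : forall k, (k <= S n)%nat ->
  phi (s + INR k * d) <= phi s + INR k * (Rabs c * d ^ 2)).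
{ induction k as [|k IH]; intros hk.
  - simpl; replace (s + 0 * d) with s by ring; lra.
  - specialize (IH ltac:(lia)); rewrite S_INR.
    assert (hk1 : INR k + 1 <= N).
    { rewrite <- S_INR; unfold N; now apply le_INR. }
    pose proof (pos_INR k).
    assert (b1 : 0 <= INR k * d) by (apply Rmult_le_pos; lra).
    assert (b2 : (INR k + 1) * d <= t - s).
    { replace (t - s) with (N * d) by (unfold d; field; lra).
      now apply Rmult_le_compat_r. }
    pose proof (h (s + INR k * d) (s + (INR k + 1) * d) ltac:(lra) ltac:(lra)) as q1.
    replace (s + (INR k + 1) * d - (s + INR k * d)) with d in q1 by ring.
    assert (c * d ^ 2 <= Rabs c * d ^ 2).
    { apply Rmult_le_compat_r; [apply pow2_ge_0 | apply Rle_abs]. }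
    lra. }
specialize (K (S n) (le_n _)); fold N in K.
replace (s + N * d) with t in K by (unfold d; field; lra).
apply Rle_trans with (1 := K); apply Rplus_le_compat_l.
replace (N * (Rabs c * d ^ 2)) with (A / N) by (unfold A, d; field; lra).
apply Rmult_le_reg_r with N; [easy|].
replace (A / N * N) with A by (field; lra); lra.
Qed.

Hypothesis q_odd : refl q = opp q.

Local Notation S0 := (sg (cs := cscal) (W := wave q) 0).
Local Notation wgq := (wave_wave_group q).

Lemma sg_even mu (z : C) f : 0 <= mu -> 0 < fst z -> refl f = f ->
  refl (sg (cs := cscal) (W := wave q) mu z f) = sg (cs := cscal) (W := wave q) mu z f.
Proof.
intros hmu hz he.
rewrite (sg_intertwine wgq mu hmu refl z f hz refl_linear); [now rewrite he | |].
- intros c x; apply Per_ext; easy.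
- apply (refl_wave q q_odd).
Qed.

(** A backward step gives [|u t| <= |u t - h (B^2 u) t| <= |u (t - h)| + O(h^2)], where
    [u t] is the orbit of [f]. *)
Lemma sg_contraction t f : 0 < t -> refl f = f -> norm (S0 (RtoC t) f) <= norm f.
Proof.
intros ht he; apply le_epsilon; intros eps hpos.
destruct (sg_limit wgq 0 (Rle_refl 0) f eps hpos) as [d [hd H]].
set (s := Rmin (t / 2) (d / 2)).
pose proof (Rmin_l (t / 2) (d / 2)) as m1; pose proof (Rmin_r (t / 2) (d / 2)) as m2.
assert (hs : 0 < s) by (apply Rmin_pos; lra).
fold s in m1, m2.
specialize (H (RtoC s) (in_cone_real s hs) ltac:(rewrite Cmod_R, Rabs_right; lra)).
assert (n1 : norm (S0 (RtoC s) f) <= norm f + eps).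
{ replace (S0 (RtoC s) f) with (plus f (minus (S0 (RtoC s) f) f)) by module_eq PV.
  apply Rle_trans with (1 := vnorm_plus (V := PV) _ _).
  now apply Rplus_le_compat_l. }
apply Rle_trans with (2 := n1).
destruct (sg_taylor wgq 0 (Rle_refl 0) s (t + 1) hs ltac:(lra)) as [M [hM T]].
apply (quadratic_increments (fun r => norm (S0 (RtoC r) f)) s t (M * norm f)); [lra|].
intros u v huv hvt.
assert (hv : 0 < v) by lra.
pose proof (sg_gen wgq 0 (Rle_refl 0) (RtoC v) f hv) as G.
pose proof (gen_square_dissipative _ _ (v - u)
  (sg_even 0 (RtoC v) f (Rle_refl 0) hv he) ltac:(lra) G) as D.
specialize (T (RtoC v) (RtoC (- (v - u))) f).
rewrite <- RtoC_plus, !Cmod_R in T.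
replace (v + - (v - u)) with u in T by ring.
rewrite Rabs_Ropp, !Rabs_right in T by lra.
specialize (T ltac:(simpl; lra) ltac:(simpl; lra) ltac:(lra) ltac:(lra)).
apply Rle_trans with (1 := D).
match type of T with norm ?X <= _ => set (X0 := X) in T end.
match goal with |- norm ?Y <= _ => replace Y with (minus (S0 (RtoC u) f) X0) end.
- apply Rle_trans with (1 := vnorm_minus (V := PV) _ _).
  apply Rplus_le_compat_l; apply Rle_trans with (1 := T).
  rewrite Rmult_comm; apply Rle_refl.
- unfold X0; rewrite (wg_cs_real wgq); module_eq PV.
Qed.

Lemma sg_exp_decay mu t f : 0 <= mu -> 0 < t -> refl f = f ->
  norm (sg (cs := cscal) (W := wave q) mu (RtoC t) f) <= exp (- mu * t) * norm f.
Proof.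
intros hmu ht he.
assert (hz : 0 < fst (RtoC t)) by easy.
rewrite (sg_mu wgq mu (RtoC t) f hz).
replace (heat_op 0 (RtoC t) f) with (cscal heat_mass (S0 (RtoC t) f)).
- rewrite (wg_cs_mul wgq), <- Cmult_assoc, Cinv_l, Cmult_1_r
    by apply heat_mass_neq_0.
  apply Rle_trans with (1 := cscal_norm _ _).
  rewrite Cmod_cexp; simpl fst.
  replace (- mu * t - 0 * 0) with (- mu * t) by ring.
  apply Rmult_le_compat_l; [apply Rlt_le, exp_pos | now apply sg_contraction].
- unfold sg; rewrite (wg_cs_mul wgq), Cinv_r by apply heat_mass_neq_0.
  rewrite (wg_cs_real wgq); module_eq PV.
Qed.
End EvenDrift.

(** * Folding the line onto the interval *)

(** The distance from [x] to the nearest even integer. *)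
Definition fold_dist (x : R) : R := Rabs (x - 2 * IZR (up ((x - 1) / 2))).

Lemma fold_dist_attained x : exists k : Z, fold_dist x = Rabs (x - 2 * IZR k).
Proof. now exists (up ((x - 1) / 2)). Qed.

Lemma fold_dist_range x : 0 <= fold_dist x <= 1.
Proof.
unfold fold_dist; split; [apply Rabs_pos|].
destruct (archimed ((x - 1) / 2)); apply Rabs_le; lra.
Qed.

Lemma fold_dist_min x (m : Z) : fold_dist x <= Rabs (x - 2 * IZR m).
Proof.
pose proof (proj2 (fold_dist_range x)) as h1.
unfold fold_dist in *; set (k := up ((x - 1) / 2)) in *.
destruct (Z.lt_trichotomy m k) as [h|[->|h]]; [|apply Rle_refl|].
- assert (IZR m + 1 <= IZR k) by (rewrite <- plus_IZR; apply IZR_le; lia).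
  pose proof (proj1 (Rabs_le_between _ _) h1).
  pose proof (Rle_abs (x - 2 * IZR m)); lra.
- assert (IZR k + 1 <= IZR m) by (rewrite <- plus_IZR; apply IZR_le; lia).
  pose proof (proj1 (Rabs_le_between _ _) h1).
  pose proof (Rle_abs (- (x - 2 * IZR m))) as h2; rewrite Rabs_Ropp in h2; lra.
Qed.

Lemma fold_dist_lipschitz x y : Rabs (fold_dist y - fold_dist x) <= Rabs (y - x).
Proof.
assert (K : forall x y, fold_dist y - fold_dist x <= Rabs (y - x)).
{ clear; intros x y; destruct (fold_dist_attained x) as [k ->].
  pose proof (fold_dist_min y k); pose proof (Rabs_triang (y - x) (x - 2 * IZR k)).
  replace (y - x + (x - 2 * IZR k)) with (y - 2 * IZR k) in * by ring; lra. }
apply Rabs_le; split; [|apply K].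
specialize (K y x); rewrite Rabs_minus_sym in K; lra.
Qed.

Lemma fold_dist_shift x : fold_dist (x + 2) = fold_dist x.
Proof.
apply Rle_antisym.
- destruct (fold_dist_attained x) as [k ->].
  replace (x - 2 * IZR k) with (x + 2 - 2 * IZR (k + 1))
    by (rewrite plus_IZR; ring); apply fold_dist_min.
- destruct (fold_dist_attained (x + 2)) as [k ->].
  replace (x + 2 - 2 * IZR k) with (x - 2 * IZR (k - 1))
    by (rewrite minus_IZR; ring); apply fold_dist_min.
Qed.

Lemma fold_dist_opp x : fold_dist (- x) = fold_dist x.
Proof.
assert (K : forall x, fold_dist (- x) <= fold_dist x).
{ clear; intros x; destruct (fold_dist_attained x) as [k ->].
  rewrite <- Rabs_Ropp; replace (- (x - 2 * IZR k)) with (- x - 2 * IZR (- k))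
    by (rewrite opp_IZR; ring); apply fold_dist_min. }
apply Rle_antisym; [apply K|].
rewrite <- (Ropp_involutive x) at 1; apply K.
Qed.

Lemma fold_dist_id x : 0 <= x <= 1 -> fold_dist x = x.
Proof.
intros hx; apply Rle_antisym.
- pose proof (fold_dist_min x 0) as h; rewrite Rmult_0_r, Rminus_0_r, Rabs_right in h;
    lra.
- destruct (fold_dist_attained x) as [k ->].
  destruct (Z_lt_le_dec 0 k) as [h|h].
  + assert (1 <= IZR k) by (apply IZR_le; lia).
    pose proof (Rle_abs (- (x - 2 * IZR k))) as h2; rewrite Rabs_Ropp in h2; lra.
  + assert (IZR k <= 0) by (apply IZR_le; lia).
    pose proof (Rle_abs (x - 2 * IZR k)); lra.
Qed.

Definition fold_UI (x : R) : UI := exist _ (fold_dist x) (fold_dist_range x).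

Lemma UI_eq (x y : UI) : (x : R) = y -> x = y.
Proof. destruct x, y; intros e; now apply subset_eq_compat. Qed.

Lemma UI_range (x : UI) : 0 <= (x : R) <= 1.
Proof. exact (proj2_sig x). Qed.

Lemma fold_UI_id (x : UI) : fold_UI x = x.
Proof. apply UI_eq, fold_dist_id, UI_range. Qed.

Definition even_ext (f : CUI) : Per.
Proof.
refine (mkPer (fun x => f (fold_UI x)) _ _).
- intros x; apply continuous_R_Cmod; intros eps he.
  destruct (proj1 (continuous_UI_Cmod f (fold_UI x)) (CUI_cont f _) eps he) as [d [hd H]].
  exists d; split; [easy|]; intros y hy; apply H.
  now apply Rle_lt_trans with (1 := fold_dist_lipschitz x y).
- intros x; f_equal; apply UI_eq, fold_dist_shift.
Defined.

Definition restr (g : Per) : CUI.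
Proof.
refine (mkCUI (fun x : UI => g x) _).
intros x; apply continuous_UI_Cmod; intros eps he.
destruct (proj1 (continuous_R_Cmod g x) (per_cont g x) eps he) as [d [hd H]].
exists d; split; [easy|]; intros y hy; now apply H.
Defined.

Lemma restr_even_ext f : restr (even_ext f) = f.
Proof. apply CUI_ext; intros x; simpl; f_equal; apply fold_UI_id. Qed.

Lemma even_ext_UI (f : CUI) (x : UI) : even_ext f x = f x.
Proof. simpl; f_equal; apply fold_UI_id. Qed.

Lemma even_ext_even f : refl (even_ext f) = even_ext f.
Proof.
apply Per_ext; intros x; rewrite refl_apply; simpl; f_equal.
apply UI_eq, fold_dist_opp.
Qed.

Lemma even_ext_restr g : refl g = g -> even_ext (restr g) = g.
Proof.
intros he; apply Per_ext; intros x.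
change (g (fold_dist x) = g x).
destruct (fold_dist_attained x) as [k ->].
replace (g x) with (g (x - 2 * IZR k)).
- unfold Rabs; destruct (Rcase_abs _); [|easy].
  now rewrite <- refl_apply, he.
- rewrite <- (per_shift g (- k) x), opp_IZR; f_equal; ring.
Qed.

Lemma even_per_eq f g : refl f = f -> refl g = g -> (forall x : UI, f x = g x) -> f = g.
Proof.
intros hf hg h; rewrite <- (even_ext_restr f hf), <- (even_ext_restr g hg).
f_equal; now apply CUI_ext.
Qed.

Lemma even_ext_plus (f g : CUI) : even_ext (plus f g) = plus (even_ext f) (even_ext g).
Proof. now apply Per_ext. Qed.

Lemma even_ext_minus (f g : CUI) : even_ext (minus f g) = minus (even_ext f) (even_ext g).
Proof. now apply Per_ext. Qed.

Lemma even_ext_scal (c : C) (f : CUI) : even_ext (scal c f) = cscal c (even_ext f).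
Proof. now apply Per_ext. Qed.

Lemma norm_even_ext f : norm (even_ext f) = norm f.
Proof.
apply Rle_antisym.
- apply per_norm_intro; intros x; apply sup_norm_ub.
- apply sup_norm_le; intros x; rewrite <- even_ext_UI; apply per_norm_bound.
Qed.

Lemma norm_restr g : norm (restr g) <= norm g.
Proof. apply sup_norm_le; intros x; apply (per_norm_bound g x). Qed.

(** * Primitives of even and odd functions *)

Definition primitive (f : Per) (x : R) : C := RInt (V := CR) f 0 x.

Lemma primitive_derive f x : is_derive_C (primitive f) x (f x).
Proof. apply (is_derive_RInt_cont (V := CR) f), per_cont. Qed.

Lemma primitive_0 f : primitive f 0 = RtoC 0.
Proof. apply (RInt_point (V := CR)). Qed.

Lemma primitive_shift f x : primitive f (x + 2) =
  (primitive f x + (primitive f 1 - primitive f (-1)%R))%C.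
Proof.
assert (D : forall x, is_derive_C
  (fun x => primitive f (1 * x + 2) - primitive f x)%C x zero).
{ intros y; apply (is_derive_C_eq _ _ (@scal _ C_R_NormedModule 1 (f (1 * y + 2)%R) - f y)%C).
  - apply is_derive_Cminus; [|apply primitive_derive].
    apply (is_derive_affine (V := CR)), primitive_derive.
  - rewrite scal_C, Rmult_1_l, per_period; change (1 * f y - f y = 0)%C; ring. }
pose proof (derive_zero_const (V := CR) _ x (-1) D) as E; cbn beta in E.
replace (1 * -1 + 2) with 1 in E by ring; rewrite Rmult_1_l in E.
rewrite <- E; ring.
Qed.

Lemma primitive_reflect (f : Per) sg x : (forall x, f (- x) = (RtoC sg * f x)%C) ->
  primitive f (- x) = (RtoC (- sg) * primitive f x)%C.
Proof.
intros h.
assert (D : forall x, is_derive_C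
  (fun x => primitive f (-1 * x + 0) - RtoC (- sg) * primitive f x)%C x zero).
{ intros y; apply (is_derive_C_eq _ _
    (@scal _ C_R_NormedModule (-1) (f (-1 * y + 0)%R) - RtoC (- sg) * f y)%C).
  - apply is_derive_Cminus.
    + apply (is_derive_affine (V := CR)), primitive_derive.
    + apply is_derive_Cscal, primitive_derive.
  - rewrite scal_C; replace (-1 * y + 0) with (- y) by ring.
    rewrite h, RtoC_opp, RtoC_m1; match goal with |- _ = ?z => change z with (RtoC 0) end; ring. }
pose proof (derive_zero_const (V := CR) _ x 0 D) as E; cbn beta in E.
replace (-1 * 0 + 0) with 0 in E by ring.
replace (-1 * x + 0) with (- x) in E by ring.
rewrite primitive_0 in E.
replace (primitive f (- x)) with (primitive f (- x) - RtoC (- sg) * primitive f x +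
  RtoC (- sg) * primitive f x)%C by ring.
rewrite E; ring.
Qed.

(** For an even [f] the integral over a period is twice [primitive f 1]. *)
Lemma odd_primitive f : refl f = f -> primitive f 1 = RtoC 0 ->
  exists g : Per, (forall x, g x = primitive f x) /\ per_derive g f /\ refl g = opp g.
Proof.
intros he h1.
assert (R : forall x, primitive f (- x) = (- primitive f x)%C).
{ intros x; rewrite (primitive_reflect f 1).
  - rewrite RtoC_opp; ring.
  - intros y; rewrite <- refl_apply, he; ring. }
assert (hc : forall x, continuous (primitive f) x)
  by (intros x; eapply continuous_C_derive, primitive_derive).
assert (hp : forall x, primitive f (x + 2) = primitive f x).
{ intros x; rewrite primitive_shift; replace (-1) with (- (1)) by ring.
  rewrite R, h1; ring. }
exists (mkPer _ hc hp); split; [easy | split]; [intros x; apply primitive_derive|].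
apply Per_ext; intros x; rewrite refl_apply; apply R.
Qed.

Lemma even_primitive f c : refl f = opp f ->
  exists g : Per, (forall x, g x = (c + primitive f x)%C) /\ per_derive g f /\ refl g = g.
Proof.
intros ho.
assert (R : forall x, primitive f (- x) = primitive f x).
{ intros x; rewrite (primitive_reflect f (-1)).
  - replace (- -1) with 1 by ring; ring.
  - intros y; rewrite <- refl_apply, ho, per_opp_apply.
    rewrite RtoC_m1; ring. }
assert (D : forall x, is_derive_C (fun x => c + primitive f x)%C x (f x)).
{ intros x; apply (is_derive_C_eq _ _ (0 + f x)%C); [|ring].
  apply is_derive_Cplus; [apply (is_derive_const (V := C_R_NormedModule))|].
  apply primitive_derive. }
assert (hc : forall x, continuous (fun x => c + primitive f x)%C x)
  by (intros x; eapply continuous_C_derive, D).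
assert (hp : forall x, (c + primitive f (x + 2)%R = c + primitive f x)%C).
{ intros x; rewrite primitive_shift; replace (-1) with (- (1)) by ring.
  rewrite R; ring. }
exists (mkPer _ hc hp); split; [easy | split]; [exact D|].
apply Per_ext; intros x; rewrite refl_apply; simpl; now rewrite R.
Qed.

(** * Derivatives on the closed interval *)

Lemma is_derive_UI_iff (V : CompleteNormedModule R_AbsRing) (f : UI -> V) (x : UI) (l : V) :
  is_derive_UI f x l <->
  forall eps, 0 < eps -> exists d, 0 < d /\ forall y : UI, Rabs (y - x) < d ->
    norm (minus (minus (f y) (f x)) (scal (y - x) l)) <= eps * Rabs (y - x).
Proof.
assert (E : forall y : UI, y <> x -> minus (minus (f y) (f x)) (scal (y - x) l) =
  scal (y - x) (minus (scal (/ (y - x)) (minus (f y) (f x))) l)).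
{ intros y hy; assert ((y : R) <> x) by (intros e; now apply hy, UI_eq).
  module_eq V; field; lra. }
assert (N : forall (r : R) (v : V), r <> 0 -> norm (scal r v) = Rabs r * norm v).
{ intros r v hr; apply Rle_antisym; [apply vnorm_scal|].
  replace v with (scal (/ r) (scal r v)) at 1 by (module_eq V; field; easy).
  assert (h : 0 < Rabs r) by now apply Rabs_pos_lt.
  apply Rle_trans with (Rabs r * (Rabs (/ r) * norm (scal r v))).
  - apply Rmult_le_compat_l; [lra | apply vnorm_scal].
  - rewrite Rabs_inv; right; field; lra. }
unfold is_derive_UI.
split.
- intros h eps he.
  destruct (proj1 (filterlim_locally_ball_norm (K := R_AbsRing) (U := V) _ _) h
    (mkposreal eps he)) as [d H].
  exists d; split; [apply cond_pos|]; intros y hy.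
  destruct (Req_dec y x) as [e|e].
  + apply UI_eq in e; subst y; rewrite Rminus_diag, Rabs_R0, Rmult_0_r.
    match goal with |- norm ?X <= 0 => replace X with (zero : V) by module_eq V end.
    rewrite vnorm_zero; lra.
  + assert (hne : y <> x) by (intros e'; now subst y).
    rewrite E by easy; rewrite N by lra.
    rewrite Rmult_comm; apply Rmult_le_compat_r; [apply Rabs_pos|].
    apply Rlt_le, (H y hy hne).
- intros h; apply (filterlim_locally_ball_norm (K := R_AbsRing) (U := V)); intros eps.
  destruct (h (eps / 2)) as [d [hd H]]; [pose proof (cond_pos eps); lra|].
  exists (mkposreal d hd); intros y0 hy hne; pose (y := y0 : UI); fold y in hy, hne |- *.
  clearbody y; clear y0; specialize (H y hy); rewrite E in H by easy.
  assert (hr : (y : R) - x <> 0) by (intros e; apply hne, UI_eq; lra).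
  rewrite N in H by easy.
  assert (hp : 0 < Rabs (y - x)) by now apply Rabs_pos_lt.
  rewrite Rmult_comm in H; apply Rmult_le_reg_r in H; [|easy].
  apply Rle_lt_trans with (1 := H); pose proof (cond_pos eps); lra.
Qed.

Lemma is_derive_UI_unique (V : CompleteNormedModule R_AbsRing) (f : UI -> V) x (l l' : V) :
  is_derive_UI f x l -> is_derive_UI f x l' -> l = l'.
Proof.
intros h h'.
assert (Z : minus l l' = zero).
{ apply vnorm_eq_0, le_epsilon; intros eps he; rewrite Rplus_0_l.
  destruct (proj1 (is_derive_UI_iff V f x l) h (eps / 2)) as [d [hd H]]; [lra|].
  destruct (proj1 (is_derive_UI_iff V f x l') h' (eps / 2)) as [d' [hd' H']]; [lra|].
  set (e := Rmin (1 / 2) (Rmin (d / 2) (d' / 2))).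
  assert (e0 : 0 < e) by (repeat apply Rmin_pos; lra).
  assert (e1 : e <= 1 / 2) by apply Rmin_l.
  assert (e2 : e <= d / 2) by (eapply Rle_trans; [apply Rmin_r | apply Rmin_l]).
  assert (e3 : e <= d' / 2) by (eapply Rle_trans; [apply Rmin_r | apply Rmin_r]).
  assert (hy : exists y : UI, Rabs (y - x) = e).
  { pose proof (UI_range x) as hx; destruct (Rle_dec x (1 / 2)) as [c|c].
    - assert (r : 0 <= x + e <= 1) by lra.
      exists (exist _ (x + e) r); change (Rabs (x + e - x) = e).
      rewrite Rabs_right; lra.
    - assert (r : 0 <= x - e <= 1) by lra.
      exists (exist _ (x - e) r); change (Rabs (x - e - x) = e).
      rewrite Rabs_left; lra. }
  destruct hy as [y hy].
  specialize (H y ltac:(lra)); specialize (H' y ltac:(lra)); rewrite hy in H, H'.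
  assert (k : norm (scal (y - x) (minus l l')) <= eps * e).
  { replace (scal (y - x) (minus l l')) with
      (minus (minus (minus (f y) (f x)) (scal (y - x) l'))
        (minus (minus (f y) (f x)) (scal (y - x) l))) by module_eq V.
    apply Rle_trans with (1 := vnorm_minus _ _); lra. }
  assert (hr : (y : R) - x <> 0).
  { intros e'; rewrite e', Rabs_R0 in hy; lra. }
  replace (minus l l') with (scal (/ (y - x)) (scal (y - x) (minus l l')))
    by (module_eq V; field; easy).
  apply Rle_trans with (1 := vnorm_scal _ _).
  rewrite Rabs_inv, hy; apply Rle_trans with (/ e * (eps * e)).
  - apply Rmult_le_compat_l; [apply Rlt_le, Rinv_0_lt_compat; lra | easy].
  - right; field; lra. }
transitivity (plus (minus l l') l'); [module_eq V|].
rewrite Z; module_eq V.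
Qed.

Lemma C1_deriv_restr f g : per_derive f g -> C1_deriv (restr f) (restr g).
Proof.
intros h x; apply (is_derive_UI_iff CR); intros eps he.
destruct (proj1 (is_derive_norm_iff (V := CR) f x (g x)) (h x) eps he) as [d [hd H]].
exists d; split; [easy|]; intros y hy; exact (H y hy).
Qed.

(** The difference of the two sides, folded onto the line, has derivative zero
    everywhere, also at the integers, since folding is a contraction. *)
Lemma UI_derive_primitive (f : UI -> C) (f1 : CUI) (x : UI) :
  (forall x, is_derive_UI (V := C_R_NormedModule) f x (f1 x)) ->
  f x = (f UI0 + primitive (even_ext f1) x)%C.
Proof.
intros h.
set (D := fun y : UI => (f y - primitive (even_ext f1) y)%C).
assert (dD : forall t, is_derive_C (fun t => D (fold_UI t)) t zero).
{ intros t; apply (is_derive_norm_iff (V := CR)); intros eps he.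
  set (u := fold_UI t).
  destruct (proj1 (is_derive_UI_iff CR f u (f1 u)) (h u) (eps / 2)) as [d1 [hd1 H1]]; [lra|].
  destruct (proj1 (is_derive_norm_iff (V := CR) _ _ _)
    (primitive_derive (even_ext f1) u) (eps / 2)) as [d2 [hd2 H2]]; [lra|].
  exists (Rmin d1 d2); split; [now apply Rmin_pos|].
  intros s hs; apply Rmin_Rgt in hs as [hs1 hs2].
  pose proof (fold_dist_lipschitz t s) as hl.
  set (v := fold_UI s).
  change (Rabs (v - u) <= Rabs (s - t)) in hl.
  specialize (H1 v ltac:(lra)); specialize (H2 v ltac:(lra)).
  rewrite even_ext_UI in H2.
  match type of H1 with norm ?X <= _ => set (A1 := X) in H1 end.
  match type of H2 with norm ?X <= _ => set (A2 := X) in H2 end.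
  match goal with |- norm ?X <= _ => replace X with (minus A1 A2) end.
  - apply Rle_trans with (1 := vnorm_minus (V := CR) A1 A2).
    pose proof (Rmult_le_compat_l (eps / 2) _ _ ltac:(lra) hl).
    apply Rle_trans with (eps / 2 * Rabs (v - u) + eps / 2 * Rabs (v - u)); [|lra].
    now apply Rplus_le_compat.
  - unfold A1, A2, D; fold u v.
    set (p1 := primitive (even_ext f1) v); set (p2 := primitive (even_ext f1) u).
    change (minus (f v - p1)%C (f u - p2)%C) with
      (minus (minus (f v : CR) p1) (minus (f u : CR) p2)).
    module_eq CR. }
pose proof (derive_zero_const (V := CR) (fun t => D (fold_UI t)) x 0 dD) as E.
cbn beta in E; rewrite fold_UI_id in E.
assert (e0 : fold_UI 0 = UI0).
{ apply UI_eq; change (fold_dist 0 = 0); apply fold_dist_id; lra. }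
rewrite e0 in E; unfold D in E.
change (UI_val UI0) with 0 in E; rewrite primitive_0 in E.
replace (f x) with (f x - primitive (even_ext f1) x + primitive (even_ext f1) x)%C by ring.
rewrite E; ring.
Qed.

(** * The operator on the interval *)

(** The drift coefficient extends to an odd periodic function because it is the
    primitive of the even extension of its derivative, which has mean zero. *)
Lemma odd_extension (p px : UI -> R)
  (hpx : forall x : UI, is_derive_UI (V := R_NormedModule) p x (px x))
  (hpx_cont : forall x : UI, continuous px x) (hp0 : p UI0 = 0) (hp1 : p UI1 = 0) :
  exists q : Per, refl q = opp q /\ (forall x, snd (q x) = 0) /\
    forall x : UI, q x = RtoC (p x).
Proof.
assert (c : forall x : UI, continuous (fun x => RtoC (px x)) x).
{ intros x; apply (continuous_comp px RtoC); [apply hpx_cont|].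
  apply (continuous_RtoC (fun r => r)), continuous_id. }
set (pxc := mkCUI _ c).
assert (d : forall x, is_derive_UI (V := C_R_NormedModule) (fun x => RtoC (p x)) x (pxc x)).
{ intros x; apply (is_derive_UI_iff CR); intros eps he.
  destruct (proj1 (is_derive_UI_iff R_CompleteNormedModule p x (px x)) (hpx x) eps he)
    as [e [h0 H]].
  exists e; split; [easy|]; intros y hy; specialize (H y hy).
  apply Rle_trans with (2 := H).
  match goal with |- norm ?X <= _ => replace X with
    (RtoC (minus (minus (p y) (p x)) (scal ((y : R) - x) (px x)))) end.
  - apply Rle_trans with (1 := Req_le _ _ (norm_C _)); rewrite Cmod_R; apply Rle_refl.
  - change (minus (minus (p y) (p x)) (scal ((y : R) - x) (px x))) with
      (p y - p x - ((y : R) - x) * px x).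
    rewrite !RtoC_minus, RtoC_mult.
    rewrite RtoC_minus.
    change (p y - p x - (y - x) * px x =
      p y - p x - @scal _ C_R_NormedModule ((y : R) - x)%R (RtoC (px x)))%C.
    now rewrite scal_C, RtoC_minus. }
assert (E : forall x : UI, primitive (even_ext pxc) x = RtoC (p x)).
{ intros x; pose proof (UI_derive_primitive _ pxc x d) as E; cbn beta in E.
  rewrite hp0 in E; rewrite E; ring. }
destruct (odd_primitive (even_ext pxc)) as [q [h1 [_ h2]]].
- apply even_ext_even.
- pose proof (E UI1) as e1; rewrite hp1 in e1; exact e1.
- exists q; split; [easy | split].
  + intros x; rewrite h1; unfold primitive.
    rewrite (linear_RInt (U := CR) (V := R_CompleteNormedModule) snd).
    * rewrite (RInt_ext _ (fun _ => zero)) by easy.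
      rewrite RInt_const; apply Rmult_0_r.
    * apply (is_linear_snd (U := R_NormedModule) (V := R_NormedModule)).
    * apply per_cont.
  + intros x; now rewrite h1, E.
Qed.

Section Interval.
Variables (mu : R) (p : UI -> R) (q : Per).
Hypothesis q_odd : refl q = opp q.
Hypothesis q_p : forall x : UI, q x = RtoC (p x).

Lemma odd_at_0 f : refl f = opp f -> f 0 = RtoC 0.
Proof.
intros h; assert (e : f 0 = (- f 0)%C).
{ rewrite <- per_opp_apply, <- h, refl_apply; f_equal; ring. }
destruct (f 0) as [a b]; unfold Copp in e; simpl in e; injection e; intros.
unfold RtoC; f_equal; lra.
Qed.

Lemma odd_at_1 f : refl f = opp f -> f 1 = RtoC 0.
Proof.
intros h; assert (e : f 1 = (- f 1)%C).
{ rewrite <- per_opp_apply, <- h, refl_apply, <- (per_period f (- (1))); f_equal; ring. }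
destruct (f 1) as [a b]; unfold Copp in e; simpl in e; injection e; intros.
unfold RtoC; f_equal; lra.
Qed.

Lemma refl_per_mult f g : refl (per_mult f g) = per_mult (refl f) (refl g).
Proof. now apply Per_ext. Qed.

(** The derivatives of a function in the domain extend to an odd and an even periodic
    function: the Neumann conditions say that the second derivative has mean zero and
    that its odd primitive restricts to the first derivative. *)
Lemma operator_gen_square f g :
  op_add (A_op mu) (B_op p) f g <->
  gen_square (B := wave_gen q) mu (even_ext f) (even_ext g).
Proof.
rewrite gen_square_even by apply even_ext_even.
split.
- intros [ga [gb [[f1 [f2 [h1 [h2 [e0 [e1 ->]]]]]] [[f1' [h1' hb]] ->]]]].
  assert (hf1 : forall x, f1' x = f1 x).
  { intros x; apply (is_derive_UI_unique CR f x); [apply h1' | apply h1]. }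
  assert (E2 : forall x : UI, primitive (even_ext f2) x = f1 x).
  { intros x; pose proof (UI_derive_primitive _ f2 x h2) as E.
    rewrite e0 in E; rewrite E; ring. }
  destruct (odd_primitive (even_ext f2)) as [F1 [hF1 [dF1 oF1]]].
  { apply even_ext_even. }
  { rewrite <- e1; apply (E2 UI1). }
  destruct (even_primitive F1 (f UI0) oF1) as [F [hF [dF eF]]].
  assert (EF : even_ext f = F).
  { apply even_per_eq; [apply even_ext_even | easy|].
    intros x; rewrite hF, even_ext_UI, (UI_derive_primitive _ f1 x h1); f_equal.
    apply (RInt_ext (V := CR)); intros t ht.
    pose proof (UI_range x) as hx; rewrite Rmin_left, Rmax_right in ht by lra.
    assert (r : 0 <= t <= 1) by lra.
    rewrite hF1; change t with (UI_val (exist _ t r)).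
    now rewrite even_ext_UI, E2. }
  exists F1, (even_ext f2); split; [now rewrite EF | split; [exact dF1|]].
  apply even_per_eq; [apply even_ext_even | |].
  + rewrite (linear_minus _ _ _ refl_linear), (linear_plus _ refl_linear),
      (linear_scal _ refl_linear), refl_per_mult, q_odd, oF1, !even_ext_even.
    f_equal; f_equal; apply Per_ext; intros x.
    rewrite !per_mult_apply, !per_opp_apply; ring.
  + intros x.
    rewrite per_minus_apply, per_plus_apply, per_scal_apply, per_mult_apply, !even_ext_UI.
    rewrite hF1, E2, q_p.
    change ((f2 x - mu * f x) + gb x = f2 x + p x * f1 x - mu * f x)%C.
    rewrite hb, hf1; ring.
- intros [F1 [F2 [d1 [d2 E]]]].
  pose proof (per_derive_even _ _ d1 (even_ext_even f)) as oF1.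
  assert (h1 : C1_deriv f (restr F1)).
  { rewrite <- (restr_even_ext f); now apply C1_deriv_restr. }
  exists (minus (restr F2) (scal (RtoC mu) f)), (restr (per_mult q F1)).
  split; [|split].
  + exists (restr F1), (restr F2); split; [easy|].
    split; [now apply C1_deriv_restr | split; [|split; [|easy]]].
    * now apply odd_at_0.
    * now apply odd_at_1.
  + exists (restr F1); split; [easy|]; intros x; simpl; now rewrite q_p.
  + apply CUI_ext; intros x.
    rewrite <- (even_ext_UI g), E, per_minus_apply, per_plus_apply, per_scal_apply,
      even_ext_UI.
    change (F2 x + per_mult q F1 x - mu * f x = F2 x - mu * f x + per_mult q F1 x)%C.
    ring.
Qed.
End Interval.

(** * The semigroup on the interval *)

Lemma op_norm_le (X : CompleteNormedModule C_AbsRing) (T : X -> X) (M : R) :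
  (forall x, norm x <= 1 -> norm (T x) <= M) -> Rbar_le (op_norm T) M.
Proof.
intros h; unfold op_norm.
apply (proj2 (Lub_Rbar_correct _)); intros r [x [hx ->]]; exact (h x hx).
Qed.

Lemma locally_C_iff (z : C) (P : C -> Prop) :
  locally z P <-> exists d, 0 < d /\ forall w, Cmod (w - z)%C < d -> P w.
Proof.
split.
- intros h.
  destruct (locally_norm_le_locally (V := C_NormedModule) z P h) as [d H].
  exists d; split; [apply cond_pos | exact H].
- intros [d [hd H]].
  apply (locally_le_locally_norm (V := C_NormedModule)).
  now exists (mkposreal d hd).
Qed.

Lemma sector_in_cone z : sector (PI / 4) z -> in_cone z.
Proof.
intros [r [th [hr [ht ->]]]].
apply Rabs_lt_between in ht; pose proof PI_RGT_0.
assert (hc : 0 < cos th) by (apply cos_gt_0; lra).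
assert (h2 : 0 < cos (2 * th)) by (apply cos_gt_0; lra).
rewrite cos_2a in h2.
split; simpl; [now apply Rmult_lt_0_compat|].
rewrite Rabs_mult, Rabs_right by lra.
apply Rmult_le_compat_l; [lra|].
rewrite <- (Rabs_right (cos th)) by lra.
apply Rsqr_le_abs_0; unfold Rsqr; lra.
Qed.

Lemma sector_weaken d e z : d <= e -> sector d z -> sector e z.
Proof.
intros h [r [th [hr [ht ->]]]]; exists r, th; repeat split; try easy; lra.
Qed.

Lemma in_cone_neq_0 z : in_cone z -> z <> RtoC 0.
Proof. intros [h _] ->; simpl in h; lra. Qed.

Section IntervalSemigroup.
Variables (q : Per) (mu : R).
Hypothesis q_odd : refl q = opp q.
Hypothesis q_real : forall x, snd (q x) = 0.
Hypothesis mu_ge_0 : 0 <= mu.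

Local Notation wgq := (wave_wave_group q).
Local Notation sgq := (sg (cs := cscal) (W := wave q) mu).
Local Notation sgq' := (sg' (cs := cscal) (W := wave q) mu).

Definition interval_sg (z : C) (f : CUI) : CUI := restr (sgq z (even_ext f)).
Definition interval_sg' (z : C) (f : CUI) : CUI := restr (sgq' z (even_ext f)).

Lemma even_ext_interval_sg (z : C) f : 0 < fst z ->
  even_ext (interval_sg z f) = sgq z (even_ext f).
Proof.
intros hz; apply even_ext_restr, sg_even; auto using even_ext_even.
Qed.

Lemma cscal_real r f : cscal (RtoC r) f = scal r f.
Proof. apply (wg_cs_real wgq). Qed.

Lemma restr_plus f g : restr (plus f g) = plus (restr f) (restr g).
Proof. now apply CUI_ext. Qed.

Lemma restr_minus f g : restr (minus f g) = minus (restr f) (restr g).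
Proof. now apply CUI_ext. Qed.

Lemma restr_cscal c f : restr (cscal c f) = scal c (restr f).
Proof. now apply CUI_ext. Qed.

Lemma restr_linear (l : Per -> Per) : is_linear l ->
  (forall c f, l (cscal c f) = cscal c (l f)) ->
  is_linear (K := C_AbsRing) (U := CUI_NormedModule) (V := CUI_NormedModule)
    (fun f => restr (l (even_ext f))).
Proof.
intros hl hc; split.
- intros f g; rewrite even_ext_plus, (linear_plus _ hl); apply restr_plus.
- intros c f; rewrite even_ext_scal, hc; apply restr_cscal.
- destruct (linear_norm _ hl) as [M [hM H]]; exists M; split; [easy|].
  intros f; apply Rle_trans with (1 := norm_restr _).
  apply Rle_trans with (1 := H _); rewrite norm_even_ext; apply Rle_refl.
Qed.

Lemma interval_sg_linear (z : C) : 0 < fst z -> is_linear (K := C_AbsRing)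
  (U := CUI_NormedModule) (V := CUI_NormedModule) (interval_sg z).
Proof.
intros hz; apply restr_linear.
- apply (sg_linear wgq mu mu_ge_0 z hz).
- intros c f; now apply (sg_cs wgq mu mu_ge_0).
Qed.

Lemma interval_sg'_linear (z : C) : 0 < fst z -> is_linear (K := C_AbsRing)
  (U := CUI_NormedModule) (V := CUI_NormedModule) (interval_sg' z).
Proof.
intros hz; apply restr_linear.
- apply (sg'_linear wgq mu mu_ge_0 z hz).
- intros c f; now apply (sg'_cs wgq mu mu_ge_0).
Qed.

Lemma interval_sg_add (z w : C) f : in_cone z -> in_cone w ->
  interval_sg (z + w)%C f = interval_sg z (interval_sg w f).
Proof.
intros hz hw; unfold interval_sg at 1 2; rewrite even_ext_interval_sg by apply hw.
now rewrite (sg_add wgq mu mu_ge_0).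
Qed.

Lemma interval_sg_limit f eps : 0 < eps -> exists d, 0 < d /\ forall z,
  in_cone z -> Cmod z < d -> norm (minus (interval_sg z f) f) <= eps.
Proof.
intros he; destruct (sg_limit wgq mu mu_ge_0 (even_ext f) eps he) as [d [hd H]].
exists d; split; [easy|]; intros z hz hzd.
rewrite <- norm_even_ext, even_ext_minus, even_ext_interval_sg by apply hz.
now apply H.
Qed.

(** The value at zero has to be set apart, because the kernel degenerates there. *)
Definition full_sg (z : C) (f : CUI) : CUI :=
  if excluded_middle_informative (z = RtoC 0) then f else interval_sg z f.

Lemma full_sg_0 f : full_sg (RtoC 0) f = f.
Proof. unfold full_sg; now destruct (excluded_middle_informative _). Qed.

Lemma full_sg_neq z f : z <> RtoC 0 -> full_sg z f = interval_sg z f.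
Proof. intros h; unfold full_sg; now destruct (excluded_middle_informative _). Qed.

Lemma full_sg_linear z : in_cone z -> is_linear (K := C_AbsRing)
  (U := CUI_NormedModule) (V := CUI_NormedModule) (full_sg z).
Proof.
intros hz; apply is_linear_ext with (interval_sg z).
- intros f; now rewrite full_sg_neq by now apply in_cone_neq_0.
- apply interval_sg_linear, hz.
Qed.

Lemma full_sg_add z w f : in_cone z -> in_cone w ->
  full_sg (z + w)%C f = full_sg z (full_sg w f).
Proof.
intros hz hw; rewrite !full_sg_neq; try now apply in_cone_neq_0.
- now apply interval_sg_add.
- now apply in_cone_neq_0, in_cone_plus.
Qed.

Lemma full_sg_holomorphic z : in_cone z ->
  holomorphic_at (X := CUI_CompleteNormedModule) full_sg z.
Proof.
intros hz; pose proof (proj1 hz) as hz0.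
exists (interval_sg' z); split; [now apply interval_sg'_linear|].
intros eps.
pose proof (Cmod_ge_0 z) as hzm.
destruct (sg_taylor wgq mu mu_ge_0 (fst z / 2) (Cmod z + 1)) as [M [hM T]];
  [lra | lra|].
apply locally_C_iff.
assert (hd : 0 < Rmin (Rmin (fst z / 2) 1) (eps / M)).
{ repeat apply Rmin_pos; try lra; apply Rdiv_lt_0_compat; [apply cond_pos | easy]. }
exists (Rmin (Rmin (fst z / 2) 1) (eps / M)); split; [easy|].
intros w hw hne.
set (h := (w - z)%C) in *.
apply Rmin_Rgt in hw as [hw hw3]; apply Rmin_Rgt in hw as [hw1 hw2].
assert (ew : w = (z + h)%C) by (unfold h; ring).
assert (hh : h <> RtoC 0).
{ intros e; apply hne; assert (ez : w = z :> C) by (rewrite ew, e; ring).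
  exact ez. }
assert (hhp : 0 < Cmod h) by now apply Cmod_gt_0.
assert (hre : Rabs (fst h) < fst z / 2).
{ apply Rle_lt_trans with (2 := hw1), Rle_trans with (2 := Rmax_Cmod h), Rmax_l. }
apply Rabs_lt_between in hre.
assert (hw0 : fst z / 2 <= fst w).
{ rewrite ew; change (fst z / 2 <= fst z + fst h); lra. }
apply op_norm_le; intros f hf.
rewrite !full_sg_neq by
  (first [now apply in_cone_neq_0 | intros e; rewrite e in hw0; simpl in hw0; lra]).
set (F := even_ext f).
assert (E : minus (scal (/ h)%C (minus (interval_sg w f) (interval_sg z f)))
   (interval_sg' z f) =
  restr (cscal (/ h)%C (minus (minus (sgq w F) (sgq z F)) (cscal h (sgq' z F))))).
{ rewrite restr_cscal, !restr_minus, restr_cscal.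
  apply CUI_ext; intros x; fold (interval_sg w f) (interval_sg z f) (interval_sg' z f).
  change (/ h * (interval_sg w f x - interval_sg z f x) - interval_sg' z f x =
    / h * ((interval_sg w f x - interval_sg z f x) - h * interval_sg' z f x))%C.
  field; exact hh. }
apply Rle_trans with (1 := Req_le _ _ (f_equal norm E)).
apply Rle_trans with (1 := norm_restr _).
apply Rle_trans with (1 := cscal_norm _ _).
rewrite Cmod_inv by exact hh.
apply Rle_trans with (/ Cmod h * (Cmod h ^ 2 * (M * norm F))).
- apply Rmult_le_compat_l; [apply Rlt_le, Rinv_0_lt_compat; lra|].
  rewrite ew; apply T; rewrite <- ?ew; try lra.
  rewrite ew; apply Rle_trans with (1 := Cmod_triangle _ _); lra.
- assert (nF : norm F <= 1) by (unfold F; rewrite norm_even_ext; exact hf).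
  pose proof (per_norm_ge_0 F).
  apply Rgt_lt, Rlt_le in hw3.
  apply Rmult_le_compat_r with (r := M) in hw3; [|lra].
  replace (eps / M * M) with (pos eps) in hw3 by (field; lra).
  replace (/ Cmod h * (Cmod h ^ 2 * (M * norm F))) with (Cmod h * M * norm F)
    by (field; lra).
  apply Rle_trans with (2 := hw3).
  rewrite <- (Rmult_1_r (Cmod h * M)) at 2.
  apply Rmult_le_compat_l; [apply Rmult_le_pos; lra | exact nF].
Qed.

Lemma full_sg_analytic :
  analytic_of_angle (X := CUI_CompleteNormedModule) (PI / 4) full_sg.
Proof.
split; [|split; [|split; [|split]]].
- intros z hz; now apply full_sg_linear, sector_in_cone.
- apply full_sg_0.
- intros z w f hz hw; apply full_sg_add; now apply sector_in_cone.
- intros z hz; now apply full_sg_holomorphic, sector_in_cone.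
- intros d' f hd' P [eps HP].
  destruct (interval_sg_limit f (eps / 2)) as [d [hd H]].
  { pose proof (cond_pos eps); lra. }
  apply locally_C_iff; exists d; split; [easy|]; intros w hw hs.
  assert (hc : in_cone w).
  { apply sector_in_cone, sector_weaken with (2 := hs); lra. }
  apply HP; rewrite full_sg_neq by now apply in_cone_neq_0.
  apply Rle_lt_trans with (eps / 2); [|pose proof (cond_pos eps); lra].
  apply H; [easy|]; replace w with (w - RtoC 0)%C by ring; easy.
Qed.

Lemma RtoC_in_cone_or_0 t : 0 <= t -> t = 0 \/ in_cone (RtoC t).
Proof. intros [h|h]; [right; now apply in_cone_real | now left]. Qed.

Lemma full_sg_C0 :
  C0_semigroup (X := CUI_CompleteNormedModule) (fun t => full_sg (RtoC t)).
Proof.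
split; [|split; [|split]].
- intros t ht; destruct (RtoC_in_cone_or_0 t ht) as [->|h].
  + apply is_linear_ext with (fun f => f); [|apply is_linear_id].
    intros f; now rewrite full_sg_0.
  + now apply full_sg_linear.
- apply full_sg_0.
- intros s t f hs ht; rewrite RtoC_plus.
  destruct (RtoC_in_cone_or_0 s hs) as [->|h]; [now rewrite Cplus_0_l, full_sg_0|].
  destruct (RtoC_in_cone_or_0 t ht) as [->|h']; [now rewrite Cplus_0_r, full_sg_0|].
  now apply full_sg_add.
- intros f P [eps HP].
  destruct (interval_sg_limit f (eps / 2)) as [d [hd H]].
  { pose proof (cond_pos eps); lra. }
  exists (mkposreal d hd); intros t ht htp.
  change (Rabs (t - 0) < d) in ht; rewrite Rminus_0_r, Rabs_right in ht by lra.
  pose proof (in_cone_real t htp) as hc.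
  apply HP; rewrite full_sg_neq by now apply in_cone_neq_0.
  apply Rle_lt_trans with (eps / 2); [|pose proof (cond_pos eps); lra].
  apply H; [easy|]; rewrite Cmod_R, Rabs_right; lra.
Qed.

Lemma full_sg_generator f g :
  generator (X := CUI_CompleteNormedModule) (fun t => full_sg (RtoC t)) f g <->
  gen_square (B := wave_gen q) mu (even_ext f) (even_ext g).
Proof.
assert (E : forall t, 0 < t ->
  norm (minus (scal (RtoC (/ t)) (minus (full_sg (RtoC t) f) f)) g) =
  norm (minus (scal (/ t) (minus (sgq (RtoC t) (even_ext f)) (even_ext f)))
    (even_ext g))).
{ intros t ht; rewrite full_sg_neq by now apply in_cone_neq_0, in_cone_real.
  rewrite <- norm_even_ext, even_ext_minus, even_ext_scal, even_ext_minus.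
  now rewrite even_ext_interval_sg, cscal_real by easy. }
split.
- intros h; apply (right_derivative_gen wgq mu mu_ge_0); intros eps he.
  destruct (h (ball g (mkposreal eps he)) (locally_ball g _)) as [d H].
  exists d; split; [apply cond_pos|]; intros t [ht1 ht2].
  apply Rle_trans with (1 := Req_le _ _ (eq_sym (E t ht1))); apply Rlt_le.
  apply (H t); [|exact ht1].
  change (Rabs (t - 0) < d); rewrite Rminus_0_r, Rabs_right; lra.
- intros h P [eps HP].
  destruct (gen_right_derivative wgq mu mu_ge_0 _ _ h (eps / 2)) as [d [hd H]].
  { pose proof (cond_pos eps); lra. }
  exists (mkposreal d hd); intros t ht htp.
  change (Rabs (t - 0) < d) in ht; rewrite Rminus_0_r, Rabs_right in ht by lra.
  apply HP; apply Rle_lt_trans with (eps / 2); [|pose proof (cond_pos eps); lra].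
  apply Rle_trans with (1 := Req_le _ _ (E t htp)); apply H; lra.
Qed.

Lemma full_sg_stable t : 0 <= t -> Rbar_le
  (op_norm (X := CUI_CompleteNormedModule) (full_sg (RtoC t))) (1 * exp (- mu * t)).
Proof.
intros ht; apply op_norm_le; intros f hf.
assert (K : norm (full_sg (RtoC t) f) <= exp (- mu * t) * norm f).
{ destruct (RtoC_in_cone_or_0 t ht) as [->|h].
  - rewrite full_sg_0, Rmult_0_r, exp_0, Rmult_1_l; apply Rle_refl.
  - rewrite full_sg_neq by now apply in_cone_neq_0.
    apply Rle_trans with (1 := norm_restr _).
    rewrite <- norm_even_ext.
    apply (sg_exp_decay q q_real q_odd); auto using even_ext_even.
    apply h. }
apply Rle_trans with (1 := K).
pose proof (exp_pos (- mu * t)); rewrite Rmult_1_l.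
rewrite <- (Rmult_1_r (exp (- mu * t))) at 2.
apply Rmult_le_compat_l; [lra | exact hf].
Qed.
End IntervalSemigroup.

Theorem theorem3 (mu : R) (hmu : 0 < mu) (p px : UI -> R)
  (hpx : forall x : UI, is_derive_UI (V := R_NormedModule) p x (px x))
  (hpx_cont : forall x : UI, continuous px x)
  (hp0 : p UI0 = 0) (hp1 : p UI1 = 0)
  (hpx_ge : forall x : UI, px x >= - 2 * mu) :
  exists T : R -> CUI -> CUI,
    generates (op_add (A_op mu) (B_op p)) T /\
    analytic_semigroup T /\
    uniformly_exponentially_stable T.
Proof.
destruct (odd_extension p px hpx hpx_cont hp0 hp1) as [q [q_odd [q_real q_p]]].
pose proof (Rlt_le _ _ hmu) as mu_ge_0.
exists (fun t => full_sg q mu (RtoC t)); split; [|split].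
- split; [now apply full_sg_C0|].
  intros f g; rewrite full_sg_generator by easy.
  now apply operator_gen_square.
- exists (PI / 4), (full_sg q mu); pose proof PI_RGT_0.
  split; [lra | split; [now apply full_sg_analytic | easy]].
- exists 1, mu; split; [lra | split; [easy|]].
  intros t ht; now apply full_sg_stable.
Qed.
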